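(* Let the deterministic coefficients $b,\sigma,f,\Phi$ satisfy the assumptions listed in the context, let $x_0\in\mathbb{R}^n$, and let $u(t,x)=Y^{t,x}_t$ be the associated value function. Then $u$ is $\tfrac12$-Hölder continuous in $t$, locally uniformly with respect to $x$: there exists a constant $C$ such that, for every $x\in\mathbb{R}^n$ and all $t,t'\in[0,T]$, $$|u(t,x)-u(t',x)|\le C(1+|x|)\,|t-t'|^{1/2}.$$
   Context: $T>0$ is fixed, $B$ is a $d$-dimensional standard Brownian motion on a complete probability space $(\Omega,\mathcal{F},P)$, and $\mathbb{F}=\{\mathcal{F}_s\}_{0\le s\le T}$ is its natural filtration augmented by all $P$-null sets. $\mathcal{S}^2_{\mathbb{F}}(0,T;\cdot)$ denotes $\mathbb{F}$-adapted càdlàg processes $\psi$ with $E[\sup_t|\psi_t|^2]<\infty$, and $\mathcal{H}^2_{\mathbb{F}}(0,T;\mathbb{R}^d)$ denotes $\mathbb{R}^d$-valued $\mathbb{F}$-progressively measurable processes with $E\int_0^T|\psi_t|^2dt<\infty$ (similarly on subintervals). Assumptions on the (deterministic) coefficients $b:[0,T]\times\mathbb{R}^n\times\mathbb{R}^n\to\mathbb{R}^n$, $\sigma:[0,T]\times\mathbb{R}^n\times\mathbb{R}^n\to\mathbb{R}^{n\times d}$, $\Phi:\mathbb{R}^n\times\mathbb{R}^n\to\mathbb{R}$, $f:[0,T]\times\mathbb{R}^n\times\mathbb{R}^n\times\mathbb{R}\times\mathbb{R}\times\mathbb{R}^d\to\mathbb{R}$: there is a constant $C>0$ such that (1) $b,\sigma$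 are continuous, $|b(t,x',x)|+|\sigma(t,x',x)|\le C(1+|x|)$, and $|b(t,x_1',x_1)-b(t,x_2',x_2)|+|\sigma(t,x_1',x_1)-\sigma(t,x_2',x_2)|\le C(|x_1'-x_2'|+|x_1-x_2|)$ for all $t$ and all space arguments; (2) $|f(t,x_1',x_1,y_1',y_1,z_1)-f(t,x_2',x_2,y_2',y_2,z_2)|+|\Phi(x_1',x_1)-\Phi(x_2',x_2)|\le C(|x_1'-x_2'|+|x_1-x_2|+|y_1'-y_2'|+|y_1-y_2|+|z_1-z_2|)$ for all arguments; (3) $|f(t,x',x,0,0,0)|+|\Phi(x',x)|\le C(1+|x|+|x'|)$; (4) $f$ is measurable, continuous in $t$ for all $(x',x,y',y,z)$; (5) $f(t,x',x,y',y,z)$ is nondecreasing in $y'$. Fix $x_0\in\mathbb{R}^n$. $X^{0,x_0}$ is the unique solution of the mean-field SDE $dX^{0,x_0}_s=\tilde b(s,X^{0,x_0}_s)ds+\tilde\sigma(s,X^{0,x_0}_s)dB_s$, $X^{0,x_0}_0=x_0$, where $\tilde b(s,x):=E[b(s,X^{0,x_0}_s,x)]$, $\tilde\sigma(s,x):=E[\sigma(s,X^{0,x_0}_s,x)]$. For $(t,x)\in[0,T]\times\mathbb{R}^n$, $X^{t,x}$ is the unique strong solution of $dX^{t,x}_s=\tilde b(s,X^{t,x}_s)ds+\tilde\sigma(s,X^{t,x}_s)dB_s$, $s\in[t,T]$, $X^{t,x}_t=x$. $(Y^{0,x_0},Z^{0,x_0})\in\mathcal S^2_{\mathbb F}\times\mathcal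 H^2_{\mathbb F}$ is the unique solution of the mean-field BSDE $-dY^{0,x_0}_s=\tilde f(s,X^{0,x_0}_s,Y^{0,x_0}_s,Z^{0,x_0}_s)ds-Z^{0,x_0}_sdB_s$, $Y^{0,x_0}_T=\tilde\Phi(X^{0,x_0}_T)$, where $\tilde f(s,x,y,z):=E[f(s,X^{0,x_0}_s,x,Y^{0,x_0}_s,y,z)]$, $\tilde\Phi(x):=E[\Phi(X^{0,x_0}_T,x)]$. For general $(t,x)$, $(Y^{t,x},Z^{t,x})$ is the unique solution in $\mathcal S^2_{\mathbb F}\times\mathcal H^2_{\mathbb F}$ of $-dY^{t,x}_s=\tilde f(s,X^{t,x}_s,Y^{t,x}_s,Z^{t,x}_s)ds-Z^{t,x}_sdB_s$, $s\in[t,T]$, $Y^{t,x}_T=\tilde\Phi(X^{t,x}_T)$. The value function is $u(t,x):=Y^{t,x}_t$, $(t,x)\in[0,T]\times\mathbb{R}^n$; it is deterministic. *)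

(* Defs.v *)
From HB Require Import structures.
From mathcomp Require Export all_boot all_order all_algebra.
From mathcomp Require Export all_classical all_reals all_analysis.
Export Order.TTheory GRing.Theory Num.Theory.
Export numFieldNormedType.Exports.

Set Implicit Arguments.
Unset Strict Implicit.
Unset Printing Implicit Defensive.

Local Open Scope classical_set_scope.
Local Open Scope ring_scope.

(* The library norm on matrices is the sup norm and needs nonzero sizes; this
   is the Euclidean norm of vectors and the Frobenius norm of matrices. *)
Definition enorm (R : realType) (m p : nat) (A : 'M[R]_(m, p)) : R :=
  Num.sqrt (\sum_i \sum_j A i j ^+ 2).

Definition borel (V : topologicalType) : set (set V) := <<s open >>.

Definition measurable_on (U : Type) (V : topologicalType) (D : set U)
    (G : set (set U)) (g : U -> V) : Prop :=
  preimage_set_system D g (@borel V) `<=` G.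

Section Processes.
Context (R : realType) (dO : measure_display) (Om : measurableType dO)
  (P : probability Om R) (T : R) (d : nat) (B : R -> Om -> 'rV[R]_d).

Definition brownian_history (s : R) : set (set Om) :=
  <<s \bigcup_(r in `[0, s]) preimage_set_system setT (B r) (@borel _) >>.

Record brownian_motion : Prop := BrownianMotion {
  bm_measurable : forall s : R, 0 <= s <= T -> measurable_on setT measurable (B s) ;
  bm_start : {ae P, forall w, B 0 w = 0} ;
  bm_continuous : {ae P, forall w, {within `[0, T], continuous (B^~ w)}} ;
  bm_indep : forall s t : R, 0 <= s <= t -> t <= T ->
    forall (G : set Om) (A : set 'rV[R]_d), brownian_history s G -> borel A ->
    P (G `&` (fun w => B t w - B s w)%R @^-1` A)
      = (P G * P ((fun w => B t w - B s w)%R @^-1` A))%E ;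
  (* increments are N(0, (t - s) Id): the coordinates are independent, and
     [normal_prob] is parametrised by the standard deviation *)
  bm_gaussian : forall s t : R, 0 <= s < t -> t <= T ->
    forall A : 'I_d -> set R, (forall j, measurable (A j)) ->
    P [set w | forall j, A j (B t w 0 j - B s w 0 j)%R]
      = (\prod_(j < d) normal_prob 0 (Num.sqrt (t - s)) (A j))%E }.

Definition filtration (s : R) : set (set Om) :=
  <<s brownian_history s `|` P.-negligible >>.

(* Processes are functions of all real times; only their values on the interval
   [t, T] of interest are constrained. *)

Definition adapted (V : topologicalType) (t : R) (psi : R -> Om -> V) : Prop :=
  forall s : R, t <= s <= T -> measurable_on setT (filtration s) (psi s).

Definition cadlag (V : topologicalType) (t : R) (g : R -> V) : Prop :=
  (forall s : R, t <= s < T -> g r @[r --> s^'+] --> g s) /\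
  (forall s : R, t < s <= T -> exists l : V, g r @[r --> s^'-] --> l).

(* [N] is the norm of the state space [V]. *)
Definition in_S2 (V : topologicalType) (N : V -> R) (t : R)
    (psi : R -> Om -> V) : Prop :=
  [/\ adapted t psi,
      forall w, cadlag t (psi^~ w) &
      (\int[P]_w ereal_sup [set (N (psi s w) ^+ 2)%:E | s in `[t, T]] < +oo)%E].

Definition progressive (V : topologicalType) (t : R) (psi : R -> Om -> V) :
    Prop :=
  forall s : R, t <= s <= T ->
    measurable_on (`[t, s] `*` setT)
      <<s [set A `*` G | A in @borel R & G in filtration s] >>
      (fun p : R * Om => psi p.1 p.2).

Definition in_H2 (t : R) (H : R -> Om -> 'rV[R]_d) : Prop :=
  progressive t H /\
  (\int[P]_w \int[lebesgue_measure]_(r in `[t, T]) (enorm (H r w) ^+ 2)%:E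
     < +oo)%E.

(* [sp_val k] is the value on the interval ]sp_time k, sp_time k.+1],
   for k < sp_size. *)
Record simple_process : Type := SimpleProcess {
  sp_size : nat ;
  sp_time : nat -> R ;
  sp_val : nat -> Om -> 'rV[R]_d }.

Definition is_simple (t : R) (S : simple_process) : Prop :=
  [/\ forall k, (k <= sp_size S)%N -> t <= sp_time S k <= T,
      forall k, (k < sp_size S)%N -> sp_time S k <= sp_time S k.+1,
      forall k, (k < sp_size S)%N ->
        measurable_on setT (filtration (sp_time S k)) (sp_val S k) &
      exists M : R, forall k w, (k < sp_size S)%N -> enorm (sp_val S k w) <= M].

Definition simple_eval (S : simple_process) (r : R) (w : Om) : 'rV[R]_d :=
  \sum_(k < sp_size S)
    (if sp_time S k < r <= sp_time S k.+1 then sp_val S k w else 0).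

Definition simple_integral (S : simple_process) (s : R) (w : Om) : R :=
  \sum_(k < sp_size S) \sum_(j < d) sp_val S k w 0 j *
    (B (Num.min s (sp_time S k.+1)) w 0 j - B (Num.min s (sp_time S k)) w 0 j).

(* [I] is the Ito integral process s |-> int_t^s H_r dB_r on [t, T]: the
   continuous adapted process which is the L^2 limit of the integrals of
   simple processes converging to H in L^2(dt x dP). *)
Definition ito_integral (t : R) (H : R -> Om -> 'rV[R]_d) (I : R -> Om -> R) :
    Prop :=
  [/\ in_H2 t H,
      adapted t I,
      {ae P, forall w, {within `[t, T], continuous (I^~ w)}} &
      exists S : nat -> simple_process,
      [/\ forall k, is_simple t (S k),
          (\int[P]_w \int[lebesgue_measure]_(r in `[t, T])
             (enorm (simple_eval (S k) r w - H r w) ^+ 2)%:E)%E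
            @[k --> \oo] --> 0%E &
          forall s : R, t <= s <= T ->
            (\int[P]_w ((simple_integral (S k) s w - I s w) ^+ 2)%:E)%E
              @[k --> \oo] --> 0%E]].

Definition sde_solution (n : nat) (bt : R -> 'rV[R]_n -> 'rV[R]_n)
    (st : R -> 'rV[R]_n -> 'M[R]_(n, d)) (t : R) (x : 'rV[R]_n)
    (X : R -> Om -> 'rV[R]_n) : Prop :=
  in_S2 (@enorm R 1 n) t X /\
  exists I : 'I_n -> R -> Om -> R,
    (forall i, ito_integral t (fun r w => row i (st r (X r w))) (I i)) /\
    {ae P, forall w, forall s : R, t <= s <= T -> forall i,
       X s w 0 i = x 0 i
         + \int[lebesgue_measure]_(r in `[t, s]) bt r (X r w) 0 i + I i s w}.

Definition bsde_solution (n : nat)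
    (ft : R -> 'rV[R]_n -> R -> 'rV[R]_d -> R) (Pt : 'rV[R]_n -> R)
    (t : R) (X : R -> Om -> 'rV[R]_n) (Y : R -> Om -> R)
    (Z : R -> Om -> 'rV[R]_d) : Prop :=
  [/\ in_S2 (fun y : R => `|y|) t Y,
      in_H2 t Z &
      exists2 I : R -> Om -> R, ito_integral t Z I &
      {ae P, forall w, forall s : R, t <= s <= T ->
         Y s w = Pt (X T w)
           + \int[lebesgue_measure]_(r in `[s, T]) ft r (X r w) (Y r w) (Z r w)
           - (I T w - I s w)}].

End Processes.

Section Coefficients.
Context (R : realType) (T : R) (n d : nat)
  (b : R -> 'rV[R]_n -> 'rV[R]_n -> 'rV[R]_n)
  (sigma : R -> 'rV[R]_n -> 'rV[R]_n -> 'M[R]_(n, d))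
  (Phi : 'rV[R]_n -> 'rV[R]_n -> R)
  (f : R -> 'rV[R]_n -> 'rV[R]_n -> R -> R -> 'rV[R]_d -> R).

(* The arguments are in the order (t, x', x, y', y, z): the primed ones are
   those over which the mean-field expectation is taken. *)
Record coefficient_assumptions (C : R) : Prop := CoefficientAssumptions {
  b_continuous :
    {within [set p : R * ('rV[R]_n * 'rV[R]_n) | 0 <= p.1 <= T],
      continuous (fun p => b p.1 p.2.1 p.2.2)} ;
  sigma_continuous :
    {within [set p : R * ('rV[R]_n * 'rV[R]_n) | 0 <= p.1 <= T],
      continuous (fun p => sigma p.1 p.2.1 p.2.2)} ;
  b_sigma_growth : forall (t : R) x' x, 0 <= t <= T ->
    enorm (b t x' x) + enorm (sigma t x' x) <= C * (1 + enorm x) ;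
  b_sigma_lipschitz : forall (t : R) x1' x1 x2' x2, 0 <= t <= T ->
    enorm (b t x1' x1 - b t x2' x2) + enorm (sigma t x1' x1 - sigma t x2' x2)
      <= C * (enorm (x1' - x2') + enorm (x1 - x2)) ;
  f_Phi_lipschitz : forall (t : R) x1' x1 y1' y1 z1 x2' x2 y2' y2 z2,
    0 <= t <= T ->
    `|f t x1' x1 y1' y1 z1 - f t x2' x2 y2' y2 z2| + `|Phi x1' x1 - Phi x2' x2|
      <= C * (enorm (x1' - x2') + enorm (x1 - x2) + `|y1' - y2'| + `|y1 - y2|
              + enorm (z1 - z2)) ;
  f_Phi_growth : forall (t : R) x' x, 0 <= t <= T ->
    `|f t x' x 0 0 0| + `|Phi x' x| <= C * (1 + enorm x + enorm x') ;
  f_measurable :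
    measurable_on
      [set p : R * ('rV[R]_n * ('rV[R]_n * (R * (R * 'rV[R]_d))))
        | 0 <= p.1 <= T]
      (@borel _)
      (fun p => f p.1 p.2.1 p.2.2.1 p.2.2.2.1 p.2.2.2.2.1 p.2.2.2.2.2) ;
  f_continuous : forall x' x y' y z,
    {within `[0, T], continuous (fun t => f t x' x y' y z)} ;
  f_nondecreasing : forall (t : R) x' x y1' y2' y z, 0 <= t <= T ->
    y1' <= y2' ->
    f t x' x y1' y z <= f t x' x y2' y z }.

Context (dO : measure_display) (Om : measurableType dO) (P : probability Om R)
  (X0 : R -> Om -> 'rV[R]_n) (Y0 : R -> Om -> R).

Definition b_tilde (s : R) (x : 'rV[R]_n) : 'rV[R]_n :=
  \row_i fine 'E_P[fun w => b s (X0 s w) x 0 i].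

Definition sigma_tilde (s : R) (x : 'rV[R]_n) : 'M[R]_(n, d) :=
  \matrix_(i, j) fine 'E_P[fun w => sigma s (X0 s w) x i j].

Definition Phi_tilde (x : 'rV[R]_n) : R :=
  fine 'E_P[fun w => Phi (X0 T w) x].

Definition f_tilde (s : R) (x : 'rV[R]_n) (y : R) (z : 'rV[R]_d) : R :=
  fine 'E_P[fun w => f s (X0 s w) x (Y0 s w) y z].

End Coefficients.

(* Main.v *)
(** Fix [t < t'] and let [c] be the constant [u t x - u t' x]. For an increment
    [J] of a stochastic integral of [h] over [s, s'] and [U] known at time [s],
    the Ito isometry gives E(U + J)^2 = E U^2 + E int |h|^2. Comparing the state
    at the two ends of a short step, it bounds E|D_s'|^2 by E|D_s|^2 for a
    forward process [D]; for a backward one it bounds E|D_s|^2 by E|D_s'|^2, the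
    term E int |h|^2 absorbing the dependence of the driver on [Z]. Iterated over
    small steps, this replaces Ito's formula. Applied to [X t x - x] and
    [X t x - X t' x] it gives E|X^{t,x}_s - X^{t',x}_s|^2 <= K (t' - t) (1 + |x|)^2
    for [s >= t'], and the same bound follows for Y^{t,x} - Y^{t',x} at time [t'].
    That difference equals [c] plus the increment of Y^{t,x} over [t, t'], so one
    more backward step, started at the constant [c], bounds c^2 in the same way:
    neither the flow property nor u(s, X_s) = Y_s is needed. *)

Require Import Defs.
From mathcomp Require Import ring lra measurable_realfun.

Set Implicit Arguments.
Unset Strict Implicit.
Unset Printing Implicit Defensive.

Local Open Scope classical_set_scope.
Local Open Scope ring_scope.

(** The final constant may not depend on the solutions, while finiteness of their second moments
    comes from bounds that do. Hence every estimate fixes its constant before the processes are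
    introduced; the bound [M] of a given process only makes a supremum finite and never enters the
    constant. The equations contain real integrals, which split at an intermediate time only along
    paths where the averaged coefficient is integrable. Its measurability in time is a question of
    its own, since it is an expectation over [X0] and [Y0] evaluated along a path: with the space
    arguments frozen the coefficient is continuous in time, the processes are then substituted one
    argument at a time by Lipschitz dependence, and the expectation is taken last. A backward step
    absorbs the [Z] term only below a length set by the bounds on the driver, and the last step
    covers all of [[t, t']]. A larger gap is therefore treated apart: the value function grows at
    most linearly in [x], and [t' - t] is then bounded below. *)

Lemma le_of_eq disp (V : porderType disp) (x y : V) : x = y -> (x <= y)%O.
Proof. by move=> ->. Qed.

(** * Discrete Gronwall inequalities *)

Section Gronwall.
Context (R : realType).
Implicit Types (phi : R -> R).

(** Apply the hypothesis with [M] the supremum [S] of [phi] on [[a, b]]: it gives [S <= A + S / 2].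
    The assumed bound, of whatever size, makes [S] finite, so that [S / 2] can be subtracted. *)
Lemma bounded_absorb phi (a b A : R) : a <= b ->
  (exists M, forall s, a <= s <= b -> phi s <= M) ->
  (forall M s, a <= s <= b -> (forall r, a <= r <= b -> phi r <= M) ->
     phi s <= A + M / 2) ->
  forall s, a <= s <= b -> phi s <= 2 * A.
Proof.
move=> ab [M0 hM0] h s hs.
pose S := [set phi r | r in [set r | a <= r <= b]].
have hS : has_sup S.
  split; first by exists (phi s), s.
  by exists M0 => _ [r hr <-]; exact: hM0.
have hle r : a <= r <= b -> phi r <= sup S.
  by move=> hr; apply: ub_le_sup; [case: hS|exists r].
have : sup S <= A + sup S / 2.
  apply: ge_sup; first by case: hS.
  by move=> _ [r hr <-]; exact: h.
by move: (hle s hs); lra.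
Qed.

(* The factor 2 in the step inequality is harmless: it is applied to boundedly
   many steps of fixed length, not to infinitesimal ones. *)
Lemma gronwall_forward (T K delta0 : R) : 0 <= K -> 0 < delta0 -> exists2 C : R, 0 <= C &
  forall phi (a g : R), 0 <= a <= T -> 0 <= g ->
    (forall s, a <= s <= T -> 0 <= phi s) ->
    (exists M, forall s, a <= s <= T -> phi s <= M) ->
    (forall s s' M, a <= s <= s' -> s' <= T -> s' - s <= delta0 ->
       (forall r, s <= r <= s' -> phi r <= M) ->
       phi s' <= 2 * phi s + K * (s' - s) * (g + M)) ->
    forall s, a <= s <= T -> phi s <= C * (phi a + (s - a) * g).
Proof.
(* The second entry ensures [K * d <= 1 / 2], the condition under which the supremum over a step is
   absorbed. *)
move=> K0 d00; set d := Num.min delta0 (2 * (K + 1))^-1.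
have i0 : 0 < (2 * (K + 1))^-1 :> R by rewrite invr_gt0; lra.
have d0 : 0 < d by rewrite lt_min d00 i0.
have Kd : K * d <= 2^-1.
  have : d <= (2 * (K + 1))^-1 by rewrite ge_min lexx orbT.
  move=> /(ler_wpM2l K0) /le_trans; apply.
  by rewrite ler_pdivrMr; lra.
have dd0 : d <= delta0 by rewrite ge_min lexx.
have K1 : 0 <= 1 + 2 * K by lra.
(* The number of steps depends on [T], [K] and [delta0] alone, so the constant can be chosen before
   [phi]. *)
have [N hN] : exists N : nat, T <= N%:R * d.
  exists (Num.bound `|T / d|); rewrite -ler_pdivrMr//.
  by apply: le_trans (ler_norm _) _; apply/ltW/archi_boundP.
exists (4 ^+ N * (1 + 2 * K)); first by rewrite mulr_ge0// exprn_ge0.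
move=> phi a g aT g0 phi0 phib h.
(* Each step costs a factor 4: one 2 from the step inequality, another from [bounded_absorb]. *)
have step k : forall s, a <= s <= T -> s - a <= k%:R * d ->
    phi s <= 4 ^+ k * (phi a + 2 * K * (s - a) * g).
  elim: k => [|k IH] s hs hk.
    have -> : s = a by move: hk hs; rewrite mul0r; lra.
    by rewrite expr0 mul1r subrr; lra.
  have [hsd|hsd] := leP (s - a) (k%:R * d).
    apply: (le_trans (IH _ hs hsd)); rewrite ler_wpM2r//.
      rewrite addr_ge0 ?mulr_ge0 ?phi0//; move: hs; lra.
    by rewrite exprS ler_peMl ?exprn_ge0; lra.
  have kd0 : 0 <= k%:R * d by rewrite mulr_ge0// ltW.
  pose s1 := a + k%:R * d.
  have hs1 : a <= s1 <= s by rewrite /s1; lra.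
  have hss1 : s - s1 <= d by move: hk; rewrite /s1 -natr1 mulrDl mul1r; lra.
  have : phi s <= 2 * (2 * phi s1 + K * (s - s1) * g).
    apply: (@bounded_absorb phi s1 s) => //; first by case/andP: hs1.
    - by case: phib => M hM; exists M => r hr; apply: hM; lra.
    - move=> M r hr hM; apply: le_trans (h s1 r M _ _ _ _) _.
      + lra.
      + lra.
      + by rewrite (le_trans _ dd0)//; lra.
      + by move=> q hq; apply: hM; lra.
      have M0 : 0 <= M by apply: le_trans (phi0 s _) (hM s _); lra.
      have : K * (r - s1) * M <= M / 2.
        rewrite mulrC ler_wpM2l//.
        by rewrite (le_trans _ Kd)// ler_wpM2l//; lra.
      have : K * (r - s1) * g <= K * (s - s1) * g.
        by rewrite ler_wpM2r// ler_wpM2l//; lra.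
      by rewrite mulrDr; lra.
    - by case/andP : hs1; lra.
  move/le_trans; apply.
  have h1 : phi s1 <= 4 ^+ k * (phi a + 2 * K * (s1 - a) * g).
    by apply: IH; rewrite /s1; lra.
  have e1 : 1 <= 4 ^+ k :> R by rewrite exprn_ege1//; lra.
  rewrite exprS.
  have e2 : K * (s - s1) * g <= 4 ^+ k * (K * (s - s1) * g).
    by rewrite ler_peMl// !mulr_ge0//; lra.
  have e3 : 4 ^+ k * (phi a + 2 * K * (s1 - a) * g) =
      4 ^+ k * (phi a + 2 * K * (s - a) * g) - 2 * (4 ^+ k * (K * (s - s1) * g)).
    by ring.
  have e4 : 0 <= 4 ^+ k * (K * (s - s1) * g).
    by rewrite !mulr_ge0 ?exprn_ge0//; lra.
  by rewrite -[leRHS]mulrA; move: h1; rewrite e3; lra.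
move=> s hs; apply: (le_trans (step N s hs _)).
  by apply: le_trans hN; lra.
have pa : 0 <= phi a by apply: phi0; lra.
have sg : 0 <= (s - a) * g by rewrite mulr_ge0//; lra.
have Kp : 0 <= K * phi a by rewrite mulr_ge0.
rewrite -[leRHS]mulrA; apply: ler_wpM2l; first exact: exprn_ge0.
by move: sg Kp pa; lra.
Qed.

(** The reflection [s |-> a + T - s] of [[a, T]] exchanges its ends and turns the backward
    inequality into the forward one. The factor [1 + T] takes up the length [T - s] that multiplies
    [g]. *)
Lemma gronwall_backward (T K delta0 : R) : 0 <= T -> 0 <= K -> 0 < delta0 ->
  exists2 C : R, 0 <= C &
  forall phi (a g : R), 0 <= a <= T -> 0 <= g ->
    (forall s, a <= s <= T -> 0 <= phi s) ->
    (exists M, forall s, a <= s <= T -> phi s <= M) ->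
    (forall s s' M, a <= s <= s' -> s' <= T -> s' - s <= delta0 ->
       (forall r, s <= r <= s' -> phi r <= M) ->
       phi s <= 2 * phi s' + K * (s' - s) * (g + M)) ->
    forall s, a <= s <= T -> phi s <= C * (phi T + g).
Proof.
move=> T0 K0 d0; have [C C0 hC] := @gronwall_forward T K delta0 K0 d0.
exists (C * (1 + T)); first by rewrite mulr_ge0//; lra.
move=> phi a g aT g0 phi0 [M hM] h s hs.
have := hC (fun s => phi (a + T - s)) a g aT g0.
have refl r : a <= r <= T -> a <= a + T - r <= T by lra.
move=> /(_ (fun r hr => phi0 _ (refl r hr))) /(_ (ex_intro _ M (fun r hr => hM _ (refl r hr)))).
have hh s0 s' M0 : a <= s0 <= s' -> s' <= T -> s' - s0 <= delta0 ->
    (forall r, s0 <= r <= s' -> phi (a + T - r) <= M0) ->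
    phi (a + T - s') <= 2 * phi (a + T - s0) + K * (s' - s0) * (g + M0).
  move=> h1 h2 h3 h4.
  have -> : s' - s0 = (a + T - s0) - (a + T - s') by ring.
  apply: h => //; [lra|lra|lra|].
  move=> r hr; have -> : r = a + T - (a + T - r) by ring.
  by apply: h4; lra.
move=> /(_ hh) /(_ _ (refl s hs)).
have -> : a + T - (a + T - s) = s by ring.
have -> : a + T - a = T by ring.
move=> /le_trans; apply.
rewrite -mulrA ler_wpM2l//.
have : 0 <= phi T by apply: phi0; lra.
move=> pT; have := mulr_ge0 T0 pT.
have : (a + T - s - a) * g <= T * g by rewrite ler_wpM2r//; lra.
lra.
Qed.
End Gronwall.

(** * The Euclidean norm of vectors and matrices *)

Section EuclideanNorm.
Context (R : realType).

Lemma enorm_ge0 m p (A : 'M[R]_(m, p)) : 0 <= enorm A.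
Proof. exact: sqrtr_ge0. Qed.

Lemma enorm0 m p : enorm (0 : 'M[R]_(m, p)) = 0.
Proof.
by rewrite /enorm big1 ?sqrtr0// => i _; rewrite big1// => j _; rewrite mxE expr0n.
Qed.

Lemma enormN m p (A : 'M[R]_(m, p)) : enorm (- A) = enorm A.
Proof.
by congr Num.sqrt; apply: eq_bigr => i _; apply: eq_bigr => j _; rewrite mxE sqrrN.
Qed.

Lemma enorm_sqr m p (A : 'M[R]_(m, p)) : enorm A ^+ 2 = \sum_i \sum_j A i j ^+ 2.
Proof.
by rewrite sqr_sqrtr// sumr_ge0// => i _; rewrite sumr_ge0// => j _; exact: sqr_ge0.
Qed.

Lemma enorm_sqr_rV n (x : 'rV[R]_n) : enorm x ^+ 2 = \sum_i x 0 i ^+ 2.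
Proof. by rewrite enorm_sqr big_ord1. Qed.

Lemma coord_le_enorm m p (A : 'M[R]_(m, p)) i j : `|A i j| <= enorm A.
Proof.
rewrite -sqrtr_sqr ler_wsqrtr// (bigD1 i)//= (bigD1 j)//= -addrA lerDl addr_ge0//.
  by apply: sumr_ge0 => k _; exact: sqr_ge0.
by apply: sumr_ge0 => k _; apply: sumr_ge0 => l _; exact: sqr_ge0.
Qed.

Lemma enormD_sqr m p (A A' : 'M[R]_(m, p)) :
  enorm (A + A') ^+ 2 <= 2 * enorm A ^+ 2 + 2 * enorm A' ^+ 2.
Proof.
rewrite !enorm_sqr !mulr_sumr -big_split ler_sum//= => i _.
rewrite !mulr_sumr -big_split ler_sum//= => j _; rewrite mxE.
by rewrite -subr_ge0 (_ : _ - _ = (A i j - A' i j) ^+ 2) ?sqr_ge0//; ring.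
Qed.

(* The sharp constant 1 would need the Cauchy-Schwarz inequality. *)
Lemma enormD m p (A A' : 'M[R]_(m, p)) : enorm (A + A') <= 2 * (enorm A + enorm A').
Proof.
have a0 := enorm_ge0 A; have a0' := enorm_ge0 A'.
rewrite -(@ler_pXn2r _ 2)// ?nnegrE ?enorm_ge0//; last by lra.
apply: (le_trans (enormD_sqr A A')).
by have := mulr_ge0 a0 a0'; have := sqr_ge0 (enorm A); have := sqr_ge0 (enorm A'); nra.
Qed.

Lemma enorm_le_coord m p (A : 'M[R]_(m, p)) (K : R) : 0 <= K ->
  (forall i j, `|A i j| <= K) -> enorm A ^+ 2 <= (m * p)%:R * K ^+ 2.
Proof.
move=> K0 h; rewrite enorm_sqr.
apply: (@le_trans _ _ (\sum_(i < m) \sum_(j < p) K ^+ 2)).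
  by apply: ler_sum => i _; apply: ler_sum => j _; rewrite -[leLHS]real_normK ?num_real// ler_sqr ?nnegrE.
by rewrite !sumr_const !card_ord -mulrnA mulnC mulr_natl.
Qed.

Lemma enorm_delta n (i : 'I_n) (r : R) : enorm (r *: delta_mx 0 i : 'rV[R]_n) = `|r|.
Proof.
rewrite /enorm big_ord1 (bigD1 i)//= big1 => [|j ji].
  by rewrite addr0 !mxE !eqxx mulr1 sqrtr_sqr.
by rewrite !mxE (negbTE ji) mulr0 expr0n.
Qed.

End EuclideanNorm.

(** * Measurability of processes *)

Section Measurability.
Context d (E : measurableType d) (R : realType).
Implicit Types (D : set E).

Definition coord_measurable n D (U : E -> 'rV[R]_n) :=
  forall i, measurable_fun D (fun e => U e 0 i).

(* [tau] is approximated strictly from the right by rational-valued functions. *)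
Lemma measurable_right_limit D (tau : E -> R) (G : R -> E -> R) (L : E -> R) :
  measurable_fun D tau -> (forall v, measurable_fun D (G v)) ->
  (forall e, D e -> G v e @[v --> (tau e)^'+] --> L e) -> measurable_fun D L.
Proof.
move=> mtau mG GL.
pose rho (n : nat) (r : R) : R := (Num.floor (r * n.+1%:R) + 1)%:~R / n.+1%:R.
have n0 n : 0 < n.+1%:R :> R by [].
have rho_gt n r : r < rho n r.
  by rewrite /rho ltr_pdivlMr// floorD1_gt.
have rho_le n r : rho n r <= r + n.+1%:R^-1.
  rewrite /rho ler_pdivrMr// mulrDl mulVf ?gt_eqF// intrD.
  by rewrite lerD2r floor_le_tmp.
have rho_cvg r : rho n r @[n --> \oo] --> r.
  apply: (@squeeze_cvgr _ _ _ _ (fun=> r) (fun n => r + n.+1%:R^-1)).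
  - by near=> n; rewrite (ltW (rho_gt n r)) rho_le.
  - exact: cvg_cst.
  - rewrite -[X in _ --> X]addr0; apply: cvgD; first exact: cvg_cst.
    exact: cvg_harmonic.
apply: (@measurable_fun_cvg _ _ _ D (fun n e => G (rho n (tau e)) e)); last first.
  move=> e De; have /cvg_at_rightP := GL e De; apply.
  by split => [n|]; [exact: rho_gt|exact: rho_cvg].
move=> n mD A mA.
(* On each of countably many pieces, indexed by the floor [k], the substituted time is the constant
   [(k + 1) / (n + 1)], so a single [G v] is involved. *)
have -> : D `&` (fun e => G (rho n (tau e)) e) @^-1` A =
    \bigcup_(k : int) ((D `&` tau @^-1` `[k%:~R / n.+1%:R, (k + 1)%:~R / n.+1%:R[)
       `&` (D `&` (G ((k + 1)%:~R / n.+1%:R)) @^-1` A)).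
  apply/seteqP; split => [e [De Ae]|e [k _ [[De /=]]]].
    exists (Num.floor (tau e * n.+1%:R)) => //; split; split => //=.
    rewrite in_itv/= ler_pdivrMr// ltr_pdivlMr//.
    by rewrite floor_le_tmp floorD1_gt.
  rewrite in_itv/= ler_pdivrMr// ltr_pdivlMr// => /andP[h1 h2] [_ h]; split => //=.
  rewrite /rho; suff -> : Num.floor (tau e * n.+1%:R) = k by [].
  by apply: floor_def; rewrite h1 h2.
apply: countable_bigcupT_measurable => // k.
by apply: measurableI; [apply: mtau => //|exact: mG].
Unshelve. all: by end_near. Qed.

(** The Lipschitz bound makes [v |-> G v e] continuous at [tau e], which supplies the right limit of
    the previous lemma. *)
Lemma measurable_plug_real D (tau : E -> R) (G : R -> E -> R) (K : R) :
  measurable_fun D tau -> (forall v, measurable_fun D (G v)) ->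
  (forall e v v', D e -> `|G v e - G v' e| <= K * `|v - v'|) ->
  measurable_fun D (fun e => G (tau e) e).
Proof.
move=> mtau mG GK; apply: (measurable_right_limit mtau mG) => e De.
apply: cvg_at_right_filter.
apply/cvgrPdist_le => eps eps0.
have K0 : 0 < `|K| + 1 by rewrite ltr_wpDl.
near=> v; rewrite (le_trans (GK _ _ _ De))//.
apply: (@le_trans _ _ ((`|K| + 1) * `|tau e - v|)).
  by rewrite ler_wpM2r// (le_trans (ler_norm _))// lerDl.
rewrite mulrC -ler_pdivlMr//.
by near: v; apply: cvgr_dist_le; [exact: cvg_id|exact: divr_gt0].
Unshelve. all: by end_near. Qed.

(** Substitution proceeds coordinate by coordinate: [mix k v e] has the first [k] coordinates of
    [U e] and the others of [v], and passing from [k] to [k + 1] substitutes one real variable. *)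
Lemma measurable_plug n D (U : E -> 'rV[R]_n) (G : 'rV[R]_n -> E -> R) (K : R) :
  coord_measurable D U -> (forall v, measurable_fun D (G v)) ->
  (forall e v v', D e -> `|G v e - G v' e| <= K * enorm (v - v')) ->
  measurable_fun D (fun e => G (U e) e).
Proof.
move=> mU mG GK.
pose mix k (v : 'rV[R]_n) e : 'rV[R]_n := \row_i if (i < k)%N then U e 0 i else v 0 i.
have main k v : (k <= n)%N -> measurable_fun D (fun e => G (mix k v e) e).
  elim: k v => [v _|k IH v kn].
    rewrite (_ : (fun _ => _) = G v)//; apply/funext => e; congr G.
    by apply/rowP => i; rewrite mxE.
  pose j := Ordinal kn.
  pose sub r : 'rV[R]_n := v + (r - v 0 j) *: delta_mx 0 j.
  rewrite (_ : (fun _ => _) = (fun e => G (mix k (sub (U e 0 j)) e) e)); last first.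
    apply/funext => e/=; congr G; apply/rowP => i; rewrite !mxE ltnS leq_eqVlt.
    case: eqP => [ik|/eqP ik]/=.
      have -> : i = j by exact/val_inj.
      by rewrite ltnn ?mxE !eqxx mulr1 addrC subrK.
    case: ifP => // _; rewrite ?mxE -[i == j]/(val i == k) (negbTE ik) mulr0; exact: esym (addr0 _).
  apply: (@measurable_plug_real D (fun e => U e 0 j) (fun r e => G (mix k (sub r) e) e) `|K|).
  - exact: mU.
  - by move=> r; apply: IH; exact: ltnW.
  - move=> e r r' De; apply: (le_trans (GK _ _ _ De)).
    have -> : mix k (sub r) e - mix k (sub r') e = (r - r') *: delta_mx 0 j.
      apply/rowP => i; rewrite !mxE; case: ifPn => ik.
        rewrite subrr (_ : (i == j) = false) ?mulr0//.
        by apply/negbTE/eqP => ij; move: ik; rewrite ij ltnn.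
      by ring.
    by rewrite enorm_delta ler_wpM2r// ler_norm.
rewrite (_ : (fun _ => _) = (fun e => G (mix n 0 e) e)); first exact: main.
apply/funext => e; congr G; apply/rowP => i; rewrite mxE ltn_ord//.
Qed.

Lemma measurable_enorm_sqr n D (U : E -> 'rV[R]_n) :
  coord_measurable D U -> measurable_fun D (fun e => enorm (U e) ^+ 2).
Proof.
move=> mU; rewrite (_ : (fun _ => _) = (fun e => \sum_i U e 0 i ^+ 2)).
  by apply: measurable_sum => i; apply: measurable_funX.
by apply/funext => e; rewrite enorm_sqr_rV.
Qed.

Lemma measurable_enorm n D (U : E -> 'rV[R]_n) :
  coord_measurable D U -> measurable_fun D (fun e => enorm (U e)).
Proof.
move=> mU; rewrite (_ : (fun _ => _) = Num.sqrt \o (fun e => enorm (U e) ^+ 2)).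
  apply: measurableT_comp; last exact: measurable_enorm_sqr.
  by apply: continuous_measurable_fun; exact: sqrt_continuous.
by apply/funext => e /=; rewrite sqrtr_sqr ger0_norm// enorm_ge0.
Qed.

Lemma coord_measurableB n D (U V : E -> 'rV[R]_n) : coord_measurable D U ->
  coord_measurable D V -> coord_measurable D (fun e => U e - V e).
Proof.
move=> mU mV i; rewrite (_ : (fun _ => _) = (fun e => U e 0 i - V e 0 i)).
  exact: measurable_funB.
by apply/funext => e; rewrite !mxE.
Qed.

End Measurability.

Section BorelMeasurability.
Context d (E : measurableType d) (R : realType).

Lemma measurable_on_comp (V : topologicalType) (D : set E) (G : set (set E))
    (g : E -> V) (h : V -> R) : G `<=` measurable -> continuous h ->
  measurable_on D G g -> measurable_fun D (h \o g).
Proof.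
move=> Gm ch mg mD; apply: (measurability _ (RGenOpens.measurableE R)) => //.
move=> _ [_ [a [b ->] <-]]; apply: Gm; apply: mg.
exists (h @^-1` `]a, b[%classic) => //; apply: sub_gen_smallest.
by move/continuousP: ch; apply; exact: interval_open.
Qed.

Lemma measurable_on_coord n (D : set E) (G : set (set E)) (g : E -> 'rV[R]_n) :
  G `<=` measurable -> measurable_on D G g -> coord_measurable D g.
Proof.
move=> Gm mg i; apply: (@measurable_on_comp _ D G g (fun v => v 0 i) Gm _ mg).
exact: coord_continuous.
Qed.

Lemma borel_real_measurable : @borel R `<=` measurable.
Proof.
apply: smallest_sub; first exact: sigma_algebra_measurable.
by move=> A; exact: open_measurable.
Qed.

End BorelMeasurability.

Section JointMeasurability.
Context d (Om : measurableType d) (R : realType).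

(** Right-continuity recovers the value at [r] from fixed times [v > r]. Clamping times to [[t, T]]
    by [cl] makes every [v] admissible; at [r = T] the clamped function is constant on the right. *)
Lemma measurable_right_continuous (g : R -> Om -> R) (t T : R) : t <= T ->
  (forall s, t <= s <= T -> measurable_fun setT (g s)) ->
  (forall w s, t <= s < T -> g r w @[r --> s^'+] --> g s w) ->
  measurable_fun (`[t, T] `*` setT) (fun p : R * Om => g p.1 p.2).
Proof.
move=> tT mg cg; pose cl v := Num.max t (Num.min v T).
have clP v : t <= cl v <= T by rewrite /cl le_max lexx/= ge_max tT ge_min lexx orbT.
apply: (@measurable_right_limit _ _ R _ fst (fun v p => g (cl v) p.2)).
- by apply: measurable_funTS; exact: measurable_fst.
- move=> v; apply: measurable_funTS.
  by apply: (measurableT_comp (mg _ (clP v))); exact: measurable_snd.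
- move=> [r w] [/=]; rewrite in_itv/= => /andP[tr rT] _.
  move: rT; rewrite le_eqVlt => /predU1P[rT|rT].
    apply: (cvg_near_cst); near=> v; congr (g _ w).
    have Tv : r < v by near: v; exact: nbhs_right_gt.
    by rewrite /cl min_r -?rT ?(ltW Tv)// max_r.
  have := cg w r; rewrite tr rT => /(_ isT); apply: cvg_trans.
  apply: near_eq_cvg; near=> v; congr (g _ w).
  have rv : r < v by near: v; exact: nbhs_right_gt.
  have vT : v < T by near: v; exact: nbhs_right_lt.
  by rewrite /cl min_l ?(ltW vT)// max_r// (le_trans tr)// ltW.
Unshelve. all: by end_near. Qed.

End JointMeasurability.

(** * The augmented Brownian filtration *)

Section Filtration.
Context (R : realType) (dO : measure_display) (Om : measurableType dO)
  (P : probability Om R) (T : R) (d : nat) (B : R -> Om -> 'rV[R]_d).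
Hypothesis P_complete : measure_is_complete P.
Hypothesis B_brownian : brownian_motion P T B.

Lemma brownian_history_measurable s : s <= T -> brownian_history B s `<=` measurable.
Proof.
move=> sT; apply: smallest_sub; first exact: sigma_algebra_measurable.
move=> A [r /=]; rewrite in_itv/= => /andP[r0 rs]; apply: (bm_measurable B_brownian).
by rewrite r0 (le_trans rs).
Qed.

(** Completeness of [P] makes the adjoined negligible sets measurable. *)
Lemma filtration_measurable s : s <= T -> filtration P B s `<=` measurable.
Proof.
move=> sT; apply: smallest_sub; first exact: sigma_algebra_measurable.
by move=> A [|]; [exact: brownian_history_measurable|exact: P_complete].
Qed.

Lemma brownian_history_le s t : s <= t -> brownian_history B s `<=` brownian_history B t.
Proof.
move=> st; apply: sub_smallest2r; first exact: smallest_sigma_algebra.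
move=> A [r /=]; rewrite in_itv/= => /andP[r0 rs] h.
by exists r => //=; rewrite in_itv/= r0 (le_trans rs).
Qed.

Lemma filtration_le s t : s <= t -> filtration P B s `<=` filtration P B t.
Proof.
move=> st; apply: sub_smallest2r; first exact: smallest_sigma_algebra.
move=> A [h|h]; [left|by right].
exact: brownian_history_le h.
Qed.

(** A copy of the sample space carrying the sigma-algebra of time [s]: adaptedness becomes plain
    [measurable_fun], and the general closure lemmas apply to it. *)
Definition filtration_type s :=
  g_sigma_algebraType (brownian_history B s `|` P.-negligible).

Definition filtration_fun s (U : Om -> R) :=
  measurable_fun (setT : set (filtration_type s)) (U : filtration_type s -> R).

Lemma filtration_fun_measurable s U : s <= T -> filtration_fun s U -> measurable_fun setT U.
Proof.
move=> sT mU _ A mA; apply: (filtration_measurable sT).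
exact: (mU measurableT A mA).
Qed.

Lemma filtration_fun_le s t U : s <= t -> filtration_fun s U -> filtration_fun t U.
Proof.
move=> st mU _ A mA; apply: (filtration_le st).
exact: (mU measurableT A mA).
Qed.

Lemma measurable_on_filtration (V : topologicalType) s (g : Om -> V) (h : V -> R) :
  continuous h -> measurable_on setT (filtration P B s) g -> filtration_fun s (h \o g).
Proof.
by move=> ch mg; apply: (measurable_on_comp (E := filtration_type s) _ ch mg).
Qed.

Lemma brownian_filtration s j : 0 <= s -> filtration_fun s (fun w => B s w 0 j).
Proof.
move=> s0; apply: (@measurable_on_filtration _ s (B s) (fun v => v 0 j)).
  exact: coord_continuous.
move=> A [V bV <-]; apply: sub_gen_smallest; left; apply: sub_gen_smallest.
exists s; first by rewrite /= in_itv/= s0 lexx.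
by exists V.
Qed.

Lemma progressive_measurable n t (H : R -> Om -> 'rV[R]_n) : t <= T ->
  progressive P T B t H ->
  coord_measurable (`[t, T] `*` setT) (fun p : R * Om => H p.1 p.2).
Proof.
move=> tT pH; have mH := pH T; rewrite tT lexx in mH.
apply: (measurable_on_coord _ (mH isT)).
apply: smallest_sub; first exact: sigma_algebra_measurable.
move=> _ [A bA [G FG <-]]; apply: measurableX.
  exact: borel_real_measurable.
exact: (filtration_measurable (lexx T)).
Qed.

Lemma adapted_measurable (V : topologicalType) t (psi : R -> Om -> V) (h : V -> R) s :
  continuous h -> adapted P T B t psi -> t <= s <= T ->
  filtration_fun s (h \o psi s).
Proof. by move=> ch ad ts; apply: measurable_on_filtration => //; exact: ad. Qed.

Lemma cadlag_joint_measurable n t (X : R -> Om -> 'rV[R]_n) : t <= T ->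
  adapted P T B t X -> (forall w, cadlag T t (X^~ w)) ->
  coord_measurable (`[t, T] `*` setT) (fun p : R * Om => X p.1 p.2).
Proof.
move=> tT aX cX i.
apply: (@measurable_right_continuous _ _ _ (fun r w => X r w 0 i)) => //.
- move=> s ts; apply: (@filtration_fun_measurable s); first by case/andP: ts.
  by apply: (@adapted_measurable _ t X (fun v => v 0 i)) => //; exact: coord_continuous.
- move=> w s ts.
  apply: (@cvg_comp _ _ _ (X^~ w) (fun v : 'rV[R]_n => v 0 i) _ _ _ ((cX w).1 s ts)).
  exact: coord_continuous.
Qed.

Lemma cadlag_joint_measurable_real t (Y : R -> Om -> R) : t <= T ->
  adapted P T B t Y -> (forall w, cadlag T t (Y^~ w)) ->
  measurable_fun (`[t, T] `*` setT) (fun p : R * Om => Y p.1 p.2).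
Proof.
move=> tT aY cY; apply: measurable_right_continuous => //.
- move=> s ts; apply: (@filtration_fun_measurable s); first by case/andP: ts.
  by apply: (@adapted_measurable _ t Y idfun) => // x; exact: cvg_id.
- by move=> w s ts; exact: (cY w).1.
Qed.

End Filtration.

(** * Mean-square norms and their limits *)

Section MeanSquare.
Context d (E : measurableType d) (R : realType)
  (m : {measure set E -> \bar R}) (D : set E).
Hypothesis mD : measurable D.

(** Continuity of a squared norm, without square roots: Young's inequality with weights [1 + eps]
    and [1 + eps^-1] is used in both directions, [eps] being chosen small against [x] before [ek] is
    made small against [eps^-1]. *)
Lemma ereal_cvg_absorb (x : R) (xk ek : nat -> \bar R) :
  (forall k, 0 <= xk k)%E -> (forall k, 0 <= ek k)%E -> ek @ \oo --> 0%E ->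
  (forall (eps : R) k, (0 < eps)%R ->
    xk k <= ((1 + eps) * x)%R%:E + (1 + eps^-1)%R%:E * ek k)%E ->
  (forall (eps : R) k, (0 < eps)%R ->
    x%:E <= (1 + eps)%R%:E * xk k + (1 + eps^-1)%R%:E * ek k)%E ->
  xk @ \oo --> x%:E.
Proof.
move=> xk0 ek0 /fine_cvgP[ekfin ek_cvg] h1 h2.
have xkfin : \forall k \near \oo, xk k \is a fin_num.
  near=> k; rewrite ge0_fin_numE//; apply: le_lt_trans (h1 1 k ltr01) _.
  have ekf : ek k \is a fin_num by near: k; exact: ekfin.
  by rewrite -(fineK ekf) -EFinM -EFinD ltry.
apply/fine_cvgP; split => //.
apply/cvgrPdist_le => e e0.
have x1 : 0 < 4 * (`|x| + 1) by rewrite mulr_gt0// ltr_wpDl.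
(* The denominator gives [eps * |x| <= e / 4], also when [x = 0]; [eps <= 1] keeps a product of two
   small terms below either factor. *)
pose eps := Num.min 1 (e / (4 * (`|x| + 1))).
have eps0 : 0 < eps by rewrite lt_min ltr01 divr_gt0.
have eps1 : eps <= 1 by rewrite ge_min lexx.
have epsx : eps * `|x| <= e / 4.
  apply: (@le_trans _ _ (e / (4 * (`|x| + 1)) * (`|x| + 1))).
    apply: ler_pM; [exact: ltW|by []|by rewrite ge_min lexx orbT|by rewrite lerDl].
  by rewrite invfM mulrA mulfVK// lt0r_neq0// ltr_wpDl.
pose q := 1 + eps^-1.
have q0 : 0 < q by rewrite ltr_wpDr// invr_ge0 ltW.
near=> k.
have ekf : ek k \is a fin_num by near: k; exact: ekfin.
have xkf : xk k \is a fin_num by near: k; exact: xkfin.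
have qe : q * fine (ek k) <= e / 4.
  rewrite mulrC -ler_pdivlMr//.
  have : `|0 - fine (ek k)| <= e / 4 / q.
    by near: k; move/cvgrPdist_le : ek_cvg; apply; rewrite !divr_gt0.
  by rewrite sub0r normrN ger0_norm// fine_ge0.
have y0 : 0 <= fine (ek k) by exact: fine_ge0.
have := h1 eps k eps0; rewrite -(fineK ekf) -(fineK xkf) -EFinM -EFinD lee_fin -/q => h1'.
have := h2 eps k eps0; rewrite -(fineK ekf) -(fineK xkf) -!EFinM -!EFinD lee_fin -/q => h2'.
have xx : eps * x <= eps * `|x| by rewrite ler_wpM2l ?(ltW eps0)// ler_norm.
have qy : 0 <= q * fine (ek k) by rewrite mulr_ge0 ?(ltW eps0) ?(ltW q0).
have h3 : eps * fine (xk k) <= eps * ((1 + eps) * x + q * fine (ek k)) by rewrite ler_wpM2l ?(ltW eps0).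
have h4 : eps * (q * fine (ek k)) <= 1 * (q * fine (ek k)) by rewrite ler_wpM2r.
have h5 : eps * (eps * `|x|) <= 1 * (eps * `|x|) by rewrite ler_wpM2r// mulr_ge0 ?(ltW eps0) ?(ltW q0).
have h6 : eps * (eps * x) <= eps * (eps * `|x|) by rewrite ler_wpM2l ?(ltW eps0).
by rewrite /= ler_norml; apply/andP; split; lra.
Unshelve. all: by end_near. Qed.

Definition msq n (h : E -> 'rV[R]_n) : \bar R := (\int[m]_(e in D) (enorm (h e) ^+ 2)%:E)%E.

Lemma measurable_sqr n (h : E -> 'rV[R]_n) : coord_measurable D h ->
  measurable_fun D (fun e => (enorm (h e) ^+ 2)%:E).
Proof. by move=> mh; apply/measurable_EFinP; exact: measurable_enorm_sqr. Qed.

Lemma msq_ge0 n (h : E -> 'rV[R]_n) : (0 <= msq h)%E.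
Proof. by apply: integral_ge0 => e _; rewrite lee_fin sqr_ge0. Qed.

(** The three vector sizes are independent, so that scalars, seen as vectors of length 1, can be
    compared with vectors. *)
Lemma msq_lin n p q (h : E -> 'rV[R]_n) (g : E -> 'rV[R]_p) (k : E -> 'rV[R]_q)
    (a b : R) : 0 <= a -> 0 <= b ->
  coord_measurable D h -> coord_measurable D g -> coord_measurable D k ->
  (forall e, D e -> enorm (h e) ^+ 2 <= a * enorm (g e) ^+ 2 + b * enorm (k e) ^+ 2) ->
  (msq h <= a%:E * msq g + b%:E * msq k)%E.
Proof.
move=> a0 b0 mh mg mk hgk.
have s0 p' (g' : E -> 'rV[R]_p') e : (0 <= (enorm (g' e) ^+ 2)%:E)%E by rewrite lee_fin sqr_ge0.
rewrite /msq -!ge0_integralZl//=; [|exact: measurable_sqr..].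
rewrite -ge0_integralD//=; last 4 first.
- by move=> e De; rewrite mule_ge0.
- by apply: measurable_funeM; exact: measurable_sqr.
- by move=> e De; rewrite mule_ge0.
- by apply: measurable_funeM; exact: measurable_sqr.
apply: ge0_le_integral => //=.
- exact: measurable_sqr.
- by apply: emeasurable_funD; apply: measurable_funeM; exact: measurable_sqr.
Qed.

Lemma msqD n (h g : E -> 'rV[R]_n) : coord_measurable D h -> coord_measurable D g ->
  (msq (fun e => h e + g e)%R <= 2%:E * msq h + 2%:E * msq g)%E.
Proof.
move=> mh mg; apply: msq_lin => //.
  move=> i; rewrite (_ : (fun _ => _) = (fun e => h e 0 i + g e 0 i)); first exact: measurable_funD.
  by apply/funext => e; rewrite mxE.
by move=> e _; exact: enormD_sqr.
Qed.

(** Both hypotheses of [ereal_cvg_absorb] come from the pointwise inequality [ptw], used once from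
    [h] to [hk] and once from [hk] to [h]. *)
Lemma msq_cvg n (hk : nat -> E -> 'rV[R]_n) (h : E -> 'rV[R]_n) :
  (forall k, coord_measurable D (hk k)) -> coord_measurable D h ->
  (msq h < +oo)%E ->
  msq (fun e => hk k e - h e) @[k --> \oo] --> 0%E ->
  msq (hk k) @[k --> \oo] --> msq h.
Proof.
move=> mhk mh hfin hcvg.
have hf : msq h \is a fin_num by rewrite ge0_fin_numE// msq_ge0.
have mB k : coord_measurable D (fun e => hk k e - h e) by apply: coord_measurableB.
have ptw (x y eps : R) : 0 < eps ->
    y ^+ 2 <= (1 + eps) * x ^+ 2 + (1 + eps^-1) * (y - x) ^+ 2.
  move=> eps0; rewrite -subr_ge0.
  rewrite (_ : _ - _ = eps * (x - eps^-1 * (y - x)) ^+ 2).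
    by rewrite mulr_ge0 ?sqr_ge0 ?ltW.
  by field; rewrite gt_eqF.
rewrite -(fineK hf); apply: (@ereal_cvg_absorb _ _ _ _ _ hcvg).
- by move=> k; exact: msq_ge0.
- by move=> k; exact: msq_ge0.
- move=> eps k eps0; rewrite EFinM fineK//; apply: msq_lin => //.
  + by rewrite addr_ge0// ltW.
  + by rewrite addr_ge0// invr_ge0 ltW.
  + move=> e _; rewrite !enorm_sqr_rV !mulr_sumr -big_split ler_sum//= => i _.
    by rewrite !mxE; exact: ptw.
- move=> eps k eps0; rewrite fineK//; apply: msq_lin => //.
  + by rewrite addr_ge0// ltW.
  + by rewrite addr_ge0// invr_ge0 ltW.
  + move=> e _; rewrite !enorm_sqr_rV !mulr_sumr -big_split ler_sum//= => i _.
    rewrite !mxE; have := ptw (hk k e 0 i) (h e 0 i) _ eps0.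
    by rewrite -[in X in X -> _](sqrrN (h e 0 i - _)) opprB.
Qed.

End MeanSquare.

(** * Integration over time and the probability space *)

Section TimeSpace.
Context (R : realType) (d : measure_display) (Om : measurableType d)
  (P : probability Om R).
Notation lam := (@lebesgue_measure R).
Notation lamP := (lam \x P)%E.

Section Sections.
Context (d' : measure_display) (U : sigmaRingType d').

Lemma time_section (A : set R) (f : R * Om -> U) w : measurable A ->
  measurable_fun (A `*` setT) f -> measurable_fun A (fun r => f (r, w)).
Proof.
move=> mA mf; apply: (measurable_comp (F := A `*` setT)) mf _.
- exact: measurableX.
- by move=> _ [r Ar <-].
- by apply: measurable_funTS; exact: pair2_measurable.
Qed.

Lemma space_section (A : set R) (f : R * Om -> U) r : measurable A -> A r ->
  measurable_fun (A `*` setT) f -> measurable_fun setT (fun w => f (r, w)).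
Proof.
move=> mA Ar mf; apply: (measurable_comp (F := A `*` setT)) mf _.
- exact: measurableX.
- by move=> _ [w _ <-].
- exact: pair1_measurable.
Qed.

End Sections.

Section Tonelli.
Context (A : set R) (mA : measurable A) (f : R * Om -> \bar R).
Hypothesis mf : measurable_fun (A `*` setT) f.
Hypothesis f0 : forall p, (A `*` setT) p -> (0 <= f p)%E.

Let D : set (R * Om) := A `*` setT.
Let mD : measurable D. Proof. exact: measurableX. Qed.
(** Extension by zero transfers both orders of integration from the whole product space to the
    strip. *)
Let g := f \_ D.
Let mg : measurable_fun setT g. Proof. exact/(measurable_restrictT _ mD). Qed.
Let g0 p : (0 <= g p)%E.
Proof. by rewrite /g patchE; case: ifPn => //; rewrite inE; exact: f0. Qed.
Let gE r w : A r -> g (r, w) = f (r, w).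
Proof. by move=> Ar; rewrite /g patchE mem_set. Qed.
Let gN r w : ~ A r -> g (r, w) = 0%E.
Proof. by move=> Ar; rewrite /g patchE memNset// => -[]. Qed.

Lemma tonelli_time_space :
  (\int[lamP]_(p in A `*` setT) f p = \int[lam]_(r in A) \int[P]_w f (r, w))%E.
Proof.
rewrite integral_mkcond// -/g fubini_tonelli1// [RHS]integral_mkcond//.
apply: eq_integral => r _; rewrite patchE; case: ifPn; rewrite ?inE => Ar.
  by apply: eq_integral => w _; exact: gE.
by rewrite /fubini_F; apply: integral0_eq => w _; apply: gN => /mem_set; apply/negP.
Qed.

Let inner : fubini_G lam g = fun w => (\int[lam]_(r in A) f (r, w))%E.
Proof.
apply/funext => w; rewrite /fubini_G [RHS]integral_mkcond//.
apply: eq_integral => r _; rewrite patchE; case: ifPn; rewrite ?inE => Ar.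
  exact: gE.
by apply: gN => /mem_set; apply/negP.
Qed.

Lemma tonelli_space_time :
  (\int[lamP]_(p in A `*` setT) f p = \int[P]_w \int[lam]_(r in A) f (r, w))%E.
Proof.
transitivity (\int[P]_w fubini_G lam g w)%E; last by rewrite inner.
by rewrite integral_mkcond// -/g fubini_tonelli1// fubini_tonelli.
Qed.

Lemma measurable_integral_time :
  measurable_fun setT (fun w => \int[lam]_(r in A) f (r, w))%E.
Proof. by rewrite -inner; exact: measurable_fun_fubini_tonelli_G. Qed.

End Tonelli.

Lemma msq_time_bound n (A : set R) (h : R * Om -> 'rV[R]_n) (M : R) :
  measurable A -> coord_measurable (A `*` setT) h ->
  (forall r, A r -> (msq P setT (fun w => h (r, w)) <= M%:E)%E) ->
  (msq lamP (A `*` setT) h <= M%:E * lam A)%E.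
Proof.
move=> mA mh hM; rewrite /msq tonelli_time_space//; last 2 first.
  exact: measurable_sqr.
  by move=> p _; rewrite lee_fin sqr_ge0.
rewrite -integral_cst//; apply: ge0_le_integral => //.
- by move=> r _; apply: integral_ge0 => w _; rewrite lee_fin sqr_ge0.
- set f := fun p : R * Om => (enorm (h p) ^+ 2)%:E.
  have mf : measurable_fun (A `*` setT) f by exact: measurable_sqr.
  pose g := f \_ (A `*` setT).
  have mg : measurable_fun setT g.
    have mD : measurable (A `*` setT : set (R * Om)) by exact: measurableX.
    exact/(measurable_restrictT _ mD).
  have g0 p : (0 <= g p)%E by rewrite /g patchE; case: ifP => // _; rewrite lee_fin sqr_ge0.
  apply: (@eq_measurable_fun _ _ _ _ _ (fubini_F P g)).
    move=> r; rewrite inE => Ar; apply: eq_integral => w _.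
    by rewrite /g patchE mem_set.
  by apply: measurable_funTS; exact: measurable_fun_fubini_tonelli_F.
Qed.

(** Cauchy-Schwarz against the constant 1: integrate [2 c h <= h^2 + c^2] with the optimal
    [c = x / (b - a)]. The integral of [h^2] may be infinite, and [x] may lie below the integral of
    [h]. *)
Lemma sqr_le_integral_sqr (a b x : R) (h : R -> R) : a <= b -> 0 <= x ->
  measurable_fun `]a, b] h -> (forall r, a < r <= b -> 0 <= h r) ->
  (x%:E <= \int[lam]_(r in `]a, b]) (h r)%:E)%E ->
  ((x ^+ 2)%:E <= (b - a)%:E * \int[lam]_(r in `]a, b]) (h r ^+ 2)%:E)%E.
Proof.
rewrite le_eqVlt => /predU1P[<- x0 _ _|ab x0 mh h0 xh].
  rewrite set_itv_ge -?leNgt ?bnd_simp// integral_set0 lee_fin => xle0.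
  by rewrite subrr mul0e lee_fin (le_anti (introT andP (conj xle0 x0))) expr0n.
have ba0 : 0 < b - a by rewrite subr_gt0.
pose c := x / (b - a).
have c0 : 0 <= c by rewrite divr_ge0// ltW.
have mh2 : measurable_fun `]a, b] (fun r => (h r ^+ 2)%:E).
  by apply/measurable_EFinP; exact: measurable_funX.
have h2 r : (`]a, b] : set R)%classic r -> (0 <= (h r ^+ 2)%:E)%E by rewrite lee_fin sqr_ge0.
have lab : lam `]a, b] = (b - a)%:E by rewrite lebesgue_measure_itv/= lte_fin ab -EFinB.
have mhE : measurable_fun `]a, b] (fun r => (h r)%:E) by exact/measurable_EFinP.
have hE0 r : (`]a, b] : set R)%classic r -> (0 <= (h r)%:E)%E.
  by rewrite /= in_itv/= lee_fin; exact: h0.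
have c2 : (0 <= (2 * c)%:E :> \bar R)%E by rewrite lee_fin mulr_ge0.
have cc : forall r, (`]a, b] : set R)%classic r -> (0 <= cst (c ^+ 2)%:E r)%E.
  by move=> r _; rewrite lee_fin sqr_ge0.
have key : ((2 * c)%:E * \int[lam]_(r in `]a, b]) (h r)%:E <=
    \int[lam]_(r in `]a, b]) (h r ^+ 2)%:E + (c ^+ 2)%:E * (b - a)%:E)%E.
  rewrite -lab -integral_cst// -ge0_integralZl// -ge0_integralD//.
  apply: ge0_le_integral => //.
  - by move=> r hr; rewrite mule_ge0// hE0.
  - exact: measurable_funeM.
  - exact: emeasurable_funD.
  - move=> r _; rewrite -EFinM -EFinD lee_fin -subr_ge0.
    by rewrite (_ : _ - _ = (h r - c) ^+ 2) ?sqr_ge0//; ring.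
have {}key : ((2 * c * x)%:E <=
    \int[lam]_(r in `]a, b]) (h r ^+ 2)%:E + (c ^+ 2 * (b - a))%:E)%E.
  by rewrite !EFinM in key *; apply: le_trans key; rewrite lee_wpmul2l// -EFinM lee_fin mulr_ge0.
set I := (\int[lam]_(r in _) _)%E in key *.
have I0 : (0 <= I)%E by exact: integral_ge0.
case: I I0 key => [I I0 key| |//]; last by rewrite gt0_muley ?lte_fin ?leey.
move: key; rewrite -EFinD -EFinM !lee_fin => key.
have cx : c * (b - a) = x by rewrite /c mulfVK// gt_eqF.
have cI : c ^+ 2 * (b - a) <= I.
  have e : 2 * c * x = 2 * (c ^+ 2 * (b - a)) by rewrite -cx; ring.
  by move: key; rewrite e; lra.
have -> : x ^+ 2 = (b - a) * (c ^+ 2 * (b - a)) by rewrite -cx; ring.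
by apply: ler_wpM2l => //; exact: ltW.
Qed.

End TimeSpace.

(** * Gaussian increments *)

Section NormalMoments.
Context (R : realType) (s : R).
Hypothesis s0 : 0 < s.
Notation lam := (@lebesgue_measure R).
Notation N := (@normal_prob R 0 s).
Notation pdf := (normal_pdf 0 s).

Let s_neq0 : s != 0. Proof. by rewrite gt_eqF. Qed.

(** The Radon-Nikodym derivative of the law and the normal density have the same integral over every
    measurable set, hence agree almost everywhere. *)
Lemma ge0_integral_normal_prob (f : R -> \bar R) : measurable_fun setT f ->
  (forall x, (0 <= f x)%E) ->
  (\int[N]_x f x = \int[lam]_x (f x * (pdf x)%:E))%E.
Proof.
move=> mf f0.
have dom := @normal_prob_dominates R 0 s.
pose g := Radon_Nikodym_SigmaFinite.f N lam.
rewrite -(@Radon_Nikodym_SigmaFinite.change_of_variables _ _ _ N lam dom f setT)//.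
have mg : measurable_fun setT g.
  exact: measurable_int (Radon_Nikodym_SigmaFinite.f_integrable dom).
have mp : measurable_fun setT (fun x => (pdf x)%:E).
  by apply/measurable_EFinP; exact: measurable_normal_pdf.
apply: ge0_ae_eq_integral => //.
- exact: emeasurable_funM.
- exact: emeasurable_funM.
- by move=> x _; rewrite mule_ge0// Radon_Nikodym_SigmaFinite.f_ge0.
- by move=> x _; rewrite mule_ge0// lee_fin normal_pdf_ge0.
- apply: ae_eqe_mul2l; apply: integral_ae_eq => //.
  + exact: Radon_Nikodym_SigmaFinite.f_integrable.
  + by move=> A _ mA; rewrite -Radon_Nikodym_SigmaFinite.f_integral.
Qed.

Let pdfE x : pdf x = normal_peak s * expR (- (x ^+ 2 / (s ^+ 2 *+ 2))).
Proof. by rewrite /normal_pdf (negbTE s_neq0) /normal_fun subr0 mulNr. Qed.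

(** The boundary term of the integration by parts for the second moment: its derivative is
    [x^2 - s^2] times the density. *)
Let F x := - (s ^+ 2 * (x * pdf x)).

Let dF (x : R) : is_derive x (1 : R) F ((x ^+ 2 - s ^+ 2) * pdf x).
Proof.
have -> : F = (fun x => - (s ^+ 2 * (x * (normal_peak s * expR (- (s ^+ 2 *+ 2)^-1 * x ^+ 2))))).
  by apply/funext => y; rewrite /F pdfE; do 4 congr (_ _); rewrite mulNr mulrC.
apply: is_derive_eq.
rewrite pdfE (_ : - (x ^+ 2 / (s ^+ 2 *+ 2)) = - (s ^+ 2 *+ 2)^-1 * x ^+ 2); last first.
  by rewrite mulNr mulrC.
rewrite /GRing.scale/=; set e := expR _; set p := normal_peak s.
by field; rewrite s_neq0.
Qed.

Let continuous_pdf : continuous pdf.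
Proof. exact: continuous_normal_pdf. Qed.

Let continuous_sqr_pdf : continuous (fun x : R => x ^+ 2 * pdf x).
Proof.
by move=> x; apply: cvgM; [exact: exprn_continuous|exact: continuous_pdf].
Qed.

Let mpdf : measurable_fun setT (fun x => (pdf x)%:E).
Proof. by apply/measurable_EFinP; exact: measurable_normal_pdf. Qed.

Let msqr : measurable_fun setT (fun x : R => (x ^+ 2 * pdf x)%:E).
Proof. by apply/measurable_EFinP; exact: continuous_measurable_fun. Qed.

Let I n : set R := `[- n.+1%:R, n.+1%:R].

Let bigcupI : \bigcup_n I n = setT.
Proof.
apply/seteqP; split => // x _; exists (Num.bound `|x|) => //=.
rewrite /I /= in_itv/= -ler_norml; apply: (le_trans (ltW (archi_boundP (normr_ge0 x)))).
by rewrite ler_nat.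
Qed.

Let ndI : nondecreasing_seq I.
Proof.
move=> i j ij; apply/subsetPset => x; rewrite /I /= !in_itv/= => /andP[h1 h2].
have : i.+1%:R <= j.+1%:R :> R by rewrite ler_nat.
by move=> h; apply/andP; split; lra.
Qed.

Let truncated n : (\int[lam]_(x in I n) (x ^+ 2 * pdf x)%:E =
  (s ^+ 2)%:E * \int[lam]_(x in I n) (pdf x)%:E + (F n.+1%:R - F (- n.+1%:R))%:E)%E.
Proof.
have nn : - n.+1%:R < n.+1%:R :> R by rewrite gtrN.
have cI (h : R -> R) : continuous h -> lam.-integrable (I n) (EFin \o h).
  move=> ch; apply: continuous_compact_integrable; first exact: segment_compact.
  exact: continuous_subspaceT.
have i1 := cI _ continuous_sqr_pdf; have i2 := cI _ continuous_pdf.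
have ch : continuous (fun x : R => (x ^+ 2 - s ^+ 2) * pdf x).
  move=> x; apply: cvgM; last exact: continuous_pdf.
  by apply: cvgB; [exact: exprn_continuous|exact: cvg_cst].
have cF : continuous F.
  by move=> x; apply/differentiable_continuous/derivable1_diffP; have := dF x; case.
have := @continuous_FTC2 R _ F _ _ nn (continuous_subspaceT ch).
rewrite -/(I n) => FTC.
rewrite EFinB -FTC; last 2 first.
- split; first by move=> x _; have := dF x; case.
  + exact: cvg_at_right_filter (cF _).
  + exact: cvg_at_left_filter (cF _).
- by move=> x _; rewrite derive1E; have := dF x; case.
have mI : measurable (I n : set (measurableTypeR R)) by exact: measurable_itv.
rewrite -(@integralZl _ _ _ lam _ mI _ i2).
rewrite -(@integralD _ _ _ lam _ mI _ _ (integrableZl mI _ i2) (cI _ ch)).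
by apply: eq_integral => x _; rewrite -EFinM -EFinD; congr (_%:E); ring.
Qed.

(** Gaussian decay from [expR q >= 1 + q >= q] with [q = (n + 1)^2 / (2 s^2)]: the boundary term is
    at most [K / (n + 1)]. *)
Let F_cvg0 : F n.+1%:R @[n --> \oo] --> 0.
Proof.
pose K := s ^+ 2 * normal_peak s * (s ^+ 2 *+ 2).
have ss : 0 < s ^+ 2 *+ 2 by rewrite mulrn_wgt0// exprn_gt0.
have K0 : 0 <= K by rewrite !mulr_ge0 ?sqr_ge0 ?normal_peak_ge0// ltW.
have FK n : `|F n.+1%:R| <= K * n.+1%:R^-1.
  have n0 : 0 < n.+1%:R :> R by [].
  rewrite /F normrN pdfE ger0_norm; last first.
    apply: mulr_ge0; first exact: sqr_ge0.
    by apply: mulr_ge0 => //; apply: mulr_ge0; [exact: normal_peak_ge0|exact: expR_ge0].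
  have q2 : 0 < n.+1%:R ^+ 2 / (s ^+ 2 *+ 2) by rewrite divr_gt0// exprn_gt0.
  have E : expR (- (n.+1%:R ^+ 2 / (s ^+ 2 *+ 2))) <= (n.+1%:R ^+ 2 / (s ^+ 2 *+ 2))^-1.
    rewrite expRN lef_pV2 ?posrE ?expR_gt0//.
    by apply: le_trans (expR_ge1Dx _); rewrite lerDr.
  have p0 := normal_peak_ge0 s.
  apply: (@le_trans _ _ (s ^+ 2 * (n.+1%:R * (normal_peak s * (n.+1%:R ^+ 2 / (s ^+ 2 *+ 2))^-1)))).
    apply: ler_wpM2l; first exact: sqr_ge0.
    by apply: ler_wpM2l => //; apply: ler_wpM2l.
  rewrite /K; apply: le_of_eq; field.
  by rewrite s_neq0 gt_eqF.
apply/cvgrPdist_le => e e0; near=> n; rewrite sub0r normrN.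
apply: (le_trans (FK n)).
have : `|0 - K * harmonic n| <= e.
  near: n; have : K * harmonic n @[n --> \oo] --> 0.
    by rewrite -[X in _ --> X](mulr0 K); apply: cvgMr; exact: cvg_harmonic.
  by move/cvgrPdist_le; apply.
by rewrite sub0r normrN ger0_norm// mulr_ge0// invr_ge0.
Unshelve. all: by end_near. Qed.

(** On growing symmetric intervals the boundary terms of the integration by parts vanish, and
    monotone convergence gives both the second moment and the total mass 1 of the density. *)
Lemma normal_prob_sqr : (\int[N]_x (x ^+ 2)%:E = (s ^+ 2)%:E)%E.
Proof.
rewrite ge0_integral_normal_prob; last 2 first.
- apply/measurable_EFinP; exact: measurable_funX.
- by move=> x; rewrite lee_fin sqr_ge0.
have pdf0 x : (0 <= (pdf x)%:E)%E by rewrite lee_fin normal_pdf_ge0.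
have sp0 x : (0 <= (x ^+ 2 * pdf x)%:E)%E by rewrite EFinM mule_ge0// lee_fin sqr_ge0.
have c1 : (\int[lam]_(x in I n) (x ^+ 2 * pdf x)%:E)%E @[n --> \oo] -->
    (\int[lam]_x (x ^+ 2 * pdf x)%:E)%E.
  rewrite -bigcupI; apply: ge0_nondecreasing_set_cvg_integral => //.
  - by move=> i; exact: measurable_itv.
  - by move=> i; exact: measurable_funTS.
have c2 : (\int[lam]_(x in I n) (pdf x)%:E)%E @[n --> \oo] --> 1%E.
  rewrite -(@integral_normal_pdf R 0 s) -bigcupI.
  apply: ge0_nondecreasing_set_cvg_integral => //.
  - by move=> i; exact: measurable_itv.
  - by move=> i; exact: measurable_funTS.
under eq_integral do rewrite -EFinM.
rewrite (funext truncated) in c1.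
apply: (cvg_unique (@ereal_hausdorff R) c1) => /=.
rewrite -[X in _ --> X]adde0 -[X in _ --> (X + _)%E]mule1.
apply: cvgeD => //; first exact: cvgeZl.
apply: cvg_EFin; first by near=> n.
have -> : fine \o (fun n => (F n.+1%:R - F (- n.+1%:R))%:E) = (fun n => F n.+1%:R + F n.+1%:R).
  apply/funext => n /=; congr (_ + _); rewrite /F !pdfE sqrrN; ring.
by rewrite -[X in _ --> X]addr0; apply: cvgD.
Unshelve. all: by end_near. Qed.

End NormalMoments.

Section NormalMean.
Context (R : realType) (s : R).
Hypothesis s0 : 0 < s.
Notation lam := (@lebesgue_measure R).
Notation N := (@normal_prob R 0 s).

(** Lebesgue measure is invariant under reflection and the centred density is even. This symmetry
    replaces a computation of the first moment. *)
Lemma normal_prob_opp (A : set R) : measurable A -> N ((-%R) @^-1` A) = N A.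
Proof.
move=> mA; have mN : measurable_fun setT (-%R : R -> measurableTypeR R) by exact: oppr_measurable.
have mp B : measurable_fun B (fun x : R => (normal_pdf 0 s x)%:E).
  by apply: measurable_funTS; apply/measurable_EFinP; exact: measurable_normal_pdf.
rewrite [RHS]/normal_prob.
rewrite (@eq_measure_integral _ _ _ (A : set (measurableTypeR R)) (pushforward lam (-%R : R -> measurableTypeR R))); last first.
  by move=> B mB _ ; rewrite /= lebesgue_measureN.
rewrite ge0_integral_pushforward//; last first.
  by move=> x _; rewrite lee_fin normal_pdf_ge0.
  exact: mp.
rewrite /normal_prob; apply: eq_integral => x _ /=; congr (_%:E).
by rewrite /normal_pdf gt_eqF// /normal_fun !subr0 sqrrN.
Qed.

End NormalMean.

(** * Independence and expectations of products *)

Section Independence.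
Context d (Om : measurableType d) (R : realType) (P : probability Om R).

Definition independent (U W : Om -> R) := forall A A' : set R,
  measurable A -> measurable A' ->
  P (U @^-1` A `&` W @^-1` A') = (P (U @^-1` A) * P (W @^-1` A'))%E.

Section Expectation.
Context (U W : Om -> R).
Hypotheses (mU : measurable_fun setT U) (mW : measurable_fun setT W).
Hypothesis UW : independent U W.

Let rU : {mfun Om >-> R} := mfun_Sub (mem_set mU).
Let rW : {mfun Om >-> R} := mfun_Sub (mem_set mW).
Let mUW : measurable_fun setT (fun w => (U w, W w)).
Proof. exact: measurable_fun_pair. Qed.
Let rUW : {mfun Om >-> (R * R)%type} := mfun_Sub (mem_set mUW).

Let joint (X : set (R * R)) : measurable X ->
  (distribution P rU \x distribution P rW)%E X = distribution P rUW X.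
Proof. by apply: product_measure_unique => A A' mA mA'; exact: UW. Qed.

Let integral_joint (f : R * R -> \bar R) :
  (\int[distribution P rUW]_p f p =
   \int[(distribution P rU \x distribution P rW)%E]_p f p)%E.
Proof. by apply: eq_measure_integral => A mA _; first [exact: joint|exact: (esym (joint mA))]. Qed.

(** By uniqueness of the product measure, independence on rectangles makes the joint law the product
    of the laws; Tonelli then factors the integral. *)
Lemma ge0_independent_expectation (g h : R -> \bar R) :
  measurable_fun setT g -> measurable_fun setT h ->
  (forall x, 0 <= g x)%E -> (forall x, 0 <= h x)%E ->
  (\int[P]_w (g (U w) * h (W w)) = \int[P]_w g (U w) * \int[P]_w h (W w))%E.
Proof.
move=> mg mh g0 h0.
have mgh : measurable_fun setT (fun p : R * R => (g p.1 * h p.2)%E).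
  by apply: emeasurable_funM; apply: measurableT_comp.
have gh0 (p : R * R) : (0 <= g p.1 * h p.2)%E by rewrite mule_ge0.
transitivity (\int[distribution P rUW]_p (g p.1 * h p.2))%E.
  by rewrite ge0_integral_distribution.
rewrite integral_joint fubini_tonelli1// /fubini_F/=.
under eq_integral => x _ do rewrite ge0_integralZl//.
rewrite ge0_integralZr//; last exact: integral_ge0.
by rewrite !ge0_integral_distribution.
Qed.

(** The nonnegative case, applied to absolute values, gives integrability of the product; Fubini's
    theorem for the product of the laws does the rest. *)
Lemma independent_expectation : P.-integrable setT (EFin \o U) ->
  P.-integrable setT (EFin \o W) ->
  P.-integrable setT (fun w => (U w * W w)%:E) /\
  (\int[P]_w (U w * W w)%:E = \int[P]_w (U w)%:E * \int[P]_w (W w)%:E)%E.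
Proof.
move=> iU iW.
have mE : measurable_fun setT (fun x : R => `|x%:E|%E).
  by apply: measurableT_comp => //; exact: measurable_abse.
have mM : measurable_fun setT (fun p : R * R => (p.1 * p.2)%:E).
  by apply/measurable_EFinP; exact: measurable_funM.
have iUW : P.-integrable setT (fun w => (U w * W w)%:E).
  apply/integrableP; split; first by apply/measurable_EFinP; exact: measurable_funM.
  under eq_integral do rewrite EFinM abseM.
  rewrite (@ge0_independent_expectation (fun x => `|x%:E|%E) (fun x => `|x%:E|%E))//.
  have /integrableP[_ fU] := iU; have /integrableP[_ fW] := iW.
  apply: lte_mul_pinfty; [exact: integral_ge0| |exact: fW].
  by rewrite ge0_fin_numE ?integral_ge0.
split => //.
transitivity (\int[distribution P rUW]_p (p.1 * p.2)%:E)%E.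
  by rewrite integral_distribution.
have idUW : (distribution P rU \x distribution P rW)%E.-integrable setT (fun p : R * R => (p.1 * p.2)%:E).
  apply/integrableP; split => //; rewrite -integral_joint ge0_integral_distribution//.
    by move/integrableP : iUW => [].
  exact: measurableT_comp.
rewrite integral_joint -integral12_prod_meas1// /fubini_F/=.
have mI : measurable_fun setT (EFin : R -> \bar R) by exact: EFin_measurable.
have idU : (distribution P rU).-integrable setT (fun x : R => x%:E).
  exact: (integrable_pushforward (phi := U) mU (f := EFin) mI iU measurableT).
have idW : (distribution P rW).-integrable setT (fun x : R => x%:E).
  exact: (integrable_pushforward (phi := W) mW (f := EFin) mI iW measurableT).
have idWf : (\int[distribution P rW]_y y%:E)%E \is a fin_num by exact: integrable_fin_num.
under eq_integral => x _.
  under eq_integral => y _ do rewrite EFinM.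
  rewrite integralZl// -(fineK idWf); over.
rewrite integralZr// fineK//.
by rewrite !integral_distribution.
Qed.

End Expectation.
End Independence.

Section NormalRandomVariable.
Context d (Om : measurableType d) (R : realType) (P : probability Om R).
Implicit Types W : Om -> R.

Lemma integrable_of_sqr W : measurable_fun setT W ->
  P.-integrable setT (fun w => (W w ^+ 2)%:E) -> P.-integrable setT (EFin \o W).
Proof.
move=> mW iW; apply: (@le_integrable _ _ _ _ _ _ _ (fun w => (1 + W w ^+ 2)%:E)) => //.
- exact/measurable_EFinP.
- move=> w _; rewrite /= lee_fin (ger0_norm (addr_ge0 ler01 (sqr_ge0 _))).
  rewrite -subr_ge0 -[W w ^+ 2]real_normK ?num_real//.
  by have := sqr_ge0 (`|W w| - 1); have := normr_ge0 (W w); nra.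
- rewrite (_ : (fun _ => _) = (fun w => ((1 : R)%:E + (W w ^+ 2)%:E)%E))//.
  by apply: integrableD => //; exact: finite_measure_integrable_cst.
Qed.

Context (W : Om -> R) (s : R).
Hypotheses (mW : measurable_fun setT W) (s0 : 0 < s).
Hypothesis lawW : forall A, measurable A -> P (W @^-1` A) = normal_prob 0 s A.

Lemma normal_law_sqr : (\int[P]_w (W w ^+ 2)%:E = (s ^+ 2)%:E)%E.
Proof.
have mW' : @measurable_fun _ _ Om (measurableTypeR R) setT W by exact: mW.
pose rW : {mfun Om >-> measurableTypeR R} := @mfun_Sub _ _ Om (measurableTypeR R) W (mem_set mW').
rewrite -(normal_prob_sqr s0).
transitivity (\int[distribution P rW]_x (x ^+ 2)%:E)%E.
  rewrite ge0_integral_distribution//.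
    by apply/measurable_EFinP; exact: measurable_funX.
  by move=> x; rewrite lee_fin sqr_ge0.
by apply: eq_measure_integral => A mA _; exact: lawW.
Qed.

Lemma normal_law_integrable_sqr : P.-integrable setT (fun w => (W w ^+ 2)%:E).
Proof.
apply/integrableP; split; first by apply/measurable_EFinP; exact: measurable_funX.
under eq_integral do rewrite gee0_abs ?lee_fin ?sqr_ge0//.
by rewrite normal_law_sqr ltry.
Qed.

Lemma normal_law_integrable : P.-integrable setT (EFin \o W).
Proof. by apply: integrable_of_sqr => //; exact: normal_law_integrable_sqr. Qed.

(** [W] and [- W] have the same law, so the mean equals its opposite; integrability makes it a real
    number, hence 0. *)
Lemma normal_law_mean : (\int[P]_w (W w)%:E = 0)%E.
Proof.
have mN : measurable_fun setT (fun w => - W w) by exact: measurableT_comp.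
have mW' : @measurable_fun _ _ Om (measurableTypeR R) setT W by exact: mW.
pose rW : {mfun Om >-> measurableTypeR R} := @mfun_Sub _ _ Om (measurableTypeR R) W (mem_set mW').
have mN' : @measurable_fun _ _ Om (measurableTypeR R) setT (fun w => - W w) by exact: mN.
pose rN : {mfun Om >-> measurableTypeR R} := @mfun_Sub _ _ Om (measurableTypeR R) _ (mem_set mN').
have iN : P.-integrable setT (EFin \o rN).
  rewrite (_ : EFin \o rN = (fun w => - (EFin \o W) w)%E); last by apply/funext.
  exact: integrableN normal_law_integrable.
have sym : (\int[P]_w (W w)%:E = \int[P]_w (- W w)%:E)%E.
  transitivity (\int[distribution P rW]_x x%:E)%E.
    by rewrite integral_distribution//; exact: normal_law_integrable.
  transitivity (\int[distribution P rN]_x x%:E)%E; last first.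
    by rewrite integral_distribution//; exact: EFin_measurable.
  apply: eq_measure_integral => A mA _.
  transitivity (normal_prob 0 s A); first exact: lawW.
  rewrite -normal_prob_opp//; apply/esym/(lawW (A := -%R @^-1` A)).
  by rewrite -[X in measurable X]setTI; apply: (@oppr_measurable R setT).
have mf : (\int[P]_w (W w)%:E)%E \is a fin_num.
  by apply: integrable_fin_num => //; exact: normal_law_integrable.
move: sym; under [RHS]eq_integral do rewrite EFinN.
rewrite integralN//=; last by apply: integrable_add_def => //; exact: normal_law_integrable.
rewrite -(fineK mf) -EFinN => -[h]; congr (_%:E).
by move: h; set x := fine _; lra.
Qed.

End NormalRandomVariable.

Section SquareIntegrable.
Context d (Om : measurableType d) (R : realType) (P : probability Om R).
Implicit Types U W : Om -> R.

Lemma integrableM_of_sqr U W : measurable_fun setT U -> measurable_fun setT W ->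
  P.-integrable setT (fun w => (U w ^+ 2)%:E) ->
  P.-integrable setT (fun w => (W w ^+ 2)%:E) ->
  P.-integrable setT (fun w => (U w * W w)%:E).
Proof.
move=> mU mW iU iW.
apply: (@le_integrable _ _ _ _ _ _ _ (fun w => (U w ^+ 2 + W w ^+ 2)%:E)) => //.
- by apply/measurable_EFinP; exact: measurable_funM.
- move=> w _; rewrite /= lee_fin (ger0_norm (addr_ge0 (sqr_ge0 _) (sqr_ge0 _))).
  rewrite normrM -[U w ^+ 2]real_normK ?num_real// -[W w ^+ 2]real_normK ?num_real//.
  rewrite -subr_ge0; have := normr_ge0 (U w); have := normr_ge0 (W w).
  by have := sqr_ge0 (`|U w| - `|W w|); nra.
- rewrite (_ : (fun _ => _) = (fun w => ((U w ^+ 2)%:E + (W w ^+ 2)%:E)%E))//.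
  exact: integrableD.
Qed.

Lemma integrableM_bounded U W (M : R) : measurable_fun setT U -> measurable_fun setT W ->
  (forall w, `|U w| <= M) -> P.-integrable setT (EFin \o W) ->
  P.-integrable setT (fun w => (U w * W w)%:E).
Proof.
move=> mU mW UM iW.
apply: (@le_integrable _ _ _ _ _ _ _ (fun w => M%:E * (W w)%:E)%E) => //.
- by apply/measurable_EFinP; exact: measurable_funM.
- move=> w _; rewrite -EFinM /= lee_fin !normrM ler_wpM2r//.
  by rewrite (le_trans (UM w))// ler_norm.
- exact: integrableZl.
Qed.

Lemma sqr_integrableM_bounded U W (M : R) : measurable_fun setT U -> measurable_fun setT W ->
  (forall w, `|U w| <= M) -> P.-integrable setT (fun w => (W w ^+ 2)%:E) ->
  P.-integrable setT (fun w => ((U w * W w) ^+ 2)%:E).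
Proof.
move=> mU mW UM iW; under eq_fun do rewrite exprMn.
apply: (@integrableM_bounded (fun w => U w ^+ 2) (fun w => W w ^+ 2) (M ^+ 2)) => //.
- exact: measurable_funX.
- exact: measurable_funX.
- move=> w; rewrite normrX ler_sqr ?nnegrE//.
  exact: le_trans (normr_ge0 _) (UM w).
Qed.

Lemma integrable_bounded U (M : R) : measurable_fun setT U ->
  (forall w, `|U w| <= M) -> P.-integrable setT (EFin \o U).
Proof.
move=> mU UM; have := @integrableM_bounded U (fun=> 1) M mU (measurable_cst _) UM.
rewrite (_ : (fun w => (U w * 1)%:E) = EFin \o U); last by apply/funext => w; rewrite mulr1.
by apply; exact: finite_measure_integrable_cst.
Qed.

End SquareIntegrable.

(** * Moments of Brownian increments *)

Section BrownianIncrements.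
Context (R : realType) (dO : measure_display) (Om : measurableType dO)
  (P : probability Om R) (T : R) (d : nat) (B : R -> Om -> 'rV[R]_d).
Hypothesis P_complete : measure_is_complete P.
Hypothesis B_brownian : brownian_motion P T B.

Lemma probability_eq_off (A A' N : set Om) : measurable A -> measurable A' ->
  P.-negligible N -> (forall w, ~ N w -> (A w <-> A' w)) -> P A = P A'.
Proof.
move=> mA mA' [N' [mN' PN' NN']] h.
have le (C C' : set Om) : measurable C -> measurable C' ->
    (forall w, ~ N w -> C w -> C' w) -> (P C <= P C')%E.
  move=> mC mC' CC'; rewrite -[leRHS]adde0 -PN'.
  apply: (@le_trans _ _ (P (C' `|` N'))); last exact: measureU2.
  apply: le_measure; rewrite ?inE//.
    exact: measurableU.
  by move=> w Cw; have [Nw|Nw] := pselect (N w); [right; exact: NN'|left; exact: CC'].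
by apply/eqP; rewrite eq_le !le// => w Nw; case: (h w Nw).
Qed.

(** Independence is given for the raw history. The sets agreeing with a set of the history off a
    negligible set form a sigma-algebra [C] that contains both kinds of generators, hence the
    augmented filtration; changing [G] on a negligible set alters no probability. *)
Lemma filtration_independent (s t : R) (G : set Om) (A : set 'rV[R]_d) :
  0 <= s <= t -> t <= T -> filtration P B s G -> borel A ->
  measurable ((fun w => B t w - B s w) @^-1` A) ->
  P (G `&` (fun w => B t w - B s w) @^-1` A)
    = (P G * P ((fun w => B t w - B s w)%R @^-1` A))%E.
Proof.
move=> /andP[s0 st] tT FG bA mE.
have sT : s <= T := le_trans st tT.
pose C G := exists G', brownian_history B s G' /\ exists N, P.-negligible N /\
  forall w, ~ N w -> (G w <-> G' w).
have [G' [hG' [N [nN GG']]]] : C G.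
  move: FG; apply: (@smallest_sub _ (sigma_algebra setT) _ C); last first.
    move=> A' [hA'|nA'].
      by exists A'; split => //; exists set0; split => //; exact: negligible_set0.
    exists set0; split; first exact: sigma_algebra0.
    by exists A'; split => // w nw; split.
  split.
  - exists set0; split; first exact: sigma_algebra0.
    by exists set0; split; [exact: negligible_set0|].
  - move=> A' [G' [hG' [N [nN h]]]]; exists (setT `\` G'); split.
      exact: sigma_algebraCD.
    by exists N; split => // w /h [h1 h2]; split => -[_ h3]; split => //; [move=> /h2|move=> /h1].
  - move=> F hF; have /choice[G' hG'] := hF.
    exists (\bigcup_k G' k); split.
      by apply: sigma_algebra_bigcup => k; case: (hG' k).
    have /choice[N hN] : forall k, exists N, P.-negligible N /\
        forall w, ~ N w -> (F k w <-> G' k w) by move=> k; case: (hG' k).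
    exists (\bigcup_k N k); split; first by apply: negligible_bigcup => k; case: (hN k).
    move=> w nw; have nk k : ~ N k w by move=> Nk; apply: nw; exists k.
    by split => -[k _ h]; exists k => //; have [_ /(_ w (nk k)) []] := hN k; auto.
have mG : measurable G by exact: (filtration_measurable P_complete B_brownian sT).
have mG' : measurable G' by exact: (brownian_history_measurable B_brownian sT).
rewrite (@probability_eq_off _ (G' `&` (fun w => B t w - B s w) @^-1` A) N)//.
- rewrite (@probability_eq_off G G' N)//.
  by apply: (bm_indep B_brownian) => //; rewrite s0.
- exact: measurableI.
- exact: measurableI.
- by move=> w /GG' [h1 h2]; split => -[? ?]; split; auto.
Qed.

Definition increment (s t : R) (j : 'I_d) (w : Om) : R := B t w 0 j - B s w 0 j.

Lemma measurable_increment s t j : 0 <= s -> s <= T -> 0 <= t -> t <= T ->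
  measurable_fun setT (increment s t j).
Proof.
move=> s0 sT t0 tT; apply: measurable_funB.
  by apply: (filtration_fun_measurable P_complete B_brownian tT); exact: brownian_filtration.
by apply: (filtration_fun_measurable P_complete B_brownian sT); exact: brownian_filtration.
Qed.

(** Used with [phi] a coordinate, for means, and with [phi] a product of two coordinates, for
    covariances. *)
Lemma independent_increment s t U (phi : 'rV[R]_d -> R) :
  0 <= s <= t -> t <= T -> filtration_fun P B s U -> continuous phi ->
  measurable_fun setT (fun w => phi (B t w - B s w)) ->
  independent P U (fun w => phi (B t w - B s w)).
Proof.
move=> st tT mU cphi mphiB A A' mA mA'.
pose V := g_sigma_algebraType (@open 'rV[R]_d).
have mphi : measurable_fun (setT : set V) (phi : V -> R).
  apply: (@measurable_on_comp _ V R _ setT (@borel 'rV[R]_d) idfun phi) => //.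
  by move=> C [C' bC' <-]; rewrite setTI.
have bA' : borel (phi @^-1` A') by have := mphi measurableT _ mA'; rewrite setTI.
rewrite (@filtration_independent s t (U @^-1` A) (phi @^-1` A'))//; last first.
  by rewrite -[X in measurable X]setTI; exact: mphiB.
by have := mU measurableT _ mA; rewrite setTI.
Qed.

Lemma increment_law s t j A : 0 <= s < t -> t <= T -> measurable A ->
  P (increment s t j @^-1` A) = normal_prob 0 (Num.sqrt (t - s)) A.
Proof.
move=> st tT mA.
pose A' (i : 'I_d) := if i == j then A else setT.
have := bm_gaussian B_brownian st tT (A := A').
rewrite (_ : [set w | _] = increment s t j @^-1` A).
  move=> ->; last by move=> i; rewrite /A'; case: ifP.
  rewrite (bigD1 j)//= big1 ?mule1 /A' ?eqxx// => i ij.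
  by rewrite (negbTE ij) probability_setT.
apply/seteqP; split => w /=; first by move=> /(_ j); rewrite /A' eqxx.
by move=> h i; rewrite /A'; case: eqP => [->|].
Qed.

Lemma independent_coordinates s t i j : 0 <= s < t -> t <= T -> i != j ->
  independent P (increment s t i) (increment s t j).
Proof.
move=> st tT ij A A' mA mA'.
rewrite !increment_law//.
pose C (k : 'I_d) := if k == i then A else if k == j then A' else setT.
have := bm_gaussian B_brownian st tT (A := C).
rewrite (_ : [set w | _] = increment s t i @^-1` A `&` increment s t j @^-1` A').
  move=> ->; last by move=> k; rewrite /C; case: ifP => // _; case: ifP.
  have ji : (j == i) = false by rewrite eq_sym (negbTE ij).
  rewrite (bigD1 i)//= (bigD1 j) ?ji//= big1 ?mule1 /C ?eqxx ?ji// => k /andP[ki kj].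
  by rewrite (negbTE ki) (negbTE kj) probability_setT.
apply/seteqP; split => w /=.
  move=> h; split; first by have := h i; rewrite /C eqxx.
  by have := h j; rewrite /C eq_sym (negbTE ij) eqxx.
by move=> [h1 h2] k; rewrite /C; case: eqP => [->//|_]; case: eqP => [->//|].
Qed.

Lemma increment_diag s j : increment s s j = fun=> 0.
Proof. by apply/funext => w; rewrite /increment subrr. Qed.

Lemma increment_split s r t j w : increment s t j w = increment s r j w + increment r t j w.
Proof. by rewrite /increment; ring. Qed.

Let minc := measurable_increment.

Lemma increment_sqr_integrable s t j : 0 <= s <= t -> t <= T ->
  P.-integrable setT (fun w => (increment s t j w ^+ 2)%:E).
Proof.
move=> /andP[s0]; rewrite le_eqVlt => /predU1P[<- _|st tT].
  rewrite increment_diag; under eq_fun do rewrite expr0n/=.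
  exact: integrable0.
apply: (@normal_law_integrable_sqr _ _ _ _ _ (Num.sqrt (t - s))).
- by apply: minc => //; lra.
- by rewrite sqrtr_gt0 subr_gt0.
- by move=> A mA; apply: (increment_law) => //; rewrite s0.
Qed.

Lemma increment_integrable s t j : 0 <= s <= t -> t <= T ->
  P.-integrable setT (EFin \o increment s t j).
Proof.
move=> st tT; apply: integrable_of_sqr; last exact: increment_sqr_integrable.
by apply: minc => //; lra.
Qed.

Lemma increment_mean s t j : 0 <= s <= t -> t <= T ->
  (\int[P]_w (increment s t j w)%:E = 0)%E.
Proof.
move=> /andP[s0]; rewrite le_eqVlt => /predU1P[<- _|st tT].
  by rewrite increment_diag integral0.
apply: (@normal_law_mean _ _ _ _ _ (Num.sqrt (t - s))).
- by apply: minc => //; lra.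
- by rewrite sqrtr_gt0 subr_gt0.
- by move=> A mA; apply: (increment_law) => //; rewrite s0.
Qed.

(** On the diagonal these are Gaussian variances; off it, the coordinates are independent and
    centred. The case [s = t] is separate because the law is given for [s < t]. *)
Lemma increment_covariance s t i j : 0 <= s <= t -> t <= T ->
  (\int[P]_w (increment s t i w * increment s t j w)%:E = ((i == j)%:R * (t - s))%:E)%E.
Proof.
move=> /andP[s0]; rewrite le_eqVlt => /predU1P[<- _|st tT].
  rewrite subrr mulr0 increment_diag; under eq_integral do rewrite mul0r.
  by rewrite integral0.
have st' : 0 <= s <= t by lra.
have m k : measurable_fun setT (increment s t k) by apply: minc => //; lra.
case: eqVneq => [<-|ij].
  under eq_integral do rewrite -expr2.
  rewrite (@normal_law_sqr _ _ _ _ _ (Num.sqrt (t - s)))//.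
  - by rewrite sqr_sqrtr ?mul1r//; lra.
  - by rewrite sqrtr_gt0 subr_gt0.
  - by move=> A mA; apply: (increment_law) => //; rewrite s0.
have ind : independent P (increment s t i) (increment s t j).
  by apply: (independent_coordinates) => //; rewrite s0.
have [_ ->] := independent_expectation (m i) (m j) ind
  (increment_integrable i st' tT) (increment_integrable j st' tT).
by rewrite !increment_mean// mul0e mul0r.
Qed.

(** Plays the part of a vanishing conditional expectation given the past; independence of the
    increment from [U] replaces conditioning. *)
Lemma filtration_increment_mean s t j U : 0 <= s <= t -> t <= T -> filtration_fun P B s U ->
  P.-integrable setT (EFin \o U) ->
  P.-integrable setT (fun w => (U w * increment s t j w)%:E) /\
  (\int[P]_w (U w * increment s t j w)%:E = 0)%E.
Proof.
move=> st tT FU iU.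
have mU : measurable_fun setT U by apply: (filtration_fun_measurable P_complete B_brownian _ FU); lra.
have minc' : measurable_fun setT (increment s t j) by apply: minc; lra.
have iE : increment s t j = (fun w => (B t w - B s w) 0 j).
  by apply/funext => w; rewrite !mxE.
have ind : independent P U (increment s t j).
  rewrite iE; apply: (independent_increment st tT FU (phi := fun v => v 0 j)).
    exact: coord_continuous.
  by rewrite -iE.
have [? ->] := independent_expectation mU minc' ind iU (increment_integrable j st tT).
by rewrite increment_mean// mule0.
Qed.

Lemma filtration_increment_covariance s t i j U : 0 <= s <= t -> t <= T -> filtration_fun P B s U ->
  P.-integrable setT (EFin \o U) ->
  P.-integrable setT (fun w => (U w * (increment s t i w * increment s t j w))%:E) /\
  (\int[P]_w (U w * (increment s t i w * increment s t j w))%:E =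
    ((i == j)%:R * (t - s))%:E * \int[P]_w (U w)%:E)%E.
Proof.
move=> st tT FU iU.
have mU : measurable_fun setT U by apply: (filtration_fun_measurable P_complete B_brownian _ FU); lra.
have m k : measurable_fun setT (increment s t k) by apply: minc; lra.
pose phi (v : 'rV[R]_d) := v 0 i * v 0 j.
have iE : (fun w => increment s t i w * increment s t j w) = (fun w => phi (B t w - B s w)).
  by apply/funext => w; rewrite /phi !mxE.
have mprod : measurable_fun setT (fun w => increment s t i w * increment s t j w) by exact: measurable_funM.
have ind : independent P U (fun w => increment s t i w * increment s t j w).
  rewrite iE; apply: (independent_increment st tT FU).
    move=> v; have h k := @coord_continuous R 1 d 0 k v; exact: (cvgM (h i) (h j)).
  by rewrite -iE.
have ip : P.-integrable setT (EFin \o (fun w => increment s t i w * increment s t j w)).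
  by apply: integrableM_of_sqr => //; exact: increment_sqr_integrable.
have [? ->] := independent_expectation mU mprod ind iU ip.
by rewrite increment_covariance// muleC.
Qed.

End BrownianIncrements.

Section MeanSquareScalar.
Context d (E : measurableType d) (R : realType) (m : {measure set E -> \bar R}) (D : set E).

Lemma enorm_scalar_sqr (x : R) : enorm (x%:M : 'rV[R]_1) ^+ 2 = x ^+ 2.
Proof. by rewrite enorm_sqr_rV big_ord1 !mxE eqxx mulr1n. Qed.

(** Reals are embedded as vectors of length 1, so that the lemmas on [msq] cover scalar second
    moments. *)
Lemma msq_scalar (F : E -> R) :
  msq m D (fun e => (F e)%:M : 'rV[R]_1) = (\int[m]_(e in D) (F e ^+ 2)%:E)%E.
Proof. by apply: eq_integral => e _; rewrite enorm_scalar_sqr. Qed.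

Lemma coord_measurable_scalar (F : E -> R) : measurable_fun D F ->
  coord_measurable D (fun e => (F e)%:M : 'rV[R]_1).
Proof.
move=> mF i; rewrite ord1 (_ : (fun _ => _) = F)//.
by apply/funext => e; rewrite mxE eqxx mulr1n.
Qed.

Lemma msq_coord n (F : E -> 'rV[R]_n) : measurable D -> coord_measurable D F ->
  (msq m D F = \sum_i \int[m]_(e in D) (F e 0 i ^+ 2)%:E)%E.
Proof.
move=> mD mF; rewrite -ge0_integral_sum//.
- by apply: eq_integral => e _; rewrite enorm_sqr_rV sumEFin.
- by move=> i; apply/measurable_EFinP; exact: measurable_funX.
- by move=> i e _; rewrite lee_fin sqr_ge0.
Qed.

End MeanSquareScalar.

Section ScalarMeanSquare.
Context d (E : measurableType d) (R : realType) (m : {measure set E -> \bar R}).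

Lemma integral_sqrD (F G : E -> R) : measurable_fun setT F -> measurable_fun setT G ->
  (\int[m]_e ((F e + G e) ^+ 2)%:E <=
   2%:E * \int[m]_e (F e ^+ 2)%:E + 2%:E * \int[m]_e (G e ^+ 2)%:E)%E.
Proof.
move=> mF mG; rewrite -!msq_scalar.
under [X in (X <= _)%E]eq_integral do rewrite raddfD.
by apply: msqD => //; exact: coord_measurable_scalar.
Qed.

Lemma integral_sqr_cvg (Fk : nat -> E -> R) (F : E -> R) :
  (forall k, measurable_fun setT (Fk k)) -> measurable_fun setT F ->
  (\int[m]_e (F e ^+ 2)%:E < +oo)%E ->
  (\int[m]_e ((Fk k e - F e) ^+ 2)%:E)%E @[k --> \oo] --> 0%E ->
  (\int[m]_e (Fk k e ^+ 2)%:E)%E @[k --> \oo] --> (\int[m]_e (F e ^+ 2)%:E)%E.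
Proof.
move=> mFk mF finF FkF; rewrite -msq_scalar.
under eq_fun do rewrite -msq_scalar.
apply: msq_cvg => //.
- by move=> k; exact: coord_measurable_scalar.
- exact: coord_measurable_scalar.
- by rewrite msq_scalar.
- rewrite (_ : (fun _ => _) = (fun k => (\int[m]_e ((Fk k e - F e) ^+ 2)%:E)%E))//.
  apply/funext => k; rewrite -msq_scalar; apply: eq_integral => e _.
  by rewrite raddfB.
Qed.

End ScalarMeanSquare.

Lemma cvge_squeeze0 (R : realType) (x y : nat -> \bar R) :
  (forall k, 0 <= x k)%E -> (forall k, x k <= y k)%E -> y @ \oo --> 0%E -> x @ \oo --> 0%E.
Proof.
move=> x0 xy y0; apply: (@squeeze_cvge _ _ _ _ (cst 0%E) _ y) => //.
  by near=> k; rewrite x0 xy.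
exact: cvg_cst.
Unshelve. all: by end_near. Qed.

Lemma cvge_lin0 (R : realType) (x y : nat -> \bar R) (a b : R) : x @ \oo --> 0%E -> y @ \oo --> 0%E ->
  (a%:E * x k + b%:E * y k)%E @[k --> \oo] --> 0%E.
Proof.
move=> x0 y0; rewrite -[X in _ --> X]adde0.
by apply: cvgeD => //; [rewrite -[X in _ --> X](mule0 a%:E)|rewrite -[X in _ --> X](mule0 b%:E)]; exact: cvgeZl.
Qed.

(** * Ito isometry and step estimates *)

Section ItoCalculus.
Context (R : realType) (dO : measure_display) (Om : measurableType dO)
  (P : probability Om R) (T : R) (d : nat) (B : R -> Om -> 'rV[R]_d).
Hypothesis P_complete : measure_is_complete P.
Hypothesis B_brownian : brownian_motion P T B.
Notation inc := (increment B).
Notation ffun := (filtration_fun P B).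
Notation lam := (@lebesgue_measure R).
Notation lamP := (lam \x P)%E.
Notation dom s s' := (`]s, s'] `*` setT : set (R * Om)).
Notation cdom s s' := (`[s, s'] `*` setT : set (R * Om)).

Let mdom (s s' : R) : measurable (dom s s').
Proof. by apply: measurableX => //; exact: measurable_itv. Qed.

Let mcdom (s s' : R) : measurable (cdom s s').
Proof. by apply: measurableX => //; exact: measurable_itv. Qed.

Lemma probability_integral_cst (c : R) : (\int[P]_w c%:E = c%:E)%E.
Proof.
by rewrite integral_cst// [X in (_ * X)%E](_ : _ = 1%E) ?mule1//; exact: probability_setT.
Qed.

(** The length of the intersection of []a, b]] and []c, e]]. *)
Definition overlap (a b c e : R) : R := Num.max 0 (Num.min b e - Num.max a c).

Let minc := measurable_increment P_complete B_brownian.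
Let ffm s U : s <= T -> ffun s U -> measurable_fun setT U.
Proof. by move=> sT; exact: (filtration_fun_measurable P_complete B_brownian sT). Qed.

Lemma filtration_increment (a b : R) j (s : R) : 0 <= a <= b -> b <= s -> ffun s (inc a b j).
Proof.
move=> /andP[a0 ab] bs; apply: measurable_funB.
  apply: (filtration_fun_le bs); apply: brownian_filtration; lra.
by apply: (@filtration_fun_le _ _ _ _ _ _ a); [lra|exact: brownian_filtration].
Qed.

Let ffM s U V : ffun s U -> ffun s V -> ffun s (fun w => U w * V w).
Proof. by move=> mU mV; exact: measurable_funM. Qed.

(** For [a <= c < b], cut both intervals at [c] and at [m], the smaller right end. The common piece
    []c, m]] yields the covariance; every other product pairs an increment with a factor known at
    its start, and has mean zero. If [b <= c] there is no common piece. *)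
Let covariance_le (a b c e : R) z y i j (M : R) : 0 <= a <= b -> b <= T -> 0 <= c <= e -> e <= T ->
  ffun a z -> ffun c y -> (forall w, `|z w| <= M) -> (forall w, `|y w| <= M) -> a <= c ->
  (\int[P]_w ((z w * inc a b i w) * (y w * inc c e j w))%:E =
   ((i == j)%:R * overlap a b c e)%:E * \int[P]_w (z w * y w)%:E)%E.
Proof.
move=> ab bT ce eT Fz Fy zM yM ac.
have cT : c <= T by lra.
have mz : measurable_fun setT z by apply: (ffm _ Fz); lra.
have my : measurable_fun setT y by exact: (ffm cT Fy).
have zy : ffun c (fun w => z w * y w) by apply: ffM => //; exact: filtration_fun_le Fz.
have zyM w : `|z w * y w| <= M * M by rewrite normrM ler_pM.
have izy : P.-integrable setT (EFin \o (fun w => z w * y w)).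
  by apply: (@integrable_bounded _ _ _ _ _ (M * M)) => //; exact: (ffm cT zy).
have [bc|cb] := leP b c.
  have -> : overlap a b c e = 0.
    rewrite /overlap (max_r ac); apply: max_l; rewrite subr_le0.
    by rewrite ge_min bc.
  rewrite mulr0 mul0e.
  rewrite (eq_integral (fun w => (z w * y w * inc a b i w * inc c e j w)%:E)); last first.
    by move=> w _; congr (_%:E); ring.
  have FX : ffun c (fun w => z w * y w * inc a b i w).
    by apply: ffM => //; exact: filtration_increment.
  have iX : P.-integrable setT (EFin \o (fun w => z w * y w * inc a b i w)).
    apply: (@integrableM_bounded _ _ _ _ _ _ (M * M)) => //.
    - exact: (ffm cT zy).
    - by apply: minc; lra.
    - exact: (increment_integrable P_complete B_brownian).
  by have [] := filtration_increment_mean P_complete B_brownian j ce eT FX iX.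
pose m := Num.min b e.
have mb : m <= b by rewrite ge_min lexx.
have me : m <= e by rewrite ge_min lexx orbT.
have cm : c <= m by rewrite le_min (ltW cb); case/andP : ce.
have c0 : 0 <= c by lra.
have -> : overlap a b c e = m - c.
  by rewrite /overlap (max_r ac) -/m; apply: max_r; rewrite subr_ge0.
have split_prod w : (z w * inc a b i w) * (y w * inc c e j w) =
    (z w * y w * inc a c i w) * inc c e j w +
    (z w * y w * (inc c m i w * inc c m j w) +
     ((z w * y w * inc c m i w) * inc m e j w + (z w * y w * inc c m j w) * inc m b i w)).
  (* One of the two tails beyond [m] is empty. *)
  have zero : inc m b i w * inc m e j w = 0.
    by rewrite /m /Num.min; case: ifP => _; rewrite increment_diag ?mul0r ?mulr0.
  rewrite (increment_split B a c b) (increment_split B c m b) (increment_split B c m e).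
  transitivity (z w * y w * inc a c i w * (inc c m j w + inc m e j w) +
    (z w * y w * (inc c m i w * inc c m j w) +
    (z w * y w * inc c m i w * inc m e j w + z w * y w * inc c m j w * inc m b i w)) +
    z w * y w * (inc m b i w * inc m e j w)); first by ring.
  by rewrite zero mulr0 addr0.
have acT : 0 <= a <= c by lra.
have cmT : 0 <= c <= m by lra.
have mT : m <= T by lra.
have meT : 0 <= m <= e by lra.
have mbT : 0 <= m <= b by lra.
have izi s t k : 0 <= s <= t -> t <= T -> P.-integrable setT (EFin \o (fun w => z w * y w * inc s t k w)).
  move=> st tT; apply: (@integrableM_bounded _ _ _ _ _ _ (M * M)) => //.
  - exact: (ffm cT zy).
  - by apply: minc; lra.
  - exact: (increment_integrable P_complete B_brownian).
have Fzm k : ffun m (fun w => z w * y w * inc c m k w).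
  apply: ffM; first exact: filtration_fun_le zy.
  exact: filtration_increment.
have [i1 e1] := @filtration_increment_mean _ _ _ _ _ _ _ P_complete B_brownian c e j
  (fun w => z w * y w * inc a c i w) ce eT (ffM zy (filtration_increment i acT (lexx c))) (izi _ _ i acT cT).
have [i2 e2] := filtration_increment_covariance P_complete B_brownian i j cmT mT zy izy.
have [i3 e3] := filtration_increment_mean P_complete B_brownian j meT eT (Fzm i) (izi _ _ i cmT mT).
have [i4 e4] := filtration_increment_mean P_complete B_brownian i mbT bT (Fzm j) (izi _ _ j cmT mT).
under eq_integral => w _ do rewrite split_prod !EFinD.
have i34 := integrableD measurableT i3 i4.
have i234 := integrableD measurableT i2 i34.
rewrite (integralD measurableT i1 i234) (integralD measurableT i2 i34) (integralD measurableT i3 i4).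
by rewrite e1 e2 e3 e4 add0e !adde0.
Qed.

Lemma term_covariance (a b c e : R) z y i j (M : R) : 0 <= a <= b -> b <= T -> 0 <= c <= e -> e <= T ->
  ffun a z -> ffun c y -> (forall w, `|z w| <= M) -> (forall w, `|y w| <= M) ->
  (\int[P]_w ((z w * inc a b i w) * (y w * inc c e j w))%:E =
   ((i == j)%:R * overlap a b c e)%:E * \int[P]_w (z w * y w)%:E)%E.
Proof.
move=> ab bT ce eT Fz Fy zM yM; have [ac|ca] := leP a c; first exact: (covariance_le i j ab bT ce eT Fz Fy zM yM).
under eq_integral do rewrite mulrC.
rewrite (covariance_le j i ce eT ab bT Fy Fz yM zM (ltW ca)).
rewrite (_ : overlap c e a b = overlap a b c e); last by rewrite /overlap (minC e) (maxC c).
rewrite (eq_sym j i); congr (_ * _)%E.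
by apply: eq_integral => w _; rewrite mulrC.
Qed.

Lemma term_sqr_integrable (a b : R) z j (M : R) : 0 <= a <= b -> b <= T -> ffun a z ->
  (forall w, `|z w| <= M) -> P.-integrable setT (fun w => ((z w * inc a b j w) ^+ 2)%:E).
Proof.
move=> ab bT Fz zM; apply: (@sqr_integrableM_bounded _ _ _ _ _ _ M) => //.
- by apply: (ffm _ Fz); lra.
- by apply: minc; lra.
- exact: (increment_sqr_integrable P_complete B_brownian).
Qed.

Lemma term_measurable (a b : R) z j : 0 <= a <= b -> b <= T -> ffun a z ->
  measurable_fun setT (fun w => z w * inc a b j w).
Proof.
move=> ab bT Fz; apply: measurable_funM; first by apply: (ffm _ Fz); lra.
by apply: minc; lra.
Qed.

(* Bounded simple integrands written as sums of scalar terms [z 1_]a, b]] e_j],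
   whose intervals may overlap; this form is stable under differences. *)
Definition elementary (s s' : R) (J : Om -> R) (h : R * Om -> 'rV[R]_d) : Prop :=
  exists (I : finType) (a b : I -> R) (j : I -> 'I_d) (z : I -> Om -> R) (M : R),
  [/\ forall p, [/\ s <= a p, a p <= b p & b p <= s'],
      forall p, ffun (a p) (z p),
      forall p w, `|z p w| <= M,
      forall w, J w = \sum_p z p w * inc (a p) (b p) (j p) w &
      forall r w, s < r <= s' -> h (r, w) =
        \sum_p ((a p < r <= b p)%R%:R * z p w) *: delta_mx 0 (j p)].

Let lam_overlap (s s' a b c e : R) : s <= a -> b <= s' ->
  lam (`]s, s'] `&` `]Num.max a c, Num.min b e]) = (overlap a b c e)%:E.
Proof.
move=> sa bs; rewrite (_ : _ `&` _ = `]Num.max a c, Num.min b e]%classic); last first.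
  apply/seteqP; split => r /=; first by case.
  rewrite !in_itv/= gt_max le_min => /andP[/andP[h1 h2] /andP[h3 h4]].
  by split; apply/andP; split => //; lra.
rewrite /overlap lebesgue_measure_itv/= lte_fin.
case: ltP => h; rewrite -?EFinB; congr (_%:E); apply: esym; [apply: max_r|apply: max_l].
  by rewrite subr_ge0 ltW.
by rewrite subr_le0.
Qed.

Let indic_overlap (a b c e r : R) :
  ((a < r <= b)%R%:R * (c < r <= e)%R%:R : R) = \1_(`]Num.max a c, Num.min b e]%classic) r.
Proof.
rewrite indicE mem_setE in_itv/= gt_max le_min -natrM mulnb; congr (_%:R).
by case: (a < r); case: (c < r); case: (r <= b); case: (r <= e).
Qed.

(** Products of indicators integrate to overlaps and the vectors [delta_mx 0 (j p)] are orthonormal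
    or equal. The resulting double sum is the one that the covariances produce, which is the content
    of the isometry. *)
Let path_square (I : finType) (s s' : R) (a b : I -> R) (j : I -> 'I_d) (z : I -> Om -> R) h w :
  (forall p, [/\ s <= a p, a p <= b p & b p <= s']) ->
  (forall r w, s < r <= s' -> h (r, w) =
        \sum_p ((a p < r <= b p)%R%:R * z p w) *: delta_mx 0 (j p)) ->
  (\int[lam]_(r in `]s, s']) (enorm (h (r, w) : 'rV[R]_d) ^+ 2)%:E =
  \sum_p \sum_q ((j p == j q)%:R * overlap (a p) (b p) (a q) (b q))%:E * (z p w * z q w)%:E)%E.
Proof.
move=> ab hE.
transitivity (\int[lam]_(r in `]s, s']) (\sum_p \sum_q ((j p == j q)%:R * (z p w * z q w))%:E *
        (\1_(`]Num.max (a p) (a q), Num.min (b p) (b q)]%classic) r)%:E))%E.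
  apply: eq_integral => r; rewrite inE/= in_itv/= => hr; rewrite (hE r w hr).
  under eq_bigr => p _ do under eq_bigr => q _ do rewrite -indic_overlap -EFinM.
  under eq_bigr do rewrite sumEFin.
  rewrite sumEFin enorm_sqr_rV; congr (_%:E).
  under eq_bigr => k _.
    rewrite summxE expr2 big_distrlr/=.
    under eq_bigr => p _ do under eq_bigr => q _ do rewrite !mxE eqxx/=.
    over.
  rewrite exchange_big/=; apply: eq_bigr => p _.
  rewrite exchange_big/=; apply: eq_bigr => q _.
  rewrite (bigD1 (j p))//= eqxx big1 ?addr0; last first.
    by move=> k /negbTE kp; rewrite kp mulr0 mul0r.
  rewrite mulr1.
  set u := (_ < _ <= _)%R%:R; set v := (_ < _ <= _)%R%:R; set t := (_ == _)%:R; by ring.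
have mI : measurable (`]s, s']%classic : set (measurableTypeR R)) by exact: measurable_itv.
have iI p q : lam.-integrable `]s, s'] (fun r =>
    (\1_(`]Num.max (a p) (a q), Num.min (b p) (b q)]%classic : set (measurableTypeR R)) r)%:E).
  by apply: (integrableS (E := setT)) => //; exact: integrable_indic_itv.
rewrite integral_sum//; last first.
  by move=> p; apply: integrable_sum => // q _; exact: (integrableZl mI _ (iI p q)).
apply: eq_bigr => p _; rewrite integral_sum//; last first.
  by move=> q; exact: (integrableZl mI _ (iI p q)).
apply: eq_bigr => q _; rewrite (integralZl mI (iI p q)).
rewrite integral_indic// [X in (_ * X)%E](_ : _ = (overlap (a p) (b p) (a q) (b q))%:E); last first.
  by rewrite setIC; apply: lam_overlap; case: (ab p).
by rewrite -!EFinM; congr (_%:E); rewrite mulrAC.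
Qed.

Lemma elementary_measurable (s s' : R) J h : 0 <= s -> s' <= T -> elementary s s' J h ->
  [/\ measurable_fun setT J, P.-integrable setT (fun w => (J w ^+ 2)%:E) &
      coord_measurable (`]s, s'] `*` setT) h].
Proof.
move=> s0 sT [I [a [b [j [z [M [ab Fz zM JE hE]]]]]]].
have abT p : 0 <= a p <= b p /\ b p <= T by have [h1 h2 h3] := ab p; split; lra.
pose X p w := z p w * inc (a p) (b p) (j p) w.
have mX p : measurable_fun setT (X p) by case: (abT p) => h1 h2; exact: term_measurable.
have iX2 p : P.-integrable setT (fun w => (X p w ^+ 2)%:E).
  by case: (abT p) => h1 h2; exact: (term_sqr_integrable _ h1 h2 (Fz p) (zM p)).
split.
- by rewrite (funext JE); exact: measurable_sum.
- rewrite (_ : (fun _ => _) = (fun w => \sum_p \sum_q (X p w * X q w)%:E)%E); last first.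
    apply/funext => w; rewrite JE expr2 big_distrlr/= -sumEFin; apply: eq_bigr => p _.
    by rewrite sumEFin.
  by apply: integrable_sum => // p _; apply: integrable_sum => // q _; exact: integrableM_of_sqr.
- move=> k; apply: (@eq_measurable_fun _ _ _ _ _
      (fun x => \sum_p (\1_(`]a p, b p]%classic) x.1 * z p x.2) * (k == j p)%:R)).
    move=> [r w]; rewrite inE/= in_itv/= => -[hr _]; rewrite (hE r w hr) summxE.
    by apply: eq_bigr => p _; rewrite !mxE eqxx/= indicE mem_setE in_itv/=.
  apply: measurable_sum => p; apply: measurable_funM => //; apply: measurable_funM.
    apply: measurable_funTS; apply: measurableT_comp; last exact: measurable_fst.
    by apply: measurable_indic; exact: measurable_itv.
  apply: measurable_funTS; apply: measurableT_comp; last exact: measurable_snd.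
  by apply: (ffm _ (Fz p)); have [h1 h2] := abT p; lra.
Qed.

(** The cross term vanishes because [U] times [z p] is known at [a p >= s], the start of the
    increment. The remaining terms match: E J^2 and E int |h|^2 expand into the same double sum over
    pairs of terms. *)
Lemma elementary_pythagoras (s s' : R) J h U : 0 <= s -> s <= s' -> s' <= T ->
  elementary s s' J h -> ffun s U -> P.-integrable setT (fun w => (U w ^+ 2)%:E) ->
  (\int[P]_w ((U w + J w) ^+ 2)%:E =
   \int[P]_w (U w ^+ 2)%:E + msq lamP (`]s, s'] `*` setT) h)%E.
Proof.
move=> s0 ss' s'T elJ FU iU2.
have [mJ iJ2 mh] := elementary_measurable s0 s'T elJ.
case: elJ => [I [a [b [j [z [M [ab Fz zM JE hE]]]]]]].
have abT p : 0 <= a p <= b p /\ b p <= T by have [h1 h2 h3] := ab p; split; lra.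
have sT : s <= T := le_trans ss' s'T.
have mU : measurable_fun setT U by exact: (ffm sT FU).
have iU := integrable_of_sqr mU iU2.
have mz p : measurable_fun setT (z p).
  by apply: (ffm _ (Fz p)); have [h1 h2] := abT p; lra.
pose X p w := z p w * inc (a p) (b p) (j p) w.
have mX p : measurable_fun setT (X p) by case: (abT p) => h1 h2; exact: term_measurable.
have iX2 p : P.-integrable setT (fun w => (X p w ^+ 2)%:E).
  by case: (abT p) => h1 h2; exact: (term_sqr_integrable _ h1 h2 (Fz p) (zM p)).
have iXX p q : P.-integrable setT (fun w => (X p w * X q w)%:E).
  exact: integrableM_of_sqr.
have izz p q : P.-integrable setT (fun w => (z p w * z q w)%:E).
  apply: (@integrable_bounded _ _ _ _ (fun w => z p w * z q w) (M * M)).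
    exact: measurable_funM.
  by move=> w; rewrite normrM ler_pM.
pose V p q := ((j p == j q)%:R * overlap (a p) (b p) (a q) (b q)).
have cross p : P.-integrable setT (fun w => (U w * X p w)%:E) /\
    (\int[P]_w (U w * X p w)%:E = 0)%E.
  have [h1 h2] := abT p; have [h3 _ _] := ab p.
  have iUz : P.-integrable setT (EFin \o (fun w => U w * z p w)).
    under [X in _.-integrable _ X]eq_fun do rewrite /= mulrC.
    exact: (integrableM_bounded (mz p) mU (zM p) iU).
  have FUz : ffun (a p) (fun w => U w * z p w).
    by apply: ffM => //; exact: filtration_fun_le FU.
  have := filtration_increment_mean P_complete B_brownian (j p) h1 h2 FUz iUz.
  by under eq_fun do rewrite -mulrA.
have iUJ : P.-integrable setT (fun w => (U w * J w)%:E) by exact: integrableM_of_sqr.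
have UJ0 : (\int[P]_w (U w * J w)%:E = 0)%E.
  rewrite (eq_integral (fun w => \sum_p (U w * X p w)%:E)%E); last first.
    by move=> w _; rewrite JE mulr_sumr sumEFin.
  rewrite integral_sum//; last by move=> p; have [] := cross p.
  by rewrite big1// => p _; have [] := cross p.
have JJ : (\int[P]_w (J w ^+ 2)%:E = \sum_p \sum_q (V p q)%:E * \int[P]_w (z p w * z q w)%:E)%E.
  rewrite (eq_integral (fun w => \sum_p \sum_q (X p w * X q w)%:E)%E); last first.
    move=> w _; rewrite JE expr2 big_distrlr/= -sumEFin; apply: eq_bigr => p _.
    by rewrite sumEFin.
  rewrite integral_sum//; last by move=> p; apply: integrable_sum => // q _.
  apply: eq_bigr => p _; rewrite integral_sum//; apply: eq_bigr => q _.
  by case: (abT p) => p1 p2; case: (abT q) => q1 q2; exact: (term_covariance _ _ p1 p2 q1 q2).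
have hh : (msq lamP (`]s, s'] `*` setT) h = \sum_p \sum_q (V p q)%:E * \int[P]_w (z p w * z q w)%:E)%E.
  rewrite /msq tonelli_space_time//; last 2 first.
  - exact: measurable_sqr.
  - by move=> p _; rewrite lee_fin sqr_ge0.
  rewrite (eq_integral (fun w => \sum_p \sum_q ((V p q)%:E * (z p w * z q w)%:E))%E); last first.
    move=> w _; exact: path_square hE.
  rewrite integral_sum//; last by move=> p; apply: integrable_sum => // q _; exact: integrableZl.
  apply: eq_bigr => p _; rewrite integral_sum//; last by move=> q; exact: integrableZl.
  by apply: eq_bigr => q _; rewrite integralZl.
rewrite hh -JJ.
rewrite (eq_integral (fun w => (U w ^+ 2)%:E + (2%:E * (U w * J w)%:E + (J w ^+ 2)%:E))%E); last first.
  by move=> w _; rewrite -EFinM -!EFinD; congr (_%:E); ring.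
have i2UJ := integrableZl measurableT 2 iUJ.
have iS := integrableD measurableT i2UJ iJ2.
rewrite (integralD measurableT iU2 iS) (integralD measurableT i2UJ iJ2).
by rewrite integralZl// UJ0 mule0 add0e.
Qed.

(** The terms of both sums are put side by side, indexed by a disjoint union; overlapping intervals
    being allowed, no common refinement is formed. *)
Lemma elementaryB (s s' : R) J J' h h' : elementary s s' J h -> elementary s s' J' h' ->
  elementary s s' (fun w => J w - J' w) (fun p => h p - h' p).
Proof.
move=> [I [a [b [j [z [M [ab Fz zM JE hE]]]]]]] [I' [a' [b' [j' [z' [M' [ab' Fz' zM' JE' hE']]]]]]].
pose se X (f : I -> X) (f' : I' -> X) (p : I + I') := match p with inl p => f p | inr p => f' p end.
exists (I + I')%type, (se _ a a'), (se _ b b'), (se _ j j'),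
  (se _ z (fun p w => - z' p w)), (Num.max M M'); split.
- by case.
- case => p /=; first exact: Fz.
  exact: (measurableT_comp (@oppr_measurable R setT) (Fz' p)).
- by case => p w /=; rewrite ?normrN le_max ?zM ?zM' ?orbT.
- move=> w; rewrite big_sumType/= JE JE' -sumrN; congr (_ + _).
  by apply: eq_bigr => p _; rewrite mulNr.
- move=> r w rs; rewrite big_sumType/= (hE r w rs) (hE' r w rs) -sumrN; congr (_ + _).
  by apply: eq_bigr => p _; rewrite mulrN scaleNr.
Qed.

(** The closure of the [elementary] pairs under mean-square convergence of both components. It
    retains what the isometry uses on one interval, and allows integrals started at different times
    to be subtracted. *)
Definition ito_increment (s s' : R) (J : Om -> R) (h : R * Om -> 'rV[R]_d) : Prop :=
  [/\ measurable_fun setT J, coord_measurable (dom s s') h,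
      (msq lamP (dom s s') h < +oo)%E &
      exists Jk hk, [/\ forall k : nat, elementary s s' (Jk k) (hk k),
        (\int[P]_w ((Jk k w - J w) ^+ 2)%:E)%E @[k --> \oo] --> 0%E &
        msq lamP (dom s s') (fun p => hk k p - h p) @[k --> \oo] --> 0%E]].

(** Both sides of the identity for elementary pairs converge in the mean-square approximation, so
    their limits agree. *)
Lemma ito_pythagoras (s s' : R) J h U : 0 <= s -> s <= s' -> s' <= T ->
  ito_increment s s' J h -> ffun s U -> P.-integrable setT (fun w => (U w ^+ 2)%:E) ->
  (\int[P]_w ((U w + J w) ^+ 2)%:E =
   \int[P]_w (U w ^+ 2)%:E + msq lamP (dom s s') h)%E.
Proof.
move=> s0 ss' s'T [mJ mh hfin [Jk [hk [el JkJ hkh]]]] FU iU.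
have mU : measurable_fun setT U.
  by apply: (filtration_fun_measurable P_complete B_brownian _ FU); lra.
have elm k := elementary_measurable s0 s'T (el k).
have mJk k : measurable_fun setT (Jk k) by case: (elm k).
have isqr_ge0 (F : Om -> R) : (0 <= \int[P]_w (F w ^+ 2)%:E)%E.
  by apply: integral_ge0 => w _; rewrite lee_fin sqr_ge0.
have sqr_fin (F : Om -> R) : P.-integrable setT (fun w => (F w ^+ 2)%:E) -> (\int[P]_w (F w ^+ 2)%:E < +oo)%E.
  by move=> /integrableP[_]; under eq_integral do rewrite gee0_abs ?lee_fin ?sqr_ge0//.
have finUJ : (\int[P]_w ((U w + J w) ^+ 2)%:E < +oo)%E.
  (* A single approximation at finite distance from [J] shows that [U + J] is square integrable. *)
  have /fine_cvgP[[k _ kfin] _] := JkJ.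
  have ek := kfin k (leqnn k).
  have e w : U w + J w = (U w + Jk k w) + - (Jk k w - J w) by ring.
  under eq_integral do rewrite e.
  apply: le_lt_trans (integral_sqrD _ _ _) _.
  - exact: measurable_funD.
  - by apply: measurableT_comp => //; exact: measurable_funB.
  apply: lte_add_pinfty; apply: lte_mul_pinfty => //.
  - apply: le_lt_trans (integral_sqrD _ _ _) _ => //.
    apply: lte_add_pinfty; apply: lte_mul_pinfty => //; first exact: sqr_fin.
    by apply: sqr_fin; case: (elm k).
  - under eq_integral do rewrite sqrrN.
    by rewrite ltey_eq ek.
have c1 : (\int[P]_w ((U w + Jk k w) ^+ 2)%:E)%E @[k --> \oo] --> (\int[P]_w ((U w + J w) ^+ 2)%:E)%E.
  apply: integral_sqr_cvg => //.
  - by move=> k; exact: measurable_funD.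
  - exact: measurable_funD.
  - have e k w : (U w + Jk k w) - (U w + J w) = Jk k w - J w by ring.
    by under eq_fun do under eq_integral do rewrite e.
have c2 : msq lamP (dom s s') (hk k) @[k --> \oo] --> msq lamP (dom s s') h.
  by apply: msq_cvg => //; [exact: mdom|move=> k; case: (elm k)].
have e k : (\int[P]_w ((U w + Jk k w) ^+ 2)%:E =
    \int[P]_w (U w ^+ 2)%:E + msq lamP (dom s s') (hk k))%E.
  exact: (elementary_pythagoras).
rewrite (funext e) in c1.
apply: (cvg_unique (@ereal_hausdorff R) c1) => /=.
apply: cvgeD => //; last exact: cvg_cst.
by rewrite ge0_adde_def// inE ?isqr_ge0 ?msq_ge0.
Qed.

Lemma ito_incrementB (s s' : R) J J' h h' : 0 <= s -> s' <= T -> ito_increment s s' J h ->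
  ito_increment s s' J' h' ->
  ito_increment s s' (fun w => J w - J' w) (fun p => h p - h' p).
Proof.
move=> s0 sT [mJ mh hfin [Jk [hk [el JkJ hkh]]]] [mJ' mh' hfin' [Jk' [hk' [el' JkJ' hkh']]]].
have elm k := elementary_measurable s0 sT (el k).
have elm' k := elementary_measurable s0 sT (el' k).
have msq_sub (f g : R * Om -> 'rV[R]_d) : coord_measurable (dom s s') f -> coord_measurable (dom s s') g ->
    (msq lamP (dom s s') (fun p => (f p - g p)%R) <= 2%:E * msq lamP (dom s s') f + 2%:E * msq lamP (dom s s') g)%E.
  move=> mf mg; apply: msq_lin => //; [exact: mdom|exact: coord_measurableB|].
  by move=> p _; rewrite (le_trans (enormD_sqr _ _))// enormN.
split.
- exact: measurable_funB.
- exact: coord_measurableB.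
- apply: le_lt_trans (msq_sub _ _ mh mh') _.
  by apply: lte_add_pinfty; apply: lte_mul_pinfty.
- exists (fun k w => Jk k w - Jk' k w), (fun k p => hk k p - hk' k p); split.
  + by move=> k; exact: elementaryB.
  + apply: (@cvge_squeeze0 _ _ (fun k => 2%:E * (\int[P]_w ((Jk k w - J w) ^+ 2)%:E) +
        2%:E * (\int[P]_w ((Jk' k w - J' w) ^+ 2)%:E))%E).
    * by move=> k; apply: integral_ge0 => w _; rewrite lee_fin sqr_ge0.
    * move=> k; have mk : measurable_fun setT (fun w => Jk k w - J w).
        by apply: measurable_funB => //; case: (elm k).
      have mk' : measurable_fun setT (fun w => Jk' k w - J' w).
        by apply: measurable_funB => //; case: (elm' k).
      have := @integral_sqrD _ _ _ P _ (fun w => - (Jk' k w - J' w)) mk (measurableT_comp (@oppr_measurable R setT) mk').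
      under [X in (_ <= _ + _ * X)%E -> _]eq_integral do rewrite sqrrN.
      apply: le_trans; apply: le_of_eq.
      by apply: eq_integral => w _; congr ((_ ^+ 2)%:E); ring.
    * exact: (@cvge_lin0 _ _ _ 2 2 JkJ JkJ').
  + apply: (@cvge_squeeze0 _ _ (fun k => 2%:E * msq lamP (dom s s') (fun p => (hk k p - h p)%R) +
        2%:E * msq lamP (dom s s') (fun p => (hk' k p - h' p)%R))%E).
    * by move=> k; exact: msq_ge0.
    * move=> k; have mk : coord_measurable (dom s s') (fun p => hk k p - h p).
        by apply: coord_measurableB => //; case: (elm k).
      have mk' : coord_measurable (dom s s') (fun p => hk' k p - h' p).
        by apply: coord_measurableB => //; case: (elm' k).
      apply: le_trans (msq_sub _ _ mk mk'); apply: le_of_eq.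
      by apply: eq_integral => p _; congr ((enorm _ ^+ 2)%:E); rewrite !opprD !opprK addrACA.
    * exact: (@cvge_lin0 _ _ _ 2 2 hkh hkh').
Qed.

Lemma coord_measurableS n (D D' : set (R * Om)) (h : R * Om -> 'rV[R]_n) :
  measurable D' -> D `<=` D' -> coord_measurable D' h -> coord_measurable D h.
Proof. by move=> mD' DD' mh i; exact: measurable_funS (mh i). Qed.

Lemma dom_sub (s s' t u : R) : t <= s -> s' <= u -> dom s s' `<=` dom t u.
Proof.
move=> ts su [r w] [] /=; rewrite in_itv/= => /andP[h1 h2] _; split => //=.
by rewrite in_itv/=; apply/andP; split; lra.
Qed.

Lemma dom_sub_closed (s s' t u : R) : t <= s -> s' <= u -> dom s s' `<=` (`[t, u] `*` setT : set (R * Om)).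
Proof.
move=> ts su [r w] [] /=; rewrite in_itv/= => /andP[h1 h2] _; split => //=.
by rewrite in_itv/=; apply/andP; split; lra.
Qed.

Lemma msq_subset n (s s' t u : R) (h : R * Om -> 'rV[R]_n) : t <= s -> s' <= u ->
  coord_measurable (dom t u) h -> (msq lamP (dom s s') h <= msq lamP (dom t u) h)%E.
Proof.
move=> ts su mh; apply: ge0_subset_integral.
- exact: mdom.
- exact: mdom.
- exact: measurable_sqr.
- by move=> p _; rewrite lee_fin sqr_ge0.
- exact: dom_sub.
Qed.

(** The closed interval of [in_H2] and the half-open one of the steps differ by a null set;
    half-open steps adjoin without overlap. *)
Lemma msq_iterated n (t u : R) (h : R * Om -> 'rV[R]_n) : coord_measurable (dom t u) h ->
  msq lamP (dom t u) h =
    (\int[P]_w \int[lam]_(r in `[t, u]) (enorm (h (r, w)) ^+ 2)%:E)%E.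
Proof.
move=> mh; have mf : measurable_fun (dom t u) (fun p => (enorm (h p) ^+ 2)%:E) by exact: measurable_sqr.
have f0 p : dom t u p -> (0 <= (enorm (h p) ^+ 2)%:E)%E by move=> _; rewrite lee_fin sqr_ge0.
have mI : measurable (`]t, u]%classic : set R) by exact: measurable_itv.
apply: (eq_trans (tonelli_space_time P mI mf f0)).
apply: eq_integral => w _; rewrite integral_itv_obnd_cbnd//.
by apply: (time_section w _ mf); exact: measurable_itv.
Qed.

(** The breakpoints are projected onto [[s, s']] by [cl], which changes neither the contributions to
    the integral over this interval nor the indicators on it. *)
Lemma simple_elementary (t s s' : R) (S : simple_process R Om d) : 0 <= t -> t <= s -> s <= s' -> s' <= T ->
  is_simple P T B t S ->
  elementary s s' (fun w => simple_integral B S s' w - simple_integral B S s w)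
    (fun p => simple_eval S p.1 p.2).
Proof.
move=> t0 ts ss' s'T [tS ndS FS [M SM]].
pose n := sp_size S.
pose cl v := Num.max s (Num.min v s').
have clP v : s <= cl v <= s' by rewrite /cl le_max lexx/= ge_max ss' ge_min lexx orbT.
have cl_nd v v' : v <= v' -> cl v <= cl v'.
  move=> vv; rewrite /cl ge_max !le_max lexx/=; apply/orP; right.
  by rewrite le_min !ge_min vv lexx orbT.
exists ('I_n * 'I_d)%type, (fun p : 'I_n * 'I_d => cl (sp_time S p.1)),
  (fun p : 'I_n * 'I_d => cl (sp_time S p.1.+1)), snd,
  (* A term starting after [s'] has both projected times equal to [s'], where its value need not be
     known yet. It contributes nothing, and the value 0 keeps it adapted; [|M|] bounds this 0 as
     well. *)
  (fun (p : 'I_n * 'I_d) w => if sp_time S p.1 <= s' then sp_val S p.1 w 0 p.2 else 0), `|M|; split.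
- move=> [k j] /=; have /andP[h1 _] := clP (sp_time S k).
  have /andP[_ h2] := clP (sp_time S k.+1).
  by split => //; apply: cl_nd; exact: (ndS _ (ltn_ord k)).
- move=> [k j] /=; case: (boolP (sp_time S k <= s')) => ks'; last exact: measurable_cst.
  apply: (@filtration_fun_le _ _ _ _ _ _ (sp_time S k)).
    by rewrite /cl le_max (min_l ks') lexx orbT.
  apply: (@measurable_on_filtration _ _ _ _ _ _ _ _ (sp_val S k) (fun v => v 0 j)); last exact: (FS _ (ltn_ord k)).
  exact: coord_continuous.
- move=> [k j] w /=; case: ifPn => _; last by rewrite normr0.
  apply: (le_trans (coord_le_enorm _ _ _)); apply: le_trans (ler_norm _).
  exact: (SM _ _ (ltn_ord k)).
- move=> w; rewrite /simple_integral -sumrB -(pair_bigA _ (fun (k : 'I_n) (j : 'I_d) =>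
    (if sp_time S k <= s' then sp_val S k w 0 j else 0) *
      inc (cl (sp_time S k)) (cl (sp_time S k.+1)) j w))/=.
  apply: eq_bigr => k _; rewrite -sumrB; apply: eq_bigr => j _.
  have key v : B (Num.min s' v) w 0 j - B (Num.min s v) w 0 j = B (cl v) w 0 j - B s w 0 j.
    rewrite /cl; have [vs|sv] := leP v s.
      by rewrite (min_r (le_trans vs ss')) (min_l (le_trans vs ss')) ?(min_r vs) ?(max_l vs) !subrr.
    by rewrite ?(min_l (ltW sv)) (minC v) max_r// le_min ss' (ltW sv).
  rewrite -mulrBr /increment.
  have -> : B (Num.min s' (sp_time S k.+1)) w 0 j - B (Num.min s' (sp_time S k)) w 0 j -
     (B (Num.min s (sp_time S k.+1)) w 0 j - B (Num.min s (sp_time S k)) w 0 j) =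
     B (cl (sp_time S k.+1)) w 0 j - B (cl (sp_time S k)) w 0 j.
    have := key (sp_time S k.+1); have := key (sp_time S k); lra.
  case: ifPn => //; rewrite -ltNge => s'k.
  have s'k1 : s' < sp_time S k.+1 by apply: lt_le_trans (ndS _ (ltn_ord k)).
  by rewrite /cl (min_r (ltW s'k)) (min_r (ltW s'k1)) subrr !mulr0.
- move=> r w /andP[sr rs'] /=; rewrite /simple_eval.
  rewrite -(pair_bigA _ (fun (k : 'I_n) (j : 'I_d) =>
    ((cl (sp_time S k) < r <= cl (sp_time S k.+1))%R%:R *
    (if sp_time S k <= s' then sp_val S k w 0 j else 0)) *: delta_mx 0 j))/=.
  apply: eq_bigr => k _.
  have -> : (cl (sp_time S k) < r <= cl (sp_time S k.+1)) = (sp_time S k < r <= sp_time S k.+1).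
    rewrite /cl gt_max sr/= gt_min le_max le_min rs' andbT.
    by rewrite [s' < r]ltNge rs' orbF [r <= s]leNgt sr.
  case: ifPn => [/andP[kr rk]|_]; last by rewrite big1// => j _; rewrite mul0r scale0r.
  rewrite [LHS]row_sum_delta; apply: eq_bigr => j _.
  by rewrite mul1r (le_trans (ltW kr) rs').
Qed.

Lemma measurable_simple_integral (t r : R) (S : simple_process R Om d) : 0 <= t -> t <= r <= T ->
  is_simple P T B t S -> measurable_fun setT (simple_integral B S r).
Proof.
move=> t0 tr simS; have tT : t <= r by lra.
have rT : r <= T by lra.
have el := simple_elementary t0 (lexx t) tT rT simS.
have [mJ _ _] := elementary_measurable t0 rT el.
have [tS ndS _ _] := simS.
rewrite (_ : simple_integral B S r = fun w => simple_integral B S r w - simple_integral B S t w)//.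
apply/funext => w; rewrite [X in _ - X](_ : _ = 0) ?subr0//.
rewrite /simple_integral big1// => k _; rewrite big1// => j _.
have h1 := tS k (ltnW (ltn_ord k)); have h2 := ndS k (ltn_ord k).
by rewrite !min_l ?subrr ?mulr0//; lra.
Qed.

(** One approximating sequence serves all subintervals: its integrals converge at [s] and at [s'],
    and its integrands converge on all of []t, T]]. *)
Lemma ito_integral_increment (t s s' : R) H I : 0 <= t -> t <= s -> s <= s' -> s' <= T ->
  ito_integral P T B t H I ->
  ito_increment s s' (fun w => I s' w - I s w) (fun p => H p.1 p.2).
Proof.
move=> t0 ts ss' s'T [[pH H2] aI cI [S [simS SH SI]]].
have tT : t <= T by lra.
have mHc := progressive_measurable P_complete B_brownian tT pH.
have mH : coord_measurable (dom t T) (fun p : R * Om => H p.1 p.2).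
  apply: coord_measurableS mHc; last exact: dom_sub_closed.
  by apply: measurableX => //; exact: measurable_itv.
have mHs : coord_measurable (dom s s') (fun p : R * Om => H p.1 p.2).
  by apply: coord_measurableS mH; [exact: mdom|exact: dom_sub].
have mI r : t <= r <= T -> measurable_fun setT (I r).
  move=> tr; have FI : ffun r (I r).
    by apply: (@adapted_measurable R dO Om P T d B R t I idfun r) => // x; exact: cvg_id.
  by apply: (filtration_fun_measurable P_complete B_brownian _ FI); lra.
have el k := simple_elementary t0 ts ss' s'T (simS k).
have elT k := simple_elementary t0 (lexx t) tT (lexx T) (simS k).
have s0 : 0 <= s by lra.
split => //.
- by apply: measurable_funB; apply: mI; lra.
- apply: le_lt_trans (msq_subset ts s'T mH) _.
  by rewrite msq_iterated.
- exists (fun k w => simple_integral B (S k) s' w - simple_integral B (S k) s w),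
    (fun k p => simple_eval (S k) p.1 p.2); split => //.
  + apply: (@cvge_squeeze0 _ _ (fun k => 2%:E * (\int[P]_w ((simple_integral B (S k) s' w - I s' w) ^+ 2)%:E) +
        2%:E * (\int[P]_w ((simple_integral B (S k) s w - I s w) ^+ 2)%:E))%E).
    * by move=> k; apply: integral_ge0 => w _; rewrite lee_fin sqr_ge0.
    * move=> k; have [mJ _ _] := elementary_measurable s0 s'T (el k).
      have mS r : t <= r <= T -> measurable_fun setT (fun w => simple_integral B (S k) r w - I r w).
        move=> tr; apply: measurable_funB; last exact: mI.
        by apply: (measurable_simple_integral t0).
      have ms' : measurable_fun setT (fun w => simple_integral B (S k) s' w - I s' w) by apply: mS; lra.
      have ms : measurable_fun setT (fun w => simple_integral B (S k) s w - I s w) by apply: mS; lra.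
      have := @integral_sqrD _ _ _ P _ (fun w => - (simple_integral B (S k) s w - I s w)) ms' (measurableT_comp (@oppr_measurable R setT) ms).
      under [X in (_ <= _ + _ * X)%E -> _]eq_integral do rewrite sqrrN.
      apply: le_trans; apply: le_of_eq.
      by apply: eq_integral => w _; congr ((_ ^+ 2)%:E); ring.
    * by apply: cvge_lin0; apply: SI; lra.
  + apply: (@cvge_squeeze0 _ _ (fun k => msq lamP (dom t T) (fun p => (simple_eval (S k) p.1 p.2 - H p.1 p.2)%R))).
    * by move=> k; exact: msq_ge0.
    * move=> k; apply: msq_subset => //; apply: coord_measurableB => //.
      by have [] := elementary_measurable t0 (lexx T) (elT k).
    * apply: cvg_trans SH; apply: near_eq_cvg; near=> k; rewrite msq_iterated//.
      apply: coord_measurableB => //.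
      by have [] := elementary_measurable t0 (lexx T) (elT k).
Unshelve. all: by end_near. Qed.

(** Cauchy-Schwarz in time along almost every path, then Tonelli. The factor [s' - s] in front makes
    the squared drift of second order over a short step when [g] has bounded second moments. *)
Lemma drift_bound (s s' : R) (A : Om -> R) (g : R * Om -> R) : s <= s' ->
  measurable_fun setT A -> measurable_fun (dom s s') g ->
  (forall p, dom s s' p -> 0 <= g p) ->
  {ae P, forall w, (`|A w|%:E <= \int[lam]_(r in `]s, s']) (g (r, w))%:E)%E} ->
  (\int[P]_w (A w ^+ 2)%:E <= (s' - s)%:E * \int[lamP]_(p in dom s s') (g p ^+ 2)%:E)%E.
Proof.
move=> ss' mA mg g0 Ag.
have mg2 : measurable_fun (dom s s') (fun p => (g p ^+ 2)%:E).
  by apply/measurable_EFinP; exact: measurable_funX.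
have ge2 p : dom s s' p -> (0 <= (g p ^+ 2)%:E)%E by rewrite lee_fin sqr_ge0.
have mI : measurable_fun setT (fun w => \int[lam]_(r in `]s, s']) (g (r, w) ^+ 2)%:E)%E.
  by apply: (@measurable_integral_time _ _ _ _ _ (fun p => (g p ^+ 2)%:E)) => //; exact: measurable_itv.
rewrite tonelli_space_time// -ge0_integralZl//; last 2 first.
- by move=> w _; apply: integral_ge0 => r _; rewrite lee_fin sqr_ge0.
- by rewrite lee_fin subr_ge0.
apply: ae_ge0_le_integral => //.
- by move=> w _; rewrite lee_fin sqr_ge0.
- by apply/measurable_EFinP; exact: measurable_funX.
- move=> w _; rewrite mule_ge0 ?lee_fin ?subr_ge0//.
  by apply: integral_ge0 => r _; rewrite lee_fin sqr_ge0.
- exact: measurable_funeM.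
- apply: filterS Ag => w Aw _; rewrite -[A w ^+ 2]real_normK ?num_real//.
  apply: (@sqr_le_integral_sqr _ _ _ _ (fun r => g (r, w))) => //.
  + by apply: (time_section w _ mg); exact: measurable_itv.
  + by move=> r hr; apply: g0; split => //=; rewrite in_itv.
Qed.

(** * Second moments across one step *)

Section Step.
Context (s s' : R) (U V J : Om -> R) (h : R * Om -> 'rV[R]_d) (g : R * Om -> R).
Hypotheses (s0 : 0 <= s) (ss' : s <= s') (s'T : s' <= T).
Hypotheses (FU : ffun s U) (U2 : P.-integrable setT (fun w => (U w ^+ 2)%:E))
  (mV : measurable_fun setT V) (ito : ito_increment s s' J h).
Hypotheses (mg : measurable_fun (dom s s') g)
  (g0 : forall p, dom s s' p -> 0 <= g p)
  (Vg : {ae P, forall w, (`|V w - U w - J w|%:E <=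
     \int[lam]_(r in `]s, s']) (g (r, w))%:E)%E}).

Let mU : measurable_fun setT U.
Proof. by apply: (filtration_fun_measurable P_complete B_brownian _ FU); exact: le_trans s'T. Qed.
Let mJ : measurable_fun setT J. Proof. by case: ito. Qed.
Let mA : measurable_fun setT (fun w => V w - U w - J w).
Proof. by apply: measurable_funB => //; exact: measurable_funB. Qed.

(** [V] is [U + J] plus a drift remainder. The isometry evaluates the first part exactly, and
    [(a + b)^2 <= 2 a^2 + 2 b^2] accounts for the factors 2. *)
Lemma ito_step_forward : (\int[P]_w (V w ^+ 2)%:E <=
  2%:E * (\int[P]_w (U w ^+ 2)%:E + msq lamP (dom s s') h) +
  2%:E * ((s' - s)%:E * \int[lamP]_(p in dom s s') (g p ^+ 2)%:E))%E.
Proof.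
rewrite -(ito_pythagoras s0 ss' s'T ito FU U2).
have e w : V w = (U w + J w) + (V w - U w - J w) by ring.
under eq_integral do rewrite e.
apply: (le_trans (integral_sqrD _ (measurable_funD mU mJ) mA)).
by apply: leeD2l; apply: lee_wpmul2l => //; exact: drift_bound.
Qed.

(** Here [U + J] is [V] minus the drift remainder. The energy of [h] stays on the left, available to
    absorb the part of [g] that depends on [h]. *)
Lemma ito_step_backward : (\int[P]_w (U w ^+ 2)%:E + msq lamP (dom s s') h <=
  2%:E * \int[P]_w (V w ^+ 2)%:E +
  2%:E * ((s' - s)%:E * \int[lamP]_(p in dom s s') (g p ^+ 2)%:E))%E.
Proof.
rewrite -(ito_pythagoras s0 ss' s'T ito FU U2).
have e w : U w + J w = V w + - (V w - U w - J w) by ring.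
under eq_integral do rewrite e.
have mNA := measurableT_comp (@oppr_measurable R setT) mA.
apply: (le_trans (integral_sqrD _ mV mNA)).
apply: leeD2l; apply: lee_wpmul2l => //.
by under eq_integral do rewrite /= sqrrN; exact: drift_bound.
Qed.

End Step.

Lemma msq_dom_bound n (s s' M : R) (F : R * Om -> 'rV[R]_n) : s <= s' ->
  coord_measurable (dom s s') F ->
  (forall r, s < r <= s' -> (msq P setT (fun w => F (r, w)) <= M%:E)%E) ->
  (msq lamP (dom s s') F <= (M * (s' - s))%:E)%E.
Proof.
move=> ss' mF FM.
have -> : (M * (s' - s))%:E = (M%:E * lam (`]s, s']%classic))%E.
  rewrite lebesgue_measure_itv/= lte_fin; move: ss'; rewrite le_eqVlt => /predU1P[->|->].
    by rewrite ltxx subrr mulr0 mule0.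
  by rewrite -EFinB EFinM.
apply: msq_time_bound => //.
Qed.

Lemma msq_dom_cst (s s' c : R) : s <= s' ->
  (msq lamP (dom s s') (fun=> c%:M : 'rV[R]_1) <= (c ^+ 2 * (s' - s))%:E)%E.
Proof.
move=> ss'; apply: msq_dom_bound => //.
by move=> r _; rewrite msq_scalar probability_integral_cst.
Qed.

(** [g] is a constant source: [1 + enorm x] for the displacement from the starting point, 0 for the
    difference of two solutions. The bound [M] lets second moments be handled as reals in the
    Gronwall inequality. *)
Lemma sde_estimate n (K : R) : 0 <= K -> exists2 C : R, 0 <= C &
  forall (a0 g : R) (D : R -> Om -> 'rV[R]_n), 0 <= a0 <= T -> 0 <= g ->
  (forall s i, a0 <= s <= T -> ffun s (fun w => D s w 0 i)) ->
  coord_measurable (cdom a0 T) (fun p => D p.1 p.2) ->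
  (exists M : R, forall s, a0 <= s <= T -> (msq P setT (D s) <= M%:E)%E) ->
  (forall s s' i, a0 <= s <= s' -> s' <= T -> exists J h,
    [/\ ito_increment s s' J h,
      forall p, dom s s' p -> enorm (h p) ^+ 2 <= K * (g ^+ 2 + enorm (D p.1 p.2) ^+ 2) &
      {ae P, forall w, (`|D s' w 0 i - D s w 0 i - J w|%:E <=
        \int[lam]_(r in `]s, s']) (K * (g + enorm (D r w)))%:E)%E}]) ->
  forall s, a0 <= s <= T ->
    (msq P setT (D s) <= (C * (fine (msq P setT (D a0)) + (s - a0) * g ^+ 2))%:E)%E.
Proof.
(* Per coordinate, the diffusion contributes [2 * K] and the drift [2 * (2 * K ^+ 2)] on steps of
   length at most 1; the factor [n] sums the coordinates. *)
move=> K0; pose K' := n%:R * (2 * K + 4 * K ^+ 2).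
have K20 := sqr_ge0 K.
have K'0 : 0 <= K' by rewrite mulr_ge0//; lra.
have [C C0 hC] := @gronwall_forward R T K' 1 K'0 ltr01.
exists C => // a0 g D aT g0 FD mD [M0 hM0] step.
pose phi s := fine (msq P setT (D s)).
have Dfin s : a0 <= s <= T -> msq P setT (D s) = (phi s)%:E.
  move=> hs; rewrite fineK// ge0_fin_numE ?msq_ge0//.
  exact: le_lt_trans (hM0 s hs) (ltry _).
suff: forall s, a0 <= s <= T -> phi s <= C * (phi a0 + (s - a0) * g ^+ 2).
  by move=> h s hs; rewrite Dfin// lee_fin; exact: h.
apply: hC => //; first exact: sqr_ge0.
- by move=> s hs; rewrite -lee_fin -Dfin// msq_ge0.
- by exists M0 => s hs; rewrite -lee_fin -Dfin// hM0.
move=> s s' M hs s'T ss1 hM.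
have ss' : s <= s' by case/andP: hs.
have s0 : 0 <= s by lra.
have hs1 : a0 <= s <= T by lra.
have hs2 : a0 <= s' <= T by lra.
have mDd : coord_measurable (dom s s') (fun p => D p.1 p.2).
  by apply: coord_measurableS mD; [exact: mcdom|apply: dom_sub_closed => //; lra].
have mDs r : a0 <= r <= T -> coord_measurable setT (D r).
  by move=> hr i; apply: (filtration_fun_measurable P_complete B_brownian _ (FD r i hr)); lra.
have msqD : (msq lamP (dom s s') (fun p => D p.1 p.2) <= (M * (s' - s))%:E)%E.
  apply: msq_dom_bound => // r hr; rewrite Dfin ?lee_fin; last lra.
  by apply: hM; lra.
have msqg := msq_dom_cst g ss'.
have mcst : coord_measurable (dom s s') (fun=> g%:M : 'rV[R]_1).
  by apply: coord_measurable_scalar; exact: measurable_cst.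
have comb (c : R) : 0 <= c -> (c%:E * msq lamP (dom s s') (fun=> g%:M : 'rV[R]_1) +
    c%:E * msq lamP (dom s s') (fun p => D p.1 p.2) <= (c * ((s' - s) * (g ^+ 2 + M)))%:E)%E.
  move=> c0; apply: (@le_trans _ _ (c%:E * (g ^+ 2 * (s' - s))%:E + c%:E * (M * (s' - s))%:E)%E).
    by apply: leeD; apply: lee_wpmul2l.
  by rewrite -!EFinM -EFinD lee_fin; apply: le_of_eq; ring.
have M00 : 0 <= M by apply: le_trans (hM s _); [rewrite -lee_fin -Dfin// msq_ge0|lra].
have gM : 0 <= (s' - s) * (g ^+ 2 + M).
  by rewrite mulr_ge0 ?subr_ge0// addr_ge0// sqr_ge0.
have one i : (\int[P]_w (D s' w 0 i ^+ 2)%:E <=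
    2%:E * \int[P]_w (D s w 0 i ^+ 2)%:E + ((2 * K + 4 * K ^+ 2) * ((s' - s) * (g ^+ 2 + M)))%:E)%E.
  have [J [h [ito hK hA]]] := step s s' i hs s'T.
  have iD2 : P.-integrable setT (fun w => (D s w 0 i ^+ 2)%:E).
    apply/integrableP; split.
      by apply/measurable_EFinP; apply: measurable_funX; exact: (mDs s hs1 i).
    under eq_integral do rewrite gee0_abs ?lee_fin ?sqr_ge0//.
    apply: (@le_lt_trans _ _ (msq P setT (D s))); last by rewrite Dfin// ltry.
    apply: ge0_le_integral => //.
    - by move=> w _; rewrite lee_fin sqr_ge0.
    - by apply/measurable_EFinP; apply: measurable_funX; exact: (mDs s hs1 i).
    - by apply: measurable_sqr; exact: mDs.
    - move=> w _; rewrite lee_fin -[leLHS]real_normK ?num_real// ler_sqr ?nnegrE ?enorm_ge0//.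
      exact: coord_le_enorm.
  have [_ mh hfin _] := ito.
  pose G (p : R * Om) := K * (g + enorm (D p.1 p.2)).
  have mG : measurable_fun (dom s s') G.
    by apply: measurable_funM => //; apply: measurable_funD => //; exact: measurable_enorm.
  have G0 p : dom s s' p -> 0 <= G p by move=> _; rewrite mulr_ge0// addr_ge0// enorm_ge0.
  apply: (le_trans (ito_step_forward s0 ss' s'T (FD s i hs1) iD2
    (mDs s' hs2 i) ito mG G0 hA)).
  have hG : (\int[lamP]_(p in dom s s') (G p ^+ 2)%:E <= (2 * K ^+ 2 * ((s' - s) * (g ^+ 2 + M)))%:E)%E.
    rewrite -msq_scalar; apply: le_trans (comb _ _); last by rewrite mulr_ge0.
    apply: msq_lin => //.
    - exact: mdom.
    - by rewrite mulr_ge0.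
    - by rewrite mulr_ge0.
    - exact: coord_measurable_scalar.
    - move=> p _; rewrite !enorm_scalar_sqr /G; set x := enorm _.
      rewrite -subr_ge0 (_ : _ - _ = K ^+ 2 * (g - x) ^+ 2); last by ring.
      by rewrite mulr_ge0// sqr_ge0.
  have hh : (msq lamP (dom s s') h <= (K * ((s' - s) * (g ^+ 2 + M)))%:E)%E.
    apply: le_trans (comb _ K0); apply: msq_lin => //.
    - exact: mdom.
    - by move=> p hp; rewrite enorm_scalar_sqr -mulrDr; exact: hK.
  rewrite muleDr ?ge0_adde_def ?inE ?msq_ge0//; last first.
    by apply: integral_ge0 => w _; rewrite lee_fin sqr_ge0.
  rewrite -addeA; apply: leeD2l.
  apply: (@le_trans _ _ (2%:E * (K * ((s' - s) * (g ^+ 2 + M)))%:E +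
     2%:E * ((s' - s)%:E * (2 * K ^+ 2 * ((s' - s) * (g ^+ 2 + M)))%:E))%E).
    apply: leeD; apply: lee_wpmul2l => //; apply: lee_wpmul2l => //.
    by rewrite lee_fin subr_ge0.
  rewrite -!EFinM -EFinD lee_fin; set x := _ * (g ^+ 2 + M) in gM *.
  have : (s' - s) * (K ^+ 2 * x) <= 1 * (K ^+ 2 * x) by rewrite ler_wpM2r// mulr_ge0.
  by lra.
have key : (msq P setT (D s') <= 2%:E * msq P setT (D s) + (K' * ((s' - s) * (g ^+ 2 + M)))%:E)%E.
  rewrite !msq_coord//; [|exact: mDs..].
  apply: (le_trans (lee_sum _ (fun i _ => one i))).
  rewrite big_split/= -ge0_sume_distrr; last first.
    by move=> i _; apply: integral_ge0 => w _; rewrite lee_fin sqr_ge0.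
  rewrite leeD2l// sumEFin lee_fin sumr_const card_ord -[leLHS]mulr_natl.
  by rewrite /K' -mulrA.
by move: key; rewrite !Dfin// -EFinM -EFinD lee_fin -mulrA.
Qed.

(** Squaring the drift bound produces at most [4 * K ^+ 2 * (s' - s)] times the energy of [h]. By
    the smallness condition this does not exceed the energy on the left of [ito_step_backward], and
    it cancels. *)
Lemma backward_step (s s' K M : R) (U V J : Om -> R) h (F : R * Om -> R) :
  0 <= s -> s <= s' -> s' <= T -> s' - s <= 1 -> 4 * K ^+ 2 * (s' - s) <= 1 -> 0 <= K ->
  ffun s U -> P.-integrable setT (fun w => (U w ^+ 2)%:E) ->
  measurable_fun setT V -> ito_increment s s' J h ->
  measurable_fun (dom s s') F -> (forall p, dom s s' p -> 0 <= F p) ->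
  (forall r, s < r <= s' -> (\int[P]_w (F (r, w) ^+ 2)%:E <= M%:E)%E) ->
  {ae P, forall w, (`|V w - U w - J w|%:E <=
     \int[lam]_(r in `]s, s']) (K * (F (r, w) + enorm (h (r, w))))%:E)%E} ->
  (\int[P]_w (U w ^+ 2)%:E <=
   2%:E * \int[P]_w (V w ^+ 2)%:E + (4 * K ^+ 2 * (s' - s) * M)%:E)%E.
Proof.
move=> s0 ss' s'T ss1 Kss K0 FU U2 mV ito mF F0 FM hA.
have [_ mh hfin _] := ito.
pose g (p : R * Om) := K * (F p + enorm (h p)).
have mg : measurable_fun (dom s s') g.
  by apply: measurable_funM => //; apply: measurable_funD => //; exact: measurable_enorm.
have g0 p : dom s s' p -> 0 <= g p.
  by move=> hp; rewrite mulr_ge0// addr_ge0 ?F0// enorm_ge0.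
have := ito_step_backward s0 ss' s'T FU U2 mV ito mg g0 hA.
have V0 : (0 <= \int[P]_w (V w ^+ 2)%:E)%E.
  by apply: integral_ge0 => w _; rewrite lee_fin sqr_ge0.
have qfin : msq lamP (dom s s') h \is a fin_num by rewrite ge0_fin_numE// msq_ge0.
have /integrableP[_ Ufin] := U2.
have {}Ufin : (\int[P]_w (U w ^+ 2)%:E)%E \is a fin_num.
  exact: integrable_fin_num.
have hg : (\int[lamP]_(p in dom s s') (g p ^+ 2)%:E <=
    (2 * K ^+ 2 * (M * (s' - s)))%:E + (2 * K ^+ 2)%:E * msq lamP (dom s s') h)%E.
  rewrite -msq_scalar; apply: (@le_trans _ _ ((2 * K ^+ 2)%:E * msq lamP (dom s s') (fun p => (F p)%:M : 'rV[R]_1)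
     + (2 * K ^+ 2)%:E * msq lamP (dom s s') h)%E).
    apply: msq_lin => //.
    - exact: mdom.
    - by rewrite mulr_ge0// sqr_ge0.
    - by rewrite mulr_ge0// sqr_ge0.
    - exact: coord_measurable_scalar.
    - exact: coord_measurable_scalar.
    - move=> p _; rewrite !enorm_scalar_sqr /g; set x := enorm _; set y := F p.
      rewrite -subr_ge0 (_ : _ - _ = K ^+ 2 * (y - x) ^+ 2); last by ring.
      by rewrite mulr_ge0// sqr_ge0.
  apply: leeD2r; rewrite (EFinM (2 * K ^+ 2) (M * (s' - s))); apply: lee_wpmul2l; first by rewrite lee_fin mulr_ge0// sqr_ge0.
  apply: msq_dom_bound => //; first exact: coord_measurable_scalar.
  by move=> r hr; rewrite msq_scalar; exact: FM.
have sq : (0 <= (s' - s)%:E :> \bar R)%E by rewrite lee_fin subr_ge0.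
have hg2 := lee_wpmul2l (lee_tofin (ler0n R 2)) (lee_wpmul2l sq hg).
move=> h1; have {h1 hg hg2} := le_trans h1 (leeD2l _ hg2).
have q0 : 0 <= fine (msq lamP (dom s s') h) by rewrite fine_ge0// msq_ge0.
(* Over an empty interval [FM] says nothing about the sign of [M], but then its coefficient is 0. *)
have M0 : 0 <= M \/ s = s'.
  move: ss'; rewrite le_eqVlt => /predU1P[|lt]; [by right|left].
  rewrite -lee_fin; apply: le_trans (FM s' _); last by rewrite lt lexx.
  by apply: integral_ge0 => w _; rewrite lee_fin sqr_ge0.
case: (\int[P]_w (V w ^+ 2)%:E)%E V0 => [v v0| _ _|//]; last first.
  by rewrite gt0_muley ?lte_fin// addye// leey.
rewrite -(fineK qfin) -(fineK Ufin); move: q0.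
set q := fine _; set u := fine _ => q0.
rewrite -!(EFinM, EFinD) !lee_fin => h1.
have h2 : 4 * K ^+ 2 * (s' - s) * q <= 1 * q by rewrite ler_wpM2r.
have h3 : 4 * K ^+ 2 * (s' - s) * M * (s' - s) <= 4 * K ^+ 2 * (s' - s) * M.
  case: M0 => [M0|->]; last by rewrite subrr !(mulr0, mul0r).
  apply: ler_piMr => //; apply: mulr_ge0 => //; apply: mulr_ge0; last by rewrite subr_ge0.
  by rewrite mulr_ge0// sqr_ge0.
by lra.
Qed.

(** The integrand [h] may vary with the step and no quantitative bound on it is assumed: each step
    absorbs its energy, so it is absent from the conclusion. *)
Lemma bsde_estimate (K : R) : 0 <= T -> 0 <= K -> exists2 C : R, 0 <= C &
  forall (a0 g : R) (D : R -> Om -> R) (G : R * Om -> R), 0 <= a0 <= T -> 0 <= g ->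
  (forall s, a0 <= s <= T -> ffun s (D s)) ->
  measurable_fun (cdom a0 T) (fun p => D p.1 p.2) ->
  (exists M : R, forall s, a0 <= s <= T -> (\int[P]_w (D s w ^+ 2)%:E <= M%:E)%E) ->
  measurable_fun (cdom a0 T) G -> (forall p, 0 <= G p) ->
  (forall s, a0 <= s <= T -> (\int[P]_w (G (s, w) ^+ 2)%:E <= g%:E)%E) ->
  (forall s s', a0 <= s <= s' -> s' <= T -> exists J h,
    ito_increment s s' J h /\
    {ae P, forall w, (`|D s' w - D s w - J w|%:E <=
        \int[lam]_(r in `]s, s']) (K * (G (r, w) + `|D r w| + enorm (h (r, w))))%:E)%E}) ->
  forall s, a0 <= s <= T ->
    (\int[P]_w (D s w ^+ 2)%:E <= (C * (fine (\int[P]_w (D T w ^+ 2)%:E) + g))%:E)%E.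
Proof.
move=> T0 K0; have K20 := sqr_ge0 K.
pose delta := Num.min 1 (4 * K ^+ 2 + 1)^-1.
have K41 : 0 < 4 * K ^+ 2 + 1 by lra.
have delta0 : 0 < delta by rewrite lt_min ltr01 invr_gt0.
(* The source [G + |D|] has second moment at most [2 * (g + M)], which doubles the [4 * K ^+ 2] of
   one step. *)
have K'0 : 0 <= 8 * K ^+ 2 by lra.
have [C C0 hC] := @gronwall_backward R T (8 * K ^+ 2) delta T0 K'0 delta0.
exists C => // a0 g D G aT g0 FD mD [M0 hM0] mG G0 Gg step.
pose phi s := fine (\int[P]_w (D s w ^+ 2)%:E)%E.
have D0 s : (0 <= \int[P]_w (D s w ^+ 2)%:E)%E.
  by apply: integral_ge0 => w _; rewrite lee_fin sqr_ge0.
have Dfin s : a0 <= s <= T -> (\int[P]_w (D s w ^+ 2)%:E)%E = (phi s)%:E.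
  by move=> hs; rewrite fineK// ge0_fin_numE//; exact: le_lt_trans (hM0 s hs) (ltry _).
suff: forall s, a0 <= s <= T -> phi s <= C * (phi T + g).
  by move=> h s hs; rewrite Dfin// lee_fin; exact: h.
apply: hC => //.
- by move=> s hs; rewrite -lee_fin -Dfin.
- by exists M0 => s hs; rewrite -lee_fin -Dfin// hM0.
move=> s s' M hs s'T ssd hM.
have ss' : s <= s' by case/andP: hs.
have s0 : 0 <= s by lra.
have hs1 : a0 <= s <= T by lra.
have hs2 : a0 <= s' <= T by lra.
have ss1 : s' - s <= 1 by apply: le_trans ssd _; rewrite ge_min lexx.
have Kss : 4 * K ^+ 2 * (s' - s) <= 1.
  apply: (@le_trans _ _ ((4 * K ^+ 2 + 1) * (4 * K ^+ 2 + 1)^-1)); last by rewrite divff ?gt_eqF.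
  apply: ler_pM; [by lra|by lra|by lra|].
  by apply: le_trans ssd _; rewrite ge_min lexx orbT.
have mDs r : a0 <= r <= T -> measurable_fun setT (D r).
  by move=> hr; apply: (filtration_fun_measurable P_complete B_brownian _ (FD r hr)); lra.
have sub : dom s s' `<=` cdom a0 T by apply: dom_sub_closed; lra.
have mDd : measurable_fun (dom s s') (fun p => D p.1 p.2) by exact: measurable_funS mD.
have mGd : measurable_fun (dom s s') G by exact: measurable_funS mG.
have iD2 : P.-integrable setT (fun w => (D s w ^+ 2)%:E).
  apply/integrableP; split; first by apply/measurable_EFinP; apply: measurable_funX; exact: mDs.
  under eq_integral do rewrite gee0_abs ?lee_fin ?sqr_ge0//.
  by rewrite Dfin// ltry.
have [J [h [ito hA]]] := step s s' hs s'T.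
pose F (p : R * Om) := G p + `|D p.1 p.2|.
have mF : measurable_fun (dom s s') F.
  by apply: measurable_funD => //; exact: measurableT_comp.
have F0 p : dom s s' p -> 0 <= F p by move=> _; rewrite addr_ge0.
have FM r : s < r <= s' -> (\int[P]_w (F (r, w) ^+ 2)%:E <= (2 * (g + M))%:E)%E.
  move=> hr; have hrT : a0 <= r <= T by lra.
  have mGr : measurable_fun setT (fun w => G (r, w)).
    by apply: (@space_section _ _ _ _ _ `[a0, T]%classic G r) => //; rewrite /= in_itv.
  have mDr : measurable_fun setT (fun w => `|D r w|) by apply: measurableT_comp => //; exact: mDs.
  apply: (le_trans (integral_sqrD _ mGr mDr)).
  under [X in (_ + _ * X <= _)%E]eq_integral do rewrite real_normK ?num_real//.
  apply: (@le_trans _ _ (2%:E * g%:E + 2%:E * M%:E)%E); last first.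
    by rewrite -!EFinM -EFinD lee_fin mulrDr.
  apply: leeD; apply: lee_wpmul2l => //; first exact: Gg.
  by rewrite Dfin// lee_fin; apply: hM; lra.
have := backward_step s0 ss' s'T ss1 Kss K0 (FD s hs1) iD2 (mDs s' hs2) ito mF F0 FM hA.
rewrite !Dfin// -EFinM -EFinD lee_fin => /le_trans; apply.
by rewrite lerD2l; apply: le_of_eq; ring.
Qed.

End ItoCalculus.

(* [integral] of a nonnegative function is a supremum over simple functions,
   hence monotone even without measurability of the larger function. *)
Lemma ge0_le_integral_nonmeasurable d (E : measurableType d) (R : realType)
    (m : {measure set E -> \bar R}) (f g : E -> \bar R) :
  (forall x, 0 <= f x)%E -> (forall x, f x <= g x)%E ->
  (\int[m]_x f x <= \int[m]_x g x)%E.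
Proof.
move=> f0 fg; have g0 x : (0 <= g x)%E := le_trans (f0 x) (fg x).
rewrite !ge0_integralTE//; apply: ereal_sup_le => _ [h hf <-].
by exists h => // x; exact: le_trans (hf x) (fg x).
Qed.

(** * Real-valued integrals and expectations *)

Section RealIntegrals.
Context (R : realType) d (Om : measurableType d) (P : probability Om R).
Notation lam := (@lebesgue_measure R).

Lemma in_S2_bound (dB : nat) (B : R -> Om -> 'rV[R]_dB) (T : R) (V : topologicalType)
    (N : V -> R) t psi : in_S2 P T B N t psi ->
  exists M : R, forall s, t <= s <= T -> (\int[P]_w (N (psi s w) ^+ 2)%:E <= M%:E)%E.
Proof.
move=> [_ _ fin].
set S := (\int[P]_w _)%E in fin; exists (fine S) => s hs.
have S0 : (0 <= S)%E.
  apply: integral_ge0 => w _; apply: ereal_sup_ge => /=.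
  by exists (N (psi s w) ^+ 2)%:E; [exists s => //=; rewrite in_itv|rewrite lee_fin sqr_ge0].
rewrite fineK ?ge0_fin_numE//.
apply: ge0_le_integral_nonmeasurable => w; first by rewrite lee_fin sqr_ge0.
by apply: ereal_sup_ubound; exists s => //=; rewrite in_itv.
Qed.

(** Tonelli applies to the positive and negative parts separately, and [fine] is measurable on all
    extended reals, so infinite expectations do no harm. *)
Lemma measurable_Rintegral_space (A : set R) (F : R * Om -> R) : measurable A ->
  measurable_fun (A `*` setT) F -> measurable_fun A (fun r => \int[P]_w F (r, w)).
Proof.
move=> mA mF.
have mD : measurable (A `*` setT : set (R * Om)) by exact: measurableX.
have ge0 (f : R * Om -> \bar R) : measurable_fun (A `*` setT) f -> (forall p, 0 <= f p)%E ->
    measurable_fun A (fun r => \int[P]_w f (r, w))%E.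
  move=> mf f0; pose g := f \_ (A `*` setT).
  have mg : measurable_fun setT g by exact/(measurable_restrictT _ mD).
  have g0 p : (0 <= g p)%E by rewrite /g patchE; case: ifP.
  apply: (@eq_measurable_fun _ _ _ _ _ (fubini_F P g)).
    move=> r; rewrite inE => Ar; apply: eq_integral => w _.
    by rewrite /g patchE mem_set.
  by apply: measurable_funTS; exact: measurable_fun_fubini_tonelli_F.
apply: (@measurableT_comp _ _ _ _ _ _ fine); first exact: fine_measurable.
rewrite (_ : (fun _ => _) = (fun r => \int[P]_w ((EFin \o F)^\+ (r, w)) - \int[P]_w ((EFin \o F)^\- (r, w)))%E).
  have mEF : measurable_fun (A `*` setT) (EFin \o F) by exact/measurable_EFinP.
  apply: emeasurable_funB; apply: ge0 => //.
  - exact: measurable_funepos.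
  - exact: measurable_funeneg.
apply/funext => r; rewrite /= [LHS]integralE; congr (_ - _)%E.
  by apply: eq_integral => w _; rewrite !funeposE.
by apply: eq_integral => w _; rewrite !funenegE.
Qed.

Lemma Rintegral_le_cst (F : Om -> R) (K : R) : P.-integrable setT (EFin \o F) ->
  (forall w, `|F w| <= K) -> `|\int[P]_w F w| <= K.
Proof.
move=> iF FK.
apply: (le_trans (le_normr_Rintegral measurableT iF)).
apply: (@le_trans _ _ (\int[P]_w (cst K w))).
  apply: le_Rintegral => //; first exact: integrable_norm.
  exact: finite_measure_integrable_cst.
rewrite Rintegral_cst// [X in fine X](_ : _ = 1%E) ?mulr1//.
exact: probability_setT.
Qed.

Lemma Rintegral_dist (F G : Om -> R) (K : R) : P.-integrable setT (EFin \o F) ->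
  P.-integrable setT (EFin \o G) -> (forall w, `|F w - G w| <= K) ->
  `|\int[P]_w F w - \int[P]_w G w| <= K.
Proof.
move=> iF iG FGK; rewrite -RintegralB//; apply: Rintegral_le_cst => //.
exact: (integrableB measurableT iF iG).
Qed.

Lemma expectation_Rintegral (F : Om -> R) : fine 'E_P[F] = \int[P]_w F w.
Proof. by rewrite unlock. Qed.

(** The right-hand side is an extended real, so the majorant may have infinite integral. *)
Lemma abs_Rintegral_le (A : set R) (u g : R -> R) : measurable A ->
  lam.-integrable A (EFin \o u) -> measurable_fun A g -> (forall r, A r -> `|u r| <= g r) ->
  (`|\int[lam]_(r in A) u r|%:E <= \int[lam]_(r in A) (g r)%:E)%E.
Proof.
move=> mA iu mg ug.
rewrite EFin_normr_Rintegral//.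
have /integrableP[mu' _] := iu.
apply: le_trans (le_abse_integral _ _ _) _ => //.
apply: ge0_le_integral => //.
- exact: measurableT_comp.
- exact/measurable_EFinP.
Qed.

End RealIntegrals.

(** * Integrability along paths and splitting of integrals *)

Section Paths.
Context (R : realType) (dO : measure_display) (Om : measurableType dO)
  (P : probability Om R) (T : R) (d : nat) (B : R -> Om -> 'rV[R]_d).
Hypotheses (P_complete : measure_is_complete P) (B_brownian : brownian_motion P T B).
Notation lam := (@lebesgue_measure R).
Notation cdom s s' := (`[s, s'] `*` setT : set (R * Om)).

(** A finite mean forces finiteness on almost every path. Pathwise integrability is what allows an
    equation written at two times to be subtracted. *)
Lemma ae_sqr_integrable n (t : R) (h : R * Om -> 'rV[R]_n) : coord_measurable (cdom t T) h ->
  (\int[P]_w \int[lam]_(r in `[t, T]) (enorm (h (r, w)) ^+ 2)%:E < +oo)%E ->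
  {ae P, forall w, lam.-integrable `[t, T] (fun r => (enorm (h (r, w)) ^+ 2)%:E)}.
Proof.
move=> mh hfin.
have mf : measurable_fun (cdom t T) (fun p => (enorm (h p) ^+ 2)%:E) by exact: measurable_sqr.
have mI : measurable_fun setT (fun w => \int[lam]_(r in `[t, T]) (enorm (h (r, w)) ^+ 2)%:E)%E.
  apply: (@measurable_integral_time _ _ _ _ _ (fun p => (enorm (h p) ^+ 2)%:E)) => //.
  by move=> p _; rewrite lee_fin sqr_ge0.
have I0 w : (0 <= \int[lam]_(r in `[t, T]) (enorm (h (r, w)) ^+ 2)%:E)%E.
  by apply: integral_ge0 => r _; rewrite lee_fin sqr_ge0.
have iI : P.-integrable setT (fun w => \int[lam]_(r in `[t, T]) (enorm (h (r, w)) ^+ 2)%:E)%E.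
  by apply/integrableP; split => //; under eq_integral do rewrite gee0_abs//.
apply: filterS (integrable_ae measurableT iI) => w /(_ Logic.I) fw.
apply/integrableP; split.
  by apply: (time_section w _ mf); exact: measurable_itv.
under eq_integral do rewrite gee0_abs ?lee_fin ?sqr_ge0//.
by rewrite -ge0_fin_numE.
Qed.

Lemma integrable_linear_growth (t K : R) (u N : R -> R) : t <= T -> 0 <= K ->
  measurable_fun `[t, T] u -> measurable_fun `[t, T] N ->
  (forall r, t <= r <= T -> 0 <= N r) ->
  (forall r, t <= r <= T -> `|u r| <= K * (1 + N r)) ->
  lam.-integrable `[t, T] (fun r => (N r ^+ 2)%:E) -> lam.-integrable `[t, T] (EFin \o u).
Proof.
move=> tT K0 mu mN N0 uN iN.
have mI : measurable (`[t, T]%classic : set (measurableTypeR R)) by exact: measurable_itv.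
have i2 : lam.-integrable `[t, T] (EFin \o cst (2 : R)).
  apply/integrableP; split; first by apply/measurable_EFinP.
  under eq_integral do rewrite /= ger0_norm//.
  have lI : (lebesgue_measure (`[t, T]%classic : set R) < +oo)%E.
    by rewrite lebesgue_measure_itv/= lte_fin; case: ifP => _; rewrite ?ltry// -EFinB ltry.
  by rewrite integral_cst//; apply: lte_mul_pinfty.
apply: (le_integrable mI) (integrableZl mI K (integrableD mI i2 iN)).
  exact/measurable_EFinP.
move=> r; rewrite /= in_itv/= => hr; rewrite lee_fin.
have n0 := N0 r hr; have s0 := sqr_ge0 (N r).
rewrite [leRHS]ger0_norm; last by rewrite mulr_ge0// addr_ge0.
apply: (le_trans (uN r hr)); apply: ler_wpM2l => //.
by have := sqr_ge0 (N r - 1); nra.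
Qed.

Lemma Rintegral_split (t s s' : R) (u : R -> R) : t <= s -> s <= s' -> s' <= T ->
  lam.-integrable `[t, T] (EFin \o u) ->
  \int[lam]_(r in `[t, s']) u r = \int[lam]_(r in `[t, s]) u r + \int[lam]_(r in `]s, s']) u r.
Proof.
move=> ts ss' s'T iu.
have i' : lam.-integrable `[t, s'] (EFin \o u).
  apply: integrableS iu => //.
  by move=> r; rewrite /= !in_itv/= => /andP[-> h]; exact: le_trans s'T.
by rewrite -(Rintegral_itvB i')// ?bnd_simp// addrC subrK.
Qed.

Lemma Rintegral_split_backward (t s s' : R) (u : R -> R) : t <= s -> s <= s' -> s' <= T ->
  lam.-integrable `[t, T] (EFin \o u) ->
  \int[lam]_(r in `[s, T]) u r = \int[lam]_(r in `]s, s']) u r + \int[lam]_(r in `[s', T]) u r.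
Proof.
move=> ts ss' s'T iu.
have sub v : t <= v -> `[v, T]%classic `<=` (`[t, T]%classic : set R).
  by move=> tv r; rewrite /= !in_itv/= => /andP[h ->]; rewrite (le_trans tv h).
have is_ : lam.-integrable `[s, T] (EFin \o u) by apply: integrableS iu => //; exact: sub.
have h := Rintegral_itvB is_ (x := s').
have -> : \int[lam]_(r in `]s, s']) u r = \int[lam]_(r in `[s, s']) u r.
  apply: Rintegral_itv_obnd_cbnd; apply: integrableS iu => //.
  by move=> r; rewrite /= !in_itv/= => /andP[h1 h2]; apply/andP; split; lra.
have -> : \int[lam]_(r in `[s', T]) u r = \int[lam]_(r in `]s', T]) u r.
  apply/esym/Rintegral_itv_obnd_cbnd; apply: integrableS iu => //.
  by move=> r; rewrite /= !in_itv/= => /andP[h1 h2]; apply/andP; split; lra.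
by rewrite -h ?bnd_simp// addrC subrK.
Qed.

(** The initial value of an Ito integral is recovered from its definition in mean square: the
    approximating simple integrals all vanish at [t]. *)
Lemma ito_integral_start (t : R) H I : 0 <= t <= T -> ito_integral P T B t H I ->
  (\int[P]_w (I t w ^+ 2)%:E = 0)%E.
Proof.
move=> tT [_ _ _ [S [simS _ SI]]].
have tt : t <= t <= T by move/andP: tT => [_ ->]; rewrite lexx.
have c := SI t tt.
have e k : (\int[P]_w ((simple_integral B (S k) t w - I t w) ^+ 2)%:E = \int[P]_w (I t w ^+ 2)%:E)%E.
  apply: eq_integral => w _; rewrite (_ : simple_integral B (S k) t w = 0) ?sub0r ?sqrrN//.
  have [tS ndS _ _] := simS k.
  rewrite /simple_integral big1// => p _; rewrite big1// => j _.
  have /andP[h1 _] := tS p (ltnW (ltn_ord p)); have h2 := ndS p (ltn_ord p).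
  by rewrite !min_l ?subrr ?mulr0//; exact: le_trans h2.
rewrite (funext e) in c.
by apply: (cvg_unique (@ereal_hausdorff R) _ c); exact: cvg_cst.
Qed.

End Paths.

Lemma fine_le_fin (R : realType) (x : \bar R) (M : R) : (0 <= x)%E -> (x <= M%:E)%E -> fine x <= M.
Proof. by case: x. Qed.

Section SquareComparison.
Context d (E : measurableType d) (R : realType) (m : {measure set E -> \bar R}).

Lemma integral_sqr_ae_le (U V : E -> R) (c M : R) : 0 <= c ->
  measurable_fun setT U -> measurable_fun setT V -> (forall e, 0 <= V e) ->
  {ae m, forall e, `|U e| <= c * V e} ->
  (\int[m]_e (V e ^+ 2)%:E <= M%:E)%E -> (\int[m]_e (U e ^+ 2)%:E <= (c ^+ 2 * M)%:E)%E.
Proof.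
move=> c0 mU mV V0 UV VM.
have c20 : (0 <= (c ^+ 2)%:E)%E by rewrite lee_fin sqr_ge0.
have mV2 : measurable_fun setT (fun e => (V e ^+ 2)%:E).
  by apply/measurable_EFinP; exact: measurable_funX.
apply: (@le_trans _ _ ((c ^+ 2)%:E * \int[m]_e (V e ^+ 2)%:E)%E); last first.
  by rewrite [leRHS]EFinM; exact: lee_wpmul2l.
rewrite -ge0_integralZl//; last by move=> e _; rewrite lee_fin sqr_ge0.
apply: ae_ge0_le_integral => //.
- by move=> e _; rewrite lee_fin sqr_ge0.
- by apply/measurable_EFinP; exact: measurable_funX.
- by move=> e _; rewrite mule_ge0// lee_fin sqr_ge0.
- exact: measurable_funeM.
- apply: filterS UV => e h _; rewrite -EFinM lee_fin -exprMn -[leLHS]real_normK ?num_real//.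
  by rewrite ler_sqr ?nnegrE ?mulr_ge0.
Qed.

End SquareComparison.

(** * The mean-field equations *)

Section MeanField.
Context (R : realType) (dO : measure_display) (Om : measurableType dO)
  (P : probability Om R) (n d : nat) (T : R) (B : R -> Om -> 'rV[R]_d)
  (b : R -> 'rV[R]_n -> 'rV[R]_n -> 'rV[R]_n)
  (sigma : R -> 'rV[R]_n -> 'rV[R]_n -> 'M[R]_(n, d))
  (Phi : 'rV[R]_n -> 'rV[R]_n -> R)
  (f : R -> 'rV[R]_n -> 'rV[R]_n -> R -> R -> 'rV[R]_d -> R) (C : R)
  (X0 : R -> Om -> 'rV[R]_n) (Y0 : R -> Om -> R).
Hypotheses (P_complete : measure_is_complete P) (B_brownian : brownian_motion P T B)
  (T_gt0 : 0 < T) (C_gt0 : 0 < C) (coeff : coefficient_assumptions T b sigma Phi f C)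
  (X0_S2 : in_S2 P T B (@enorm R 1 n) 0 X0) (Y0_S2 : in_S2 P T B (fun y : R => `|y|) 0 Y0).
Notation lam := (@lebesgue_measure R).
Notation bt := (b_tilde b P X0).
Notation st := (sigma_tilde sigma P X0).
Notation Pt := (Phi_tilde T Phi P X0).
Notation ft := (f_tilde f P X0 Y0).
Notation cdom s s' := (`[s, s'] `*` setT : set (R * Om)).
Notation dom s s' := (`]s, s'] `*` setT : set (R * Om)).
Notation ffun := (filtration_fun P B).

Let C0 : 0 <= C. Proof. exact: ltW. Qed.
Let T0 : 0 <= T. Proof. exact: ltW. Qed.

(** * Bounds on the coefficients and their averages *)

Lemma b_lip s x1' x1 x2' x2 i : 0 <= s <= T ->
  `|b s x1' x1 0 i - b s x2' x2 0 i| <= C * (enorm (x1' - x2') + enorm (x1 - x2)).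
Proof.
move=> hs; apply: le_trans (b_sigma_lipschitz coeff _ _ _ _ hs).
rewrite -[leLHS]addr0; apply: lerD; last exact: enorm_ge0.
by have := coord_le_enorm (b s x1' x1 - b s x2' x2) 0 i; rewrite !mxE.
Qed.

Lemma sigma_lip s x1' x1 x2' x2 i j : 0 <= s <= T ->
  `|sigma s x1' x1 i j - sigma s x2' x2 i j| <= C * (enorm (x1' - x2') + enorm (x1 - x2)).
Proof.
move=> hs; apply: le_trans (b_sigma_lipschitz coeff _ _ _ _ hs).
rewrite -[leLHS]add0r; apply: lerD; first exact: enorm_ge0.
by have := coord_le_enorm (sigma s x1' x1 - sigma s x2' x2) i j; rewrite !mxE.
Qed.

Lemma b_growth s x' x i : 0 <= s <= T -> `|b s x' x 0 i| <= C * (1 + enorm x).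
Proof.
move=> hs; apply: le_trans (b_sigma_growth coeff _ _ hs).
by rewrite -[leLHS]addr0; apply: lerD; [exact: coord_le_enorm|exact: enorm_ge0].
Qed.

Lemma sigma_growth s x' x i j : 0 <= s <= T -> `|sigma s x' x i j| <= C * (1 + enorm x).
Proof.
move=> hs; apply: le_trans (b_sigma_growth coeff _ _ hs).
by rewrite -[leLHS]add0r; apply: lerD; [exact: enorm_ge0|exact: coord_le_enorm].
Qed.

Lemma f_lip s x1' x1 y1' y1 z1 x2' x2 y2' y2 z2 : 0 <= s <= T ->
  `|f s x1' x1 y1' y1 z1 - f s x2' x2 y2' y2 z2| <=
  C * (enorm (x1' - x2') + enorm (x1 - x2) + `|y1' - y2'| + `|y1 - y2| + enorm (z1 - z2)).
Proof.
move=> hs; apply: le_trans (f_Phi_lipschitz coeff x1' x1 y1' y1 z1 x2' x2 y2' y2 z2 hs).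
by rewrite lerDl.
Qed.

Lemma Phi_lip x1' x1 x2' x2 : `|Phi x1' x1 - Phi x2' x2| <= C * (enorm (x1' - x2') + enorm (x1 - x2)).
Proof.
have h0 : 0 <= (0 : R) <= T by rewrite lexx.
have := f_Phi_lipschitz coeff x1' x1 0 0 0 x2' x2 0 0 0 h0.
rewrite !subrr normr0 enorm0 !addr0; apply: le_trans.
by rewrite lerDr.
Qed.

Lemma f_growth s x' x y' y z : 0 <= s <= T ->
  `|f s x' x y' y z| <= C * (1 + enorm x + enorm x' + `|y'| + `|y| + enorm z).
Proof.
move=> hs; have h1 := f_Phi_growth coeff x' x hs.
have := f_lip x' x y' y z x' x 0 0 0 hs.
rewrite !subrr !enorm0 !subr0 !add0r => h2.
have h3 : `|f s x' x 0 0 0| <= C * (1 + enorm x + enorm x').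
  by apply: le_trans h1; rewrite lerDl.
rewrite -[f s x' x y' y z](subrK (f s x' x 0 0 0)).
apply: (le_trans (ler_normD _ _)); apply: (le_trans (lerD h2 h3)).
by apply: le_of_eq; ring.
Qed.

Lemma X0_measurable s : 0 <= s <= T -> coord_measurable setT (X0 s).
Proof.
move=> hs i; have [aX _ _] := X0_S2.
have FX : filtration_fun P B s (fun w => X0 s w 0 i).
  apply: (@adapted_measurable R dO Om P T d B _ 0 X0 (fun v => v 0 i) s) => //.
  exact: coord_continuous.
by apply: (filtration_fun_measurable P_complete B_brownian _ FX); case/andP: hs.
Qed.

Lemma Y0_measurable s : 0 <= s <= T -> measurable_fun setT (Y0 s).
Proof.
move=> hs; have [aY _ _] := Y0_S2.
have FY : filtration_fun P B s (Y0 s).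
  by apply: (@adapted_measurable R dO Om P T d B _ 0 Y0 idfun s) => // x; exact: cvg_id.
by apply: (filtration_fun_measurable P_complete B_brownian _ FY); case/andP: hs.
Qed.

Lemma moment_le (F : Om -> R) (M : R) : measurable_fun setT F ->
  (\int[P]_w (F w ^+ 2)%:E <= M%:E)%E ->
  P.-integrable setT (EFin \o F) /\ \int[P]_w `|F w| <= 1 + M.
Proof.
move=> mF FM.
have iF2 : P.-integrable setT (EFin \o (fun w => F w ^+ 2)).
  apply/integrableP; split; first by apply/measurable_EFinP; exact: measurable_funX.
  under eq_integral do rewrite /= ger0_norm ?sqr_ge0//.
  exact: le_lt_trans FM (ltry _).
have iF := integrable_of_sqr mF iF2.
split => //.
have i1 : P.-integrable setT (EFin \o cst (1 : R)) by exact: finite_measure_integrable_cst.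
apply: (@le_trans _ _ (\int[P]_w (1 + F w ^+ 2))).
  apply: le_Rintegral => //; first exact: integrable_norm.
    exact: (integrableD measurableT i1 iF2).
  move=> w _; rewrite -[F w ^+ 2]real_normK ?num_real//.
  by rewrite -subr_ge0; have := sqr_ge0 (`|F w| - 1); have := normr_ge0 (F w); nra.
rewrite (RintegralD measurableT i1 iF2) Rintegral_cst//.
rewrite [X in fine X](_ : _ = 1%E); last exact: probability_setT.
rewrite mulr1 lerD2l -lee_fin fineK//; exact: integrable_fin_num.
Qed.

(** First moments follow from the second moments of [in_S2] by [|y| <= 1 + y^2]. One constant serves
    all times, since it enters the growth bound of the averaged driver. *)
Lemma base_moments : exists2 m : R, 0 <= m & forall s, 0 <= s <= T ->
  [/\ P.-integrable setT (EFin \o (fun w => enorm (X0 s w))),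
      P.-integrable setT (EFin \o Y0 s),
      \int[P]_w enorm (X0 s w) <= m & \int[P]_w `|Y0 s w| <= m].
Proof.
have [M hM] := in_S2_bound X0_S2; have [M' hM'] := in_S2_bound Y0_S2.
exists (Num.max 0 (Num.max (1 + M) (1 + M'))); first by rewrite le_max lexx.
move=> s hs.
have [iX XM] := moment_le (measurable_enorm (X0_measurable hs)) (hM s hs).
have hY : (\int[P]_w (Y0 s w ^+ 2)%:E <= M'%:E)%E.
  by apply: le_trans (hM' s hs); under [leRHS]eq_integral do rewrite real_normK ?num_real//.
have [iY YM] := moment_le (Y0_measurable hs) hY.
split => //.
- rewrite !le_max; apply/orP; right; apply/orP; left; apply: le_trans XM.
  by under [leRHS]eq_Rintegral do rewrite ger0_norm ?enorm_ge0//.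
- by rewrite !le_max YM !orbT.
Qed.

(** The growth bound on [b] does not involve the averaged variable, so the integrand is bounded; the
    Lipschitz dependence on that variable gives measurability. *)
Lemma b_integrable s x i : 0 <= s <= T -> P.-integrable setT (EFin \o (fun w => b s (X0 s w) x 0 i)).
Proof.
move=> hs; apply: (@integrable_bounded _ _ _ _ _ (C * (1 + enorm x))).
  apply: (@measurable_plug _ _ _ n setT (X0 s) (fun v w => b s v x 0 i) C).
  - exact: X0_measurable.
  - by move=> v; exact: measurable_cst.
  - by move=> w v v' _; have := b_lip v x v' x i hs; rewrite subrr enorm0 addr0.
by move=> w; exact: b_growth.
Qed.

Lemma sigma_integrable s x i j : 0 <= s <= T ->
  P.-integrable setT (EFin \o (fun w => sigma s (X0 s w) x i j)).
Proof.
move=> hs; apply: (@integrable_bounded _ _ _ _ _ (C * (1 + enorm x))).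
  apply: (@measurable_plug _ _ _ n setT (X0 s) (fun v w => sigma s v x i j) C).
  - exact: X0_measurable.
  - by move=> v; exact: measurable_cst.
  - by move=> w v v' _; have := sigma_lip v x v' x i j hs; rewrite subrr enorm0 addr0.
by move=> w; exact: sigma_growth.
Qed.

Lemma b_tildeE s x i : bt s x 0 i = \int[P]_w b s (X0 s w) x 0 i.
Proof. by rewrite mxE expectation_Rintegral. Qed.

(** Averaging preserves the Lipschitz constant, the averaged variable being the same on both
    sides. *)
Lemma b_tilde_lip s x x' i : 0 <= s <= T -> `|bt s x 0 i - bt s x' 0 i| <= C * enorm (x - x').
Proof.
move=> hs; rewrite !b_tildeE; apply: Rintegral_dist; [exact: b_integrable..|].
by move=> w; have := b_lip (X0 s w) x (X0 s w) x' i hs; rewrite subrr enorm0 add0r.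
Qed.

Lemma b_tilde_growth s x i : 0 <= s <= T -> `|bt s x 0 i| <= C * (1 + enorm x).
Proof.
move=> hs; rewrite b_tildeE; apply: Rintegral_le_cst; first exact: b_integrable.
by move=> w; exact: b_growth.
Qed.

Lemma sigma_tilde_lip s x x' i : 0 <= s <= T ->
  enorm (row i (st s x) - row i (st s x')) ^+ 2 <= d%:R * (C * enorm (x - x')) ^+ 2.
Proof.
move=> hs; rewrite -[in leRHS](mul1n d); apply: enorm_le_coord.
  by rewrite mulr_ge0 ?enorm_ge0.
move=> i' j; rewrite !mxE !expectation_Rintegral.
apply: Rintegral_dist; [exact: sigma_integrable..|].
by move=> w; have := sigma_lip (X0 s w) x (X0 s w) x' i j hs; rewrite subrr enorm0 add0r.
Qed.

Lemma sigma_tilde_growth s x i : 0 <= s <= T ->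
  enorm (row i (st s x)) ^+ 2 <= d%:R * (C * (1 + enorm x)) ^+ 2.
Proof.
move=> hs; rewrite -[in leRHS](mul1n d); apply: enorm_le_coord.
  by rewrite mulr_ge0 ?addr_ge0 ?enorm_ge0.
move=> i' j; rewrite !mxE expectation_Rintegral.
apply: Rintegral_le_cst; first exact: sigma_integrable.
by move=> w; exact: sigma_growth.
Qed.

(** * The averaged terminal value and driver *)

Section AveragedDriver.
Let mX0 := X0_measurable.
Let mY0 := Y0_measurable.
Let moments := base_moments.

Lemma Phi_integrable x : P.-integrable setT (EFin \o (fun w => Phi (X0 T w) x)).
Proof.
have hT : 0 <= T <= T by rewrite lexx T0.
have [m m0 hm] := moments; have [iX _ _ _] := hm T hT.
have mP : measurable_fun setT (fun w => Phi (X0 T w) x).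
  apply: (@measurable_plug _ _ _ n setT (X0 T) (fun v w => Phi v x) C).
  - exact: mX0.
  - by move=> v; exact: measurable_cst.
  - by move=> w v v' _; have := Phi_lip v x v' x; rewrite subrr enorm0 addr0.
have i1 : P.-integrable setT (EFin \o cst (1 + enorm x : R)) by exact: finite_measure_integrable_cst.
apply: (@le_integrable _ _ _ _ _ measurableT _ (fun w => C%:E * ((1 + enorm x)%:E + (enorm (X0 T w))%:E))%E).
- exact/measurable_EFinP.
- move=> w _; rewrite -EFinD -EFinM /= lee_fin [leRHS]ger0_norm; last first.
    by rewrite mulr_ge0// !addr_ge0// enorm_ge0.
  apply: le_trans (f_Phi_growth coeff (X0 T w) x hT).
  by rewrite lerDr.
- exact: (integrableZl measurableT C (integrableD measurableT i1 iX)).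
Qed.

Lemma Phi_tilde_lip x x' : `|Pt x - Pt x'| <= C * enorm (x - x').
Proof.
rewrite /Phi_tilde !expectation_Rintegral; apply: Rintegral_dist; [exact: Phi_integrable..|].
by move=> w; have := Phi_lip (X0 T w) x (X0 T w) x'; rewrite subrr enorm0 add0r.
Qed.

Lemma f_measurable_space s x y z : 0 <= s <= T ->
  measurable_fun setT (fun w => f s (X0 s w) x (Y0 s w) y z).
Proof.
move=> hs.
apply: (@measurable_plug_real _ _ _ setT (Y0 s) (fun v w => f s (X0 s w) x v y z) C).
- exact: mY0.
- move=> v; apply: (@measurable_plug _ _ _ n setT (X0 s) (fun u w => f s u x v y z) C).
  + exact: mX0.
  + by move=> u; exact: measurable_cst.
  + move=> w u u' _; have := f_lip u x v y z u' x v y z hs.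
    by rewrite !subrr !enorm0 normr0 !addr0.
- move=> w v v' _; have := f_lip (X0 s w) x v y z (X0 s w) x v' y z hs.
  by rewrite !subrr !enorm0 normr0 !addr0 !add0r.
Qed.

Lemma f_integrable s x y z : 0 <= s <= T ->
  P.-integrable setT (EFin \o (fun w => f s (X0 s w) x (Y0 s w) y z)).
Proof.
move=> hs; have [m m0 hm] := moments; have [iX iY _ _] := hm s hs.
have i1 : P.-integrable setT (EFin \o cst (1 + enorm x + `|y| + enorm z : R)).
  exact: finite_measure_integrable_cst.
have iY' := integrable_norm iY.
apply: (@le_integrable _ _ _ _ _ measurableT _ (fun w => C%:E * ((1 + enorm x + `|y| + enorm z)%:E +
    ((enorm (X0 s w))%:E + `|Y0 s w|%:E)))%E).
- by apply/measurable_EFinP; exact: f_measurable_space.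
- move=> w _; rewrite -!EFinD -EFinM /= lee_fin [leRHS]ger0_norm; last first.
    by rewrite mulr_ge0// !addr_ge0// enorm_ge0.
  apply: (le_trans (f_growth _ _ _ _ _ hs)).
  by apply: le_of_eq; ring.
- exact: (integrableZl measurableT C (integrableD measurableT i1 (integrableD measurableT iX iY'))).
Qed.

Lemma f_tildeE s x y z : ft s x y z = \int[P]_w f s (X0 s w) x (Y0 s w) y z.
Proof. by rewrite /f_tilde expectation_Rintegral. Qed.

Lemma f_tilde_lip s x y z x' y' z' : 0 <= s <= T ->
  `|ft s x y z - ft s x' y' z'| <= C * (enorm (x - x') + `|y - y'| + enorm (z - z')).
Proof.
move=> hs; rewrite !f_tildeE; apply: Rintegral_dist; [exact: f_integrable..|].
move=> w; have := f_lip (X0 s w) x (Y0 s w) y z (X0 s w) x' (Y0 s w) y' z' hs.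
by rewrite !subrr enorm0 normr0 add0r addr0.
Qed.

(** Averaging adds the first moments of [X0] and [Y0], at most [m + m]; as the remaining bracket [c]
    is at least 1, they are absorbed in the factor [1 + m + m]. *)
Lemma f_tilde_growth : exists2 K : R, 0 <= K & forall s x y z, 0 <= s <= T ->
  `|ft s x y z| <= K * (1 + enorm x + `|y| + enorm z).
Proof.
have [m m0 hm] := moments; exists (C * (1 + m + m)); first by rewrite mulr_ge0// !addr_ge0.
move=> s x y z hs.
have [iX iY Xm Ym] := hm s hs.
have iY' := integrable_norm iY.
pose c := 1 + enorm x + `|y| + enorm z.
have c1 : 1 <= c.
  by rewrite /c -!addrA lerDl !addr_ge0// enorm_ge0.
have i1 : P.-integrable setT (EFin \o cst c) by exact: finite_measure_integrable_cst.
have iXY : P.-integrable setT (EFin \o (fun w => enorm (X0 s w) + `|Y0 s w|)).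
  exact: (integrableD measurableT iX iY').
have iS : P.-integrable setT (EFin \o (fun w => c + (enorm (X0 s w) + `|Y0 s w|))).
  exact: (integrableD measurableT i1 iXY).
rewrite f_tildeE; have iF := f_integrable x y z hs.
apply: (le_trans (le_normr_Rintegral measurableT iF)).
apply: (@le_trans _ _ (\int[P]_w (C * (c + (enorm (X0 s w) + `|Y0 s w|))))).
  apply: le_Rintegral => //.
  - exact: integrable_norm.
  - exact: (integrableZl measurableT C iS).
  - move=> w _; apply: (le_trans (f_growth _ _ _ _ _ hs)).
    by apply: le_of_eq; rewrite /c; ring.
rewrite RintegralZl// -mulrA ler_wpM2l//.
rewrite (RintegralD measurableT i1 iXY) (RintegralD measurableT iX iY') Rintegral_cst//.
rewrite [X in fine X](_ : _ = 1%E); last exact: probability_setT.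
rewrite mulr1; apply: (@le_trans _ _ (c + (m + m))); first by rewrite lerD2l lerD.
rewrite (_ : (1 + m + m) * _ = c + (m * c + m * c)); last by rewrite /c; ring.
by rewrite lerD2l; apply: lerD; rewrite ler_peMr.
Qed.

(** * Measurability of averaged coefficients along paths *)

Section PathMeasurability.
Context (t : R).
Hypothesis t0 : 0 <= t.
Notation cdom := (`[t, T] `*` setT : set (R * Om)).

Let mI : measurable (`[t, T]%classic : set R). Proof. exact: measurable_itv. Qed.

Let in0T r : `[t, T]%classic r -> 0 <= r <= T.
Proof. by rewrite /= in_itv/= => /andP[tr ->]; rewrite (le_trans t0 tr). Qed.

Let measurable_time (h : R -> R) : {within `[0, T], continuous h} ->
  measurable_fun cdom (fun p => h p.1).
Proof.
move=> ch; have mh : measurable_fun `[0, T] h by exact: subspace_continuous_measurable_fun.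
apply: (measurable_comp (F := `[0, T]%classic)) mh _ => //.
- by move=> _ [[r w] [/in0T hr _] <-]; rewrite /= in_itv.
- by apply: measurable_funTS; exact: measurable_fst.
Qed.

Let time_coord m (xs : R -> 'rV[R]_m) : coord_measurable `[t, T] xs ->
  coord_measurable cdom (fun p => xs p.1).
Proof.
move=> mxs i; apply: (measurable_comp (F := `[t, T]%classic)) (mxs i) _ => //.
- by move=> _ [[r w] [hr _] <-].
- by apply: measurable_funTS; exact: measurable_fst.
Qed.

Let time_real (ys : R -> R) : measurable_fun `[t, T] ys -> measurable_fun cdom (fun p => ys p.1).
Proof.
move=> mys; apply: (measurable_comp (F := `[t, T]%classic)) mys _ => //.
- by move=> _ [[r w] [hr _] <-].
- by apply: measurable_funTS; exact: measurable_fst.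
Qed.

Let jX0 : coord_measurable cdom (fun p => X0 p.1 p.2).
Proof.
have [aX cX _] := X0_S2.
apply: coord_measurableS (cadlag_joint_measurable P_complete B_brownian T0 aX cX).
  by apply: measurableX => //; exact: measurable_itv.
by move=> [r w] [/in0T hr _]; split => //; rewrite /= in_itv.
Qed.

Let jY0 : measurable_fun cdom (fun p => Y0 p.1 p.2).
Proof.
have [aY cY _] := Y0_S2.
apply: measurable_funS (cadlag_joint_measurable_real P_complete B_brownian T0 aY cY).
  by apply: measurableX => //; exact: measurable_itv.
by move=> [r w] [/in0T hr _]; split => //; rewrite /= in_itv.
Qed.

Let b_time_continuous x' x i : {within `[0, T], continuous (fun r => b r x' x 0 i)}.
Proof.
have /subspace_continuousP cb := b_continuous coeff.
apply/subspace_continuousP => r hr.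
have hr' : 0 <= r <= T by move: hr; rewrite /= in_itv.
have := cb (r, (x', x)) hr' => h.
have h2 : b r' x' x @[r' --> within `[0, T] (nbhs r)] --> b r x' x.
  apply: cvg_trans h; move=> U hU.
  have [[V1 V2] /= [nV1 nV2] hV] := hU.
  rewrite /nbhs/=.
  apply: filterS nV1 => q V1q q0T.
  apply: (hV (q, (x', x))); first by split => //; exact: nbhs_singleton nV2.
  by move: q0T; rewrite /= in_itv.
apply: (@cvg_comp _ _ _ _ (fun v : 'rV[R]_n => v 0 i) _ _ _ h2).
exact: coord_continuous.
Qed.

(** With frozen space arguments [b] is continuous in time; [X0] and then [xs] are substituted by
    Lipschitz dependence, and integrating over [w] preserves measurability in time. *)
Lemma b_tilde_path (xs : R -> 'rV[R]_n) i : coord_measurable `[t, T] xs ->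
  measurable_fun `[t, T] (fun r => bt r (xs r) 0 i).
Proof.
move=> mxs.
rewrite (_ : (fun _ => _) = (fun r => \int[P]_w b r (X0 r w) (xs r) 0 i)); last first.
  by apply/funext => r; rewrite b_tildeE.
apply: (@measurable_Rintegral_space _ _ _ P _ (fun p => b p.1 (X0 p.1 p.2) (xs p.1) 0 i)) => //.
apply: (@measurable_plug _ _ _ n cdom (fun p => xs p.1) (fun v p => b p.1 (X0 p.1 p.2) v 0 i) C).
- exact: time_coord.
- move=> v; apply: (@measurable_plug _ _ _ n cdom (fun p => X0 p.1 p.2) (fun u p => b p.1 u v 0 i) C).
  + exact: jX0.
  + by move=> u; apply: (@measurable_time (fun r => b r u v 0 i)); exact: b_time_continuous.
  + move=> [r w] u u' [/in0T hr _]; have := b_lip u v u' v i hr.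
    by rewrite subrr enorm0 addr0.
- move=> [r w] v v' [/in0T hr _]; have := b_lip (X0 r w) v (X0 r w) v' i hr.
  by rewrite subrr enorm0 add0r.
Qed.

(** Five substitutions, one per space argument, are peeled off until only continuity in time is
    left. *)
Lemma f_tilde_path (xs : R -> 'rV[R]_n) (ys : R -> R) (zs : R -> 'rV[R]_d) :
  coord_measurable `[t, T] xs -> measurable_fun `[t, T] ys -> coord_measurable `[t, T] zs ->
  measurable_fun `[t, T] (fun r => ft r (xs r) (ys r) (zs r)).
Proof.
move=> mxs mys mzs.
rewrite (_ : (fun _ => _) = (fun r => \int[P]_w f r (X0 r w) (xs r) (Y0 r w) (ys r) (zs r))); last first.
  by apply/funext => r; rewrite f_tildeE.
apply: (@measurable_Rintegral_space _ _ _ P _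
  (fun p => f p.1 (X0 p.1 p.2) (xs p.1) (Y0 p.1 p.2) (ys p.1) (zs p.1))) => //.
have L r x1' x1 y1' y1 z1 x2' x2 y2' y2 z2 := f_lip x1' x1 y1' y1 z1 x2' x2 y2' y2 z2 (s := r).
have simp := (subrr, enorm0, normr0, addr0, add0r).
apply: (@measurable_plug _ _ _ d cdom (fun p => zs p.1)
  (fun v p => f p.1 (X0 p.1 p.2) (xs p.1) (Y0 p.1 p.2) (ys p.1) v) C); first exact: time_coord; last first.
  by move=> [r w] v v' [/in0T hr _]; have := L r (X0 r w) (xs r) (Y0 r w) (ys r) v (X0 r w) (xs r) (Y0 r w) (ys r) v' hr; rewrite !simp.
move=> z; apply: (@measurable_plug_real _ _ _ cdom (fun p => ys p.1)
  (fun v p => f p.1 (X0 p.1 p.2) (xs p.1) (Y0 p.1 p.2) v z) C); first exact: time_real; last first.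
  by move=> [r w] v v' [/in0T hr _]; have := L r (X0 r w) (xs r) (Y0 r w) v z (X0 r w) (xs r) (Y0 r w) v' z hr; rewrite !simp.
move=> y; apply: (@measurable_plug_real _ _ _ cdom (fun p => Y0 p.1 p.2)
  (fun v p => f p.1 (X0 p.1 p.2) (xs p.1) v y z) C); first exact: jY0; last first.
  by move=> [r w] v v' [/in0T hr _]; have := L r (X0 r w) (xs r) v y z (X0 r w) (xs r) v' y z hr; rewrite !simp.
move=> y'; apply: (@measurable_plug _ _ _ n cdom (fun p => xs p.1)
  (fun v p => f p.1 (X0 p.1 p.2) v y' y z) C); first exact: time_coord; last first.
  by move=> [r w] v v' [/in0T hr _]; have := L r (X0 r w) v y' y z (X0 r w) v' y' y z hr; rewrite !simp.
move=> x; apply: (@measurable_plug _ _ _ n cdom (fun p => X0 p.1 p.2)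
  (fun v p => f p.1 v x y' y z) C); first exact: jX0; last first.
  by move=> [r w] v v' [/in0T hr _]; have := L r v x y' y z v' x y' y z hr; rewrite !simp.
move=> x'; apply: (@measurable_time (fun r => f r x' x y' y z)).
exact: (f_continuous coeff).
Qed.

End PathMeasurability.
End AveragedDriver.

(** * The equations along almost every path *)

Section Regularity.
Context (t : R).
Hypothesis tT : 0 <= t <= T.
Let t_T : t <= T. Proof. by case/andP: tT. Qed.

Lemma S2_filtration m (X : R -> Om -> 'rV[R]_m) s i : in_S2 P T B (@enorm R 1 m) t X ->
  t <= s <= T -> ffun s (fun w => X s w 0 i).
Proof.
move=> [aX _ _] ts; apply: (@adapted_measurable R dO Om P T d B _ t X (fun v => v 0 i) s) => //.
exact: coord_continuous.
Qed.

Lemma S2_coord_measurable m (X : R -> Om -> 'rV[R]_m) s : in_S2 P T B (@enorm R 1 m) t X ->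
  t <= s <= T -> coord_measurable setT (X s).
Proof.
move=> SX hs i; apply: (filtration_fun_measurable P_complete B_brownian (s := s)).
  by case/andP: hs.
exact: S2_filtration hs.
Qed.

Lemma S2_filtration_real (Y : R -> Om -> R) s : in_S2 P T B (fun y : R => `|y|) t Y ->
  t <= s <= T -> ffun s (Y s).
Proof.
move=> [aY _ _] ts; apply: (@adapted_measurable R dO Om P T d B _ t Y idfun s) => //.
by move=> x; exact: cvg_id.
Qed.

Lemma S2_measurable_real (Y : R -> Om -> R) s : in_S2 P T B (fun y : R => `|y|) t Y ->
  t <= s <= T -> measurable_fun setT (Y s).
Proof.
move=> SY hs; apply: (filtration_fun_measurable P_complete B_brownian (s := s)).
  by case/andP: hs.
exact: S2_filtration_real.
Qed.

Lemma S2_joint m (X : R -> Om -> 'rV[R]_m) : in_S2 P T B (@enorm R 1 m) t X ->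
  coord_measurable (cdom t T) (fun p => X p.1 p.2).
Proof. by move=> [aX cX _]; exact: (cadlag_joint_measurable P_complete B_brownian). Qed.

Lemma S2_joint_real (Y : R -> Om -> R) : in_S2 P T B (fun y : R => `|y|) t Y ->
  measurable_fun (cdom t T) (fun p => Y p.1 p.2).
Proof. by move=> [aY cY _]; exact: (cadlag_joint_measurable_real P_complete B_brownian). Qed.

Lemma S2_bound_real (Y : R -> Om -> R) : in_S2 P T B (fun y : R => `|y|) t Y ->
  exists M : R, forall s, t <= s <= T -> (\int[P]_w (Y s w ^+ 2)%:E <= M%:E)%E.
Proof.
move=> SY; have [M hM] := in_S2_bound SY; exists M => s hs.
by apply: le_trans (hM s hs); under [leRHS]eq_integral do rewrite real_normK ?num_real//.
Qed.

Lemma ae_path_integrable m (X : R * Om -> 'rV[R]_m) (M : R) : coord_measurable (cdom t T) X ->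
  (forall s, t <= s <= T -> (msq P setT (fun w => X (s, w)) <= M%:E)%E) ->
  {ae P, forall w, lam.-integrable `[t, T] (fun r => (enorm (X (r, w)) ^+ 2)%:E)}.
Proof.
move=> mX hM; apply: ae_sqr_integrable => //.
have mXd : coord_measurable (dom t T) X.
  by apply: coord_measurableS mX; [apply: measurableX => //; exact: measurable_itv|exact: dom_sub_closed].
rewrite -msq_iterated//.
apply: (@le_lt_trans _ _ (M * (T - t))%:E); last exact: ltry.
apply: msq_dom_bound => // r /andP[tr rT]; apply: hM.
by rewrite rT ltW.
Qed.

Lemma time_section_coord m (X : R * Om -> 'rV[R]_m) w : coord_measurable (cdom t T) X ->
  coord_measurable `[t, T] (fun r => X (r, w)).
Proof.
by move=> mX i; apply: (time_section w _ (mX i)); exact: measurable_itv.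
Qed.

(** This is the increment form that the step estimates consume, with one null set for all pairs
    [s <= s']. The value at [t] is stated in mean square, as the stochastic integral is known to
    vanish there in that sense. *)
Lemma sde_path x X : sde_solution P T B bt st t x X -> exists2 I : 'I_n -> R -> Om -> R,
  (forall i, ito_integral P T B t (fun r w => row i (st r (X r w))) (I i)) &
  (forall i, (\int[P]_w ((X t w 0 i - x 0 i) ^+ 2)%:E = 0)%E) /\
  {ae P, forall w, forall i s s', t <= s -> s <= s' -> s' <= T ->
    lam.-integrable `]s, s'] (EFin \o (fun r => bt r (X r w) 0 i)) /\
    X s' w 0 i - X s w 0 i - (I i s' w - I i s w) = \int[lam]_(r in `]s, s']) bt r (X r w) 0 i}.
Proof.
move=> [SX [I [itoI eqI]]]; exists I => //.
have mX := S2_joint SX.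
have [M hM] := in_S2_bound SX.
have iX := ae_path_integrable mX hM.
split.
  move=> i; rewrite -(ito_integral_start tT (itoI i)).
  have tt : t <= t <= T by rewrite lexx.
  have mXt : measurable_fun setT (fun w => X t w 0 i).
    by apply: (filtration_fun_measurable P_complete B_brownian t_T); exact: S2_filtration.
  have mIt : measurable_fun setT (I i t).
    have [_ aI _ _] := itoI i.
    apply: (filtration_fun_measurable P_complete B_brownian t_T).
    by apply: (@adapted_measurable R dO Om P T d B _ t (I i) idfun t) => // y; exact: cvg_id.
  apply: ge0_ae_eq_integral => //.
  - by apply/measurable_EFinP; apply: measurable_funX; exact: measurable_funB.
  - by apply/measurable_EFinP; exact: measurable_funX.
  - by move=> w _; rewrite lee_fin sqr_ge0.
  - by move=> w _; rewrite lee_fin sqr_ge0.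
  - apply: filterS eqI => w /(_ t tt i) -> _.
    rewrite set_itv1 Rintegral_set1; congr (_%:E); ring.
apply: filterS2 iX eqI => w iXw eqw i s s' ts ss' s'T.
have iu : lam.-integrable `[t, T] (EFin \o (fun r => bt r (X r w) 0 i)).
  apply: (@integrable_linear_growth _ _ _ C _ (fun r => enorm (X r w))) => //.
  - apply: (b_tilde_path); first by case/andP: tT.
    exact: (time_section_coord w mX).
  - by apply: measurable_enorm; exact: (time_section_coord w mX).
  - by move=> r _; exact: enorm_ge0.
  - move=> r /andP[tr rT].
    apply: (b_tilde_growth).
    by rewrite rT andbT; apply: le_trans tr; case/andP: tT.
split.
  apply: integrableS iu => // r; rewrite /= !in_itv/= => /andP[h1 h2].
  by rewrite (le_trans ts (ltW h1)) (le_trans h2 s'T).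
have hs : t <= s <= T by rewrite ts (le_trans ss' s'T).
have hs' : t <= s' <= T by rewrite s'T (le_trans ts ss').
rewrite (eqw s hs i) (eqw s' hs' i) (Rintegral_split ts ss' s'T iu).
by ring.
Qed.

(** The driver grows linearly in [N], the sum of the three norms. Paths of [N] are square integrable
    by the uniform second moments of [X] and [Y] and by the [in_H2] bound on [Z], so the driver is
    integrable along them. *)
Lemma bsde_path X Y Z : in_S2 P T B (@enorm R 1 n) t X ->
  bsde_solution P T B ft Pt t X Y Z -> exists2 I : R -> Om -> R,
  ito_integral P T B t Z I &
  {ae P, forall w, Y T w = Pt (X T w)} /\
  {ae P, forall w, forall s s', t <= s -> s <= s' -> s' <= T ->
    lam.-integrable `]s, s'] (EFin \o (fun r => ft r (X r w) (Y r w) (Z r w))) /\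
    Y s' w - Y s w - (I s' w - I s w) = - \int[lam]_(r in `]s, s']) ft r (X r w) (Y r w) (Z r w)}.
Proof.
move=> SX [SY [pZ Z2] [I itoI eqI]]; exists I => //.
have mX := S2_joint SX; have mY := S2_joint_real SY.
have [M hM] := in_S2_bound SX; have [M' hM'] := S2_bound_real SY.
have iX := ae_path_integrable mX hM.
have mYs : coord_measurable (cdom t T) (fun p => (Y p.1 p.2)%:M : 'rV[R]_1).
  exact: coord_measurable_scalar.
have iY : {ae P, forall w, lam.-integrable `[t, T] (fun r => (enorm ((Y r w)%:M : 'rV[R]_1) ^+ 2)%:E)}.
  apply: (@ae_path_integrable _ (fun p => (Y p.1 p.2)%:M : 'rV[R]_1) M') => // s hs.
  by rewrite msq_scalar; exact: hM'.
have mZ := progressive_measurable P_complete B_brownian t_T pZ.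
have iZ := ae_sqr_integrable mZ Z2.
have [K K0 hK] := f_tilde_growth.
split.
  apply: filterS eqI => w /(_ T); rewrite lexx t_T => /(_ isT) ->.
  by rewrite set_itv1 Rintegral_set1; ring.
apply: filterS2 (filterI (filterI iX iY) iZ) eqI => w [[iXw iYw] iZw] eqw s s' ts ss' s'T.
have mXw := time_section_coord w mX.
have mZw := time_section_coord w mZ.
have mYw : measurable_fun `[t, T] (fun r => Y r w).
  by apply: (time_section w _ mY); exact: measurable_itv.
pose N r := enorm (X r w) + `|Y r w| + enorm (Z r w).
have mN : measurable_fun `[t, T] N.
  apply: measurable_funD; last exact: measurable_enorm.
  by apply: measurable_funD; [exact: measurable_enorm|exact: measurableT_comp].
have iN : lam.-integrable `[t, T] (fun r => (N r ^+ 2)%:E).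
  have mI : measurable (`[t, T]%classic : set (measurableTypeR R)) by exact: measurable_itv.
  have iS := integrableD mI (integrableD mI iXw iYw) iZw.
  apply: (le_integrable mI) (integrableZl mI 3 iS).
    by apply/measurable_EFinP; exact: measurable_funX.
  move=> r _; rewrite lee_fin enorm_scalar_sqr ger0_norm ?sqr_ge0//.
  rewrite ger0_norm; last by rewrite mulr_ge0// !addr_ge0// sqr_ge0.
  rewrite /N -[Y r w ^+ 2]real_normK ?num_real//.
  move: (enorm (X r w)) (`|Y r w|) (enorm (Z r w)) => a b' c.
  rewrite -subr_ge0 (_ : _ - _ = (a - b') ^+ 2 + (a - c) ^+ 2 + (b' - c) ^+ 2); last by ring.
  by rewrite !addr_ge0// sqr_ge0.
have iu : lam.-integrable `[t, T] (EFin \o (fun r => ft r (X r w) (Y r w) (Z r w))).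
  apply: (@integrable_linear_growth _ _ _ K _ N) => //.
  - apply: (f_tilde_path) => //.
    by case/andP: tT.
  - by move=> r _; rewrite !addr_ge0// enorm_ge0.
  - move=> r /andP[tr rT]; rewrite /N !addrA; apply: hK.
    by rewrite rT andbT; apply: le_trans tr; case/andP: tT.
split.
  apply: integrableS iu => // r; rewrite /= !in_itv/= => /andP[h1 h2].
  by rewrite (le_trans ts (ltW h1)) (le_trans h2 s'T).
have hs : t <= s <= T by rewrite ts (le_trans ss' s'T).
have hs' : t <= s' <= T by rewrite s'T (le_trans ts ss').
rewrite (eqw s hs) (eqw s' hs') (Rintegral_split_backward ts ss' s'T iu).
by ring.
Qed.

End Regularity.

(** * Estimates for the forward equation *)

Section ForwardEstimates.
(** One constant for both uses of [sde_estimate]: [2 * C] bounds the drift and the other summand a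
    squared row of the diffusion, once [1 + enorm y] is replaced by
    [2 * ((1 + enorm x) + enorm (y - x))]. *)
Let K : R := 2 * C + 8 * (d%:R * C ^+ 2).
Let dC0 : 0 <= d%:R * C ^+ 2. Proof. by rewrite mulr_ge0// sqr_ge0. Qed.
Let K0 : 0 <= K. Proof. by rewrite addr_ge0// mulr_ge0// ltW. Qed.
Let K2C : 2 * C <= K. Proof. by rewrite lerDl mulr_ge0. Qed.
Let K8C : 8 * (d%:R * C ^+ 2) <= K. Proof. by rewrite lerDr mulr_ge0// ltW. Qed.

Lemma measurable_path_enorm m (t s s' : R) (h : R -> Om -> 'rV[R]_m) w : t <= s -> s' <= T ->
  coord_measurable (cdom t T) (fun p => h p.1 p.2) ->
  measurable_fun `]s, s'] (fun r => enorm (h r w)).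
Proof.
move=> ts s'T mh; apply: measurable_enorm => i.
apply: (@measurable_funS _ _ _ _ `[t, T]%classic); first exact: measurable_itv.
  move=> r; rewrite /= !in_itv/= => /andP[sr rs'].
  by rewrite (le_trans ts (ltW sr)) (le_trans rs' s'T).
by apply: (time_section w _ (mh i)); exact: measurable_itv.
Qed.

Lemma measurable_path_abs (t s s' : R) (h : R -> Om -> R) w : t <= s -> s' <= T ->
  measurable_fun (cdom t T) (fun p => h p.1 p.2) ->
  measurable_fun `]s, s'] (fun r => `|h r w|).
Proof.
move=> ts s'T mh; apply: measurableT_comp => //.
apply: (@measurable_funS _ _ _ _ `[t, T]%classic); first exact: measurable_itv.
  move=> r; rewrite /= !in_itv/= => /andP[sr rs'].
  by rewrite (le_trans ts (ltW sr)) (le_trans rs' s'T).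
by apply: (time_section w _ mh); exact: measurable_itv.
Qed.

Lemma msqB_le m (U V : Om -> 'rV[R]_m) (M M' : R) : coord_measurable setT U ->
  coord_measurable setT V -> (msq P setT U <= M%:E)%E -> (msq P setT V <= M'%:E)%E ->
  (msq P setT (fun w => (U w - V w)%R) <= (2 * M + 2 * M')%:E)%E.
Proof.
move=> mU mV UM VM; apply: (@le_trans _ _ (2%:E * msq P setT U + 2%:E * msq P setT V)%E).
  apply: msq_lin => //; first exact: coord_measurableB.
  by move=> w _; rewrite (le_trans (enormD_sqr _ _))// enormN.
rewrite (_ : (2 * M + 2 * M')%:E = 2%:E * M%:E + 2%:E * M'%:E)%E; last first.
  by rewrite -!EFinM -EFinD.
by apply: leeD; apply: lee_wpmul2l.
Qed.

Lemma msq_translate_bound t x (X : R -> Om -> 'rV[R]_n) : 0 <= t <= T ->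
  in_S2 P T B (@enorm R 1 n) t X ->
  exists M : R, forall s, t <= s <= T -> (msq P setT (fun w => (X s w - x)%R) <= M%:E)%E.
Proof.
move=> tT SX; have [M hM] := in_S2_bound SX.
exists (2 * M + 2 * enorm x ^+ 2) => s hs.
apply: msqB_le (hM s hs) _.
- exact: S2_coord_measurable hs.
- by move=> i; exact: measurable_cst.
- by rewrite /msq probability_integral_cst.
Qed.

(** The displacement starts from 0 in mean square, so the estimate leaves only its source term,
    proportional to [s - t]: its square root is the origin of the exponent one half, and the source
    [1 + enorm x] that of the growth in [x]. *)
Lemma sde_displacement : exists2 C1 : R, 0 <= C1 & forall t x X s, 0 <= t <= T ->
  sde_solution P T B bt st t x X -> t <= s <= T ->
  (msq P setT (fun w => (X s w - x)%R) <= (C1 * ((s - t) * (1 + enorm x) ^+ 2))%:E)%E.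
Proof.
have [C1 C10 hC1] := sde_estimate P_complete B_brownian n K0.
exists C1 => // t x X s tT solX hs.
have t0 : 0 <= t by case/andP: tT.
have tT' : t <= T by case/andP: tT.
have SX := solX.1.
have [I itoI [X_t pX]] := sde_path tT solX.
have x_ge0 := enorm_ge0 x.
have mX := S2_joint tT SX.
have mD : coord_measurable (cdom t T) (fun p => X p.1 p.2 - x).
  by apply: coord_measurableB => // i; exact: measurable_cst.
have ffX r i : t <= r <= T -> ffun r (fun w => (X r w - x) 0 i).
  move=> hr; rewrite (_ : (fun _ => _) = (fun w => X r w 0 i - x 0 i)).
    by apply: measurable_funB; [exact: (S2_filtration _ SX hr)|exact: measurable_cst].
  by apply/funext => w; rewrite !mxE.
have tt : t <= t <= T by rewrite lexx.
have D0 : msq P setT (fun w => (X t w - x)%R) = 0%E.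
  rewrite msq_coord//; last first.
    by move=> i; apply: (filtration_fun_measurable P_complete B_brownian tT'); exact: ffX.
  by apply: big1 => i _; under eq_integral do rewrite !mxE; exact: X_t.
have growth (y : 'rV[R]_n) : 1 + enorm y <= 2 * ((1 + enorm x) + enorm (y - x)).
  have := enormD (y - x) x; rewrite subrK; lra.
have := hC1 t (1 + enorm x) (fun r w => X r w - x) tT _ ffX mD (msq_translate_bound x tT SX) _ s hs.
rewrite D0 /= add0r; apply; first by rewrite addr_ge0.
move=> r r' i /andP[tr rr'] r'T.
have [r0 r'0] : 0 <= r /\ 0 <= r' by split; [exact: le_trans tr|exact: le_trans (le_trans tr rr')].
exists (fun w => I i r' w - I i r w), (fun p => row i (st p.1 (X p.1 p.2))); split.
- exact: (ito_integral_increment P_complete B_brownian t0 tr rr' r'T (itoI i)).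
- move=> [q w] [] /=; rewrite in_itv/= => /andP[rq qr'] _.
  have hq : 0 <= q <= T by rewrite (le_trans r0 (ltW rq)) (le_trans qr' r'T).
  apply: (le_trans (sigma_tilde_growth _ i hq)).
  have := growth (X q w); have := enorm_ge0 (X q w); have := enorm_ge0 (X q w - x).
  set y := enorm (X q w - x); set g := 1 + enorm x; set z := enorm (X q w) => y0 z0 zg.
  have g0 : 0 <= g by rewrite addr_ge0.
  apply: (@le_trans _ _ (8 * (d%:R * C ^+ 2) * (g ^+ 2 + y ^+ 2))); last first.
    by rewrite ler_wpM2r// addr_ge0// sqr_ge0.
  rewrite exprMn [leLHS]mulrA [8 * _]mulrC -[leRHS]mulrA; apply: ler_wpM2l => //.
  apply: (@le_trans _ _ ((2 * (g + y)) ^+ 2)).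
    by rewrite ler_sqr ?nnegrE// ?addr_ge0// mulr_ge0// addr_ge0.
  rewrite -subr_ge0 (_ : _ - _ = 4 * (g - y) ^+ 2); last by ring.
  by rewrite mulr_ge0// sqr_ge0.
- apply: filterS pX => w /(_ i r r' tr rr' r'T)[iu e].
  rewrite !mxE (_ : _ - _ - _ = X r' w 0 i - X r w 0 i - (I i r' w - I i r w)); last by ring.
  rewrite e; apply: abs_Rintegral_le => //.
    apply: measurable_funM => //; apply: measurable_funD => //.
    exact: (@measurable_path_enorm n t r r' (fun q w => X q w - x) w tr r'T mD).
  move=> q; rewrite /= in_itv/= => /andP[rq qr'].
  have hq : 0 <= q <= T by rewrite (le_trans r0 (ltW rq)) (le_trans qr' r'T).
  apply: (le_trans (b_tilde_growth _ i hq)).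
  apply: (@le_trans _ _ (C * (2 * ((1 + enorm x) + enorm (X q w - x))))).
    by rewrite ler_wpM2l ?growth// ltW.
  by rewrite mulrA [C * 2]mulrC ler_wpM2r// !addr_ge0// enorm_ge0.
Qed.

Lemma coord_measurable_later m t t' (h : R -> Om -> 'rV[R]_m) : t <= t' ->
  coord_measurable (cdom t T) (fun p => h p.1 p.2) ->
  coord_measurable (cdom t' T) (fun p => h p.1 p.2).
Proof.
move=> tt' mh; apply: (coord_measurableS _ _ mh).
  by apply: measurableX => //; exact: measurable_itv.
move=> [r w] [] /=; rewrite !in_itv/= => /andP[h1 ->] _; split => //=.
by rewrite (le_trans tt' h1).
Qed.

(** Lipschitz coefficients leave no source, so [g = 0]. The comparison runs from the later starting
    time, where the first solution is already random. *)
Lemma sde_stability : exists2 C2 : R, 0 <= C2 & forall t t' x x' X X' s, 0 <= t <= t' -> t' <= T ->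
  sde_solution P T B bt st t x X -> sde_solution P T B bt st t' x' X' -> t' <= s <= T ->
  (msq P setT (fun w => (X s w - X' s w)%R) <=
    (C2 * fine (msq P setT (fun w => (X t' w - X' t' w)%R)))%:E)%E.
Proof.
have [C2 C20 hC2] := sde_estimate P_complete B_brownian n K0.
exists C2 => // t t' x x' X X' s /andP[t0 tt'] t'T solX solX' hs.
have tT : 0 <= t <= T by rewrite t0 (le_trans tt').
have t'0 := le_trans t0 tt'.
have t'T' : 0 <= t' <= T by rewrite t'0.
have SX := solX.1; have SX' := solX'.1.
have [I itoI [_ pX]] := sde_path tT solX.
have [I' itoI' [_ pX']] := sde_path t'T' solX'.
have mX := coord_measurable_later tt' (S2_joint tT SX).
have mX' := S2_joint t'T' SX'.
have mD : coord_measurable (cdom t' T) (fun p => X p.1 p.2 - X' p.1 p.2).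
  exact: coord_measurableB.
have later r : t' <= r <= T -> t <= r <= T.
  by case/andP => h ->; rewrite (le_trans tt' h).
have ffX r i : t' <= r <= T -> ffun r (fun w => (X r w - X' r w) 0 i).
  move=> hr; rewrite (_ : (fun _ => _) = (fun w => X r w 0 i - X' r w 0 i)).
    by apply: measurable_funB; [exact: (S2_filtration _ SX (later r hr))|exact: (S2_filtration _ SX' hr)].
  by apply/funext => w; rewrite !mxE.
have bound : exists M : R, forall r, t' <= r <= T ->
    (msq P setT (fun w => (X r w - X' r w)%R) <= M%:E)%E.
  have [M hM] := in_S2_bound SX; have [M' hM'] := in_S2_bound SX'.
  exists (2 * M + 2 * M') => r hr.
  apply: msqB_le (hM r (later r hr)) (hM' r hr).
    exact: (S2_coord_measurable SX (later r hr)).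
  exact: (S2_coord_measurable SX' hr).
have := hC2 t' 0 (fun r w => X r w - X' r w) t'T' (lexx 0) ffX mD bound _ s hs.
rewrite expr0n/= mulr0 addr0; apply => r r' i /andP[tr rr'] r'T.
have [r0 r'0] : 0 <= r /\ 0 <= r'.
  by split; [exact: le_trans tr|exact: le_trans (le_trans tr rr')].
have tr1 := le_trans tt' tr.
exists (fun w => (I i r' w - I i r w) - (I' i r' w - I' i r w)),
  (fun p => row i (st p.1 (X p.1 p.2)) - row i (st p.1 (X' p.1 p.2))); split.
- apply: (ito_incrementB P_complete B_brownian r0 r'T).
    exact: (ito_integral_increment P_complete B_brownian t0 tr1 rr' r'T (itoI i)).
  exact: (ito_integral_increment P_complete B_brownian t'0 tr rr' r'T (itoI' i)).
- move=> [q w] [] /=; rewrite in_itv/= => /andP[rq qr'] _.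
  have hq : 0 <= q <= T by rewrite (le_trans r0 (ltW rq)) (le_trans qr' r'T).
  apply: (le_trans (sigma_tilde_lip _ _ i hq)).
  rewrite exprMn mulrA add0r ler_wpM2r ?sqr_ge0//; apply: le_trans K8C.
  by rewrite ler_peMl// ler1n.
- apply: filterS2 pX pX' => w /(_ i r r' tr1 rr' r'T)[iu e] /(_ i r r' tr rr' r'T)[iu' e'].
  rewrite !mxE (_ : _ - _ - _ = (X r' w 0 i - X r w 0 i - (I i r' w - I i r w)) -
    (X' r' w 0 i - X' r w 0 i - (I' i r' w - I' i r w))); last by ring.
  rewrite e e' -RintegralB//; apply: abs_Rintegral_le => //.
  + have mI : measurable (`]r, r']%classic : set (measurableTypeR R)) by exact: measurable_itv.
    exact: (integrableB mI iu iu').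
  + apply: measurable_funM => //; apply: measurable_funD => //.
    exact: (@measurable_path_enorm n t' r r' (fun q w => X q w - X' q w) w tr r'T mD).
  + move=> q; rewrite /= in_itv/= => /andP[rq qr'].
    have hq : 0 <= q <= T by rewrite (le_trans r0 (ltW rq)) (le_trans qr' r'T).
    apply: (le_trans (b_tilde_lip _ _ i hq)).
    rewrite add0r ler_wpM2r ?enorm_ge0//; apply: le_trans K2C.
    by rewrite (ler_peMl (ltW C_gt0))// ler1n.
Qed.

End ForwardEstimates.

(** At [t'] the first solution has moved from [x] by its displacement over [[t, t']], and the second
    equals [x] in mean square; stability carries this gap to later times. *)
Lemma sde_flow : exists2 C1 : R, 0 <= C1 & forall t t' x X X' s, 0 <= t <= t' -> t' <= T ->
  sde_solution P T B bt st t x X -> sde_solution P T B bt st t' x X' -> t' <= s <= T ->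
  (msq P setT (fun w => (X s w - X' s w)%R) <= (C1 * ((t' - t) * (1 + enorm x) ^+ 2))%:E)%E.
Proof.
have [C1 C10 hC1] := sde_displacement.
have [C2 C20 hC2] := sde_stability.
exists (C2 * (2 * C1)); first by rewrite !mulr_ge0.
move=> t t' x X X' s tt' t'T solX solX' hs.
have [t0 tlt] : 0 <= t /\ t <= t' by apply/andP.
have tT : 0 <= t <= T by rewrite t0 (le_trans tlt).
have t'T' : 0 <= t' <= T by rewrite (le_trans t0 tlt).
have h1 : t <= t' <= T by rewrite tlt.
have h2 : t' <= t' <= T by rewrite lexx.
apply: (le_trans (hC2 t t' x x X X' s tt' t'T solX solX' hs)).
rewrite lee_fin -mulrA ler_wpM2l//.
have a1 := hC1 t x X t' tT solX h1; have a2 := hC1 t' x X' t' t'T' solX' h2.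
rewrite subrr mul0r mulr0 in a2.
have mx : coord_measurable setT (fun _ : Om => x) by move=> i; exact: measurable_cst.
have mX := S2_coord_measurable solX.1 h1; have mX' := S2_coord_measurable solX'.1 h2.
have key : (msq P setT (fun w => (X t' w - X' t' w)%R) <=
    (2 * C1 * ((t' - t) * (1 + enorm x) ^+ 2))%:E)%E.
  rewrite (_ : (fun w => X t' w - X' t' w) = (fun w => (X t' w - x) - (X' t' w - x))); last first.
    by apply/funext => w; rewrite opprB addrA subrK.
  apply: le_trans (msqB_le _ _ a1 a2) _; [exact: coord_measurableB..|].
  by rewrite mulr0 addr0 mulrA.
have := key; rewrite -[X in (X <= _)%E]fineK ?lee_fin//.
rewrite ge0_fin_numE ?msq_ge0//; exact: le_lt_trans key (ltry _).
Qed.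

Lemma sde_moment : exists2 C5 : R, 0 <= C5 & forall t x X s, 0 <= t <= T ->
  sde_solution P T B bt st t x X -> t <= s <= T ->
  (\int[P]_w ((1 + enorm (X s w)) ^+ 2)%:E <= (C5 * (1 + enorm x) ^+ 2)%:E)%E.
Proof.
have [C1 C10 hC1] := sde_displacement.
(* The factor 8 comes from squaring [1 + |X| <= 2 ((1 + |x|) + |X - x|)]. *)
exists (8 * (1 + C1 * T)); first by rewrite mulr_ge0// addr_ge0// mulr_ge0.
move=> t x X s tT solX hs; have x_ge0 := enorm_ge0 x.
have a1 := hC1 t x X s tT solX hs.
have mX := S2_coord_measurable solX.1 hs.
have mx : coord_measurable setT (fun _ : Om => x) by move=> i; exact: measurable_cst.
rewrite -msq_scalar.
have mg : coord_measurable setT (fun _ : Om => (1 + enorm x)%:M : 'rV[R]_1).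
  by apply: coord_measurable_scalar; exact: measurable_cst.
apply: (@le_trans _ _ (8%:E * msq P setT (fun _ : Om => (1 + enorm x)%:M : 'rV[R]_1) +
    8%:E * msq P setT (fun w => (X s w - x)%R))%E).
  apply: msq_lin => //; last first.
  - move=> w _; rewrite !enorm_scalar_sqr.
    have := enormD (X s w - x) x; rewrite subrK.
    have := enorm_ge0 (X s w); have := enorm_ge0 (X s w - x).
    set y := enorm (X s w - x); set z := enorm (X s w) => y0 z0 zg.
    apply: (@le_trans _ _ ((2 * ((1 + enorm x) + y)) ^+ 2)).
      by rewrite ler_sqr ?nnegrE; lra.
    rewrite -subr_ge0 (_ : _ - _ = 4 * ((1 + enorm x) - y) ^+ 2); last by ring.
    by rewrite mulr_ge0// sqr_ge0.
  - exact: coord_measurableB.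
  - by apply: coord_measurable_scalar; apply: measurable_funD => //; exact: measurable_enorm.
apply: (@le_trans _ _ (8%:E * ((1 + enorm x) ^+ 2)%:E + 8%:E * (C1 * ((s - t) * (1 + enorm x) ^+ 2))%:E)%E).
  apply: leeD; apply: lee_wpmul2l => //.
  by rewrite msq_scalar probability_integral_cst.
rewrite -!EFinM -EFinD lee_fin.
have g2 := sqr_ge0 (1 + enorm x).
rewrite (_ : 8 * (1 + C1 * T) * (1 + enorm x) ^+ 2 = 8 * (1 + enorm x) ^+ 2 +
  8 * (C1 * (T * (1 + enorm x) ^+ 2))); last by ring.
rewrite lerD2l ler_wpM2l// ler_wpM2l// ler_wpM2r//.
by case/andP: tT => *; case/andP: hs => *; lra.
Qed.

(** Source and terminal value are both controlled by [1 + enorm (X s w)], whose second moment is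
    known. At the initial time this bounds the value function linearly in [x]. *)
Lemma bsde_bound : exists2 C6 : R, 0 <= C6 & forall t x X Y Z s, 0 <= t <= T ->
  sde_solution P T B bt st t x X -> bsde_solution P T B ft Pt t X Y Z -> t <= s <= T ->
  (\int[P]_w (Y s w ^+ 2)%:E <= (C6 * (1 + enorm x) ^+ 2)%:E)%E.
Proof.
have [K K0 hK] := f_tilde_growth.
have [C5 C50 hC5] := sde_moment.
have [C6 C60 hC6] := bsde_estimate P_complete B_brownian T0 K0.
pose L := `|Pt 0| + C.
have L0 : 0 <= L by rewrite addr_ge0// ltW.
have hL y : `|Pt y| <= L * (1 + enorm y).
  have := Phi_tilde_lip y 0; rewrite subr0 => h.
  have y0 := enorm_ge0 y; have p0 := normr_ge0 (Pt 0).
  rewrite -[Pt y](subrK (Pt 0)); apply: (le_trans (ler_normD _ _)).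
  have := mulr_ge0 p0 y0; have := C_gt0; rewrite /L; nra.
exists (C6 * (L ^+ 2 * C5 + C5)); first by rewrite mulr_ge0// addr_ge0// mulr_ge0// sqr_ge0.
move=> t x X Y Z s tT solX solY hs.
have [t0 tT'] : 0 <= t /\ t <= T by apply/andP.
have SX := solX.1; have [SY _ _] := solY.
have [I itoI [Y_T pY]] := bsde_path tT SX solY.
have mX := S2_joint tT SX.
have mY := S2_joint_real tT SY.
have mZ := progressive_measurable P_complete B_brownian tT' (let: And3 _ H _ := solY in H.1).
have mG : measurable_fun (cdom t T) (fun p => 1 + enorm (X p.1 p.2)).
  by apply: measurable_funD => //; exact: measurable_enorm.
have TT : t <= T <= T by rewrite tT' lexx.
have := hC6 t (C5 * (1 + enorm x) ^+ 2) Y (fun p => 1 + enorm (X p.1 p.2)) tT _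
  (fun r hr => S2_filtration_real SY hr) mY (S2_bound_real SY) mG.
move=> /(_ (mulr_ge0 C50 (sqr_ge0 _)) (fun p => addr_ge0 ler01 (enorm_ge0 _))).
move=> /(_ (fun r hr => hC5 t x X r tT solX hr) _ s hs) h.
apply: (le_trans (h _)).
  move=> r r' /andP[tr rr'] r'T.
  exists (fun w => I r' w - I r w), (fun p => Z p.1 p.2); split.
    exact: (ito_integral_increment P_complete B_brownian t0 tr rr' r'T itoI).
  apply: filterS pY => w /(_ r r' tr rr' r'T)[iu e].
  rewrite e normrN; apply: abs_Rintegral_le => //.
    apply: measurable_funM => //; apply: measurable_funD; last first.
      exact: (measurable_path_enorm w tr r'T mZ).
    apply: measurable_funD.
      by apply: measurable_funD => //; exact: (measurable_path_enorm w tr r'T mX).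
    exact: (measurable_path_abs w tr r'T mY).
  move=> q; rewrite /= in_itv/= => /andP[rq qr'].
  by apply: hK; rewrite (le_trans t0 (le_trans tr (ltW rq))) (le_trans qr' r'T).
rewrite lee_fin -mulrA ler_wpM2l// mulrDl lerD2r.
have mXT := S2_coord_measurable SX TT.
have mGT : measurable_fun setT (fun w => 1 + enorm (X T w)).
  by apply: measurable_funD => //; exact: measurable_enorm.
have mYT := S2_measurable_real SY TT.
apply: fine_le_fin; first by apply: integral_ge0 => w _; rewrite lee_fin sqr_ge0.
rewrite -mulrA; apply: (integral_sqr_ae_le L0 mYT mGT _ _ (hC5 t x X T tT solX TT)).
  by move=> w; rewrite addr_ge0// enorm_ge0.
by apply: filterS Y_T => w ->; exact: hL.
Qed.

(** The Lipschitz bounds give the difference the source [enorm (X - X')]. In the constant, [C ^+ 2]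
    stands for the terminal difference and 1 for the driver. *)
Lemma bsde_stability : exists2 C7 : R, 0 <= C7 &
  forall t t' x x' X X' Y Y' Z Z' M s, 0 <= t <= t' -> t' <= T ->
  sde_solution P T B bt st t x X -> sde_solution P T B bt st t' x' X' ->
  bsde_solution P T B ft Pt t X Y Z -> bsde_solution P T B ft Pt t' X' Y' Z' -> 0 <= M ->
  (forall r, t' <= r <= T -> (msq P setT (fun w => (X r w - X' r w)%R) <= M%:E)%E) ->
  t' <= s <= T -> (\int[P]_w ((Y s w - Y' s w) ^+ 2)%:E <= (C7 * M)%:E)%E.
Proof.
have [C6 C60 hC6] := bsde_estimate P_complete B_brownian T0 C0.
exists (C6 * (C ^+ 2 + 1)); first by rewrite mulr_ge0// addr_ge0// sqr_ge0.
move=> t t' x x' X X' Y Y' Z Z' M s /andP[t0 tt'] t'T solX solX' solY solY' M0 hM hs.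
have tT : 0 <= t <= T by rewrite t0 (le_trans tt').
have t'0 := le_trans t0 tt'.
have t'T' : 0 <= t' <= T by rewrite t'0.
have tlT : t <= T := le_trans tt' t'T.
have SX := solX.1; have SX' := solX'.1.
have [SY pZ _] := solY; have [SY' pZ' _] := solY'.
have [I itoI [Y_T pY]] := bsde_path tT SX solY.
have [I' itoI' [Y'_T pY']] :=
  bsde_path t'T' SX' solY'.
have later r : t' <= r <= T -> t <= r <= T.
  by case/andP => h ->; rewrite (le_trans tt' h).
have mX := coord_measurable_later tt' (S2_joint tT SX).
have mX' := S2_joint t'T' SX'.
have mY : measurable_fun (cdom t' T) (fun p => Y p.1 p.2).
  apply: (measurable_funS _ _ (S2_joint_real tT SY)).
    by apply: measurableX => //; exact: measurable_itv.
  move=> [r w] [] /=; rewrite !in_itv/= => hr _; split => //=.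
  exact: later.
have mY' := S2_joint_real t'T' SY'.
have mZ := coord_measurable_later tt' (progressive_measurable P_complete B_brownian tlT pZ.1).
have mZ' := progressive_measurable P_complete B_brownian t'T pZ'.1.
have mDX : coord_measurable (cdom t' T) (fun p => X p.1 p.2 - X' p.1 p.2).
  exact: coord_measurableB.
have mDZ : coord_measurable (cdom t' T) (fun p => Z p.1 p.2 - Z' p.1 p.2).
  exact: coord_measurableB.
have mDY : measurable_fun (cdom t' T) (fun p => Y p.1 p.2 - Y' p.1 p.2).
  exact: measurable_funB.
have mG : measurable_fun (cdom t' T) (fun p => enorm (X p.1 p.2 - X' p.1 p.2)).
  exact: measurable_enorm.
have TT : t' <= T <= T by rewrite t'T lexx.
have FD r : t' <= r <= T -> ffun r (fun w => Y r w - Y' r w).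
  move=> hr; apply: measurable_funB; first exact: (S2_filtration_real SY (later r hr)).
  exact: (S2_filtration_real SY' hr).
have bound : exists M : R, forall r, t' <= r <= T -> (\int[P]_w ((Y r w - Y' r w) ^+ 2)%:E <= M%:E)%E.
  have [N hN] := S2_bound_real SY; have [N' hN'] := S2_bound_real SY'.
  exists (2 * N + 2 * N') => r hr.
  apply: (le_trans (integral_sqrD P (S2_measurable_real SY (later r hr)) (measurableT_comp (@oppr_measurable R setT) (S2_measurable_real SY' hr)))).
  under [X in (_ + _ * X <= _)%E]eq_integral do rewrite sqrrN.
  rewrite (_ : (2 * N + 2 * N')%:E = 2%:E * N%:E + 2%:E * N'%:E)%E; last first.
    by rewrite -!EFinM -EFinD.
  by apply: leeD; apply: lee_wpmul2l => //; [exact/hN/later|exact: hN'].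
have := hC6 t' M (fun r w => Y r w - Y' r w) (fun p => enorm (X p.1 p.2 - X' p.1 p.2)) t'T' M0
  FD mDY bound mG (fun p => enorm_ge0 _) hM _ s hs.
move=> h; apply: (le_trans (h _)).
  move=> r r' /andP[tr rr'] r'T; have tr1 := le_trans tt' tr.
  have r0 : 0 <= r by exact: le_trans tr.
  exists (fun w => (I r' w - I r w) - (I' r' w - I' r w)),
    (fun p => Z p.1 p.2 - Z' p.1 p.2); split.
    apply: (ito_incrementB P_complete B_brownian r0 r'T).
      exact: (ito_integral_increment P_complete B_brownian t0 tr1 rr' r'T itoI).
    exact: (ito_integral_increment P_complete B_brownian t'0 tr rr' r'T itoI').
  apply: filterS2 pY pY' => w /(_ r r' tr1 rr' r'T)[iu e] /(_ r r' tr rr' r'T)[iu' e'].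
  rewrite (_ : _ - _ - _ = (Y r' w - Y r w - (I r' w - I r w)) -
    (Y' r' w - Y' r w - (I' r' w - I' r w))); last by ring.
  rewrite e e' -opprD normrN -RintegralB//; apply: abs_Rintegral_le => //.
  + have mI : measurable (`]r, r']%classic : set (measurableTypeR R)) by exact: measurable_itv.
    exact: (integrableB mI iu iu').
  + apply: measurable_funM => //; apply: measurable_funD; last first.
      exact: (@measurable_path_enorm d t' r r' (fun q w => Z q w - Z' q w) w tr r'T mDZ).
    apply: measurable_funD.
      exact: (@measurable_path_enorm n t' r r' (fun q w => X q w - X' q w) w tr r'T mDX).
    exact: (@measurable_path_abs t' r r' (fun q w => Y q w - Y' q w) w tr r'T mDY).
  + move=> q; rewrite /= in_itv/= => /andP[rq qr'].
    apply: (f_tilde_lip).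
    by rewrite (le_trans r0 (ltW rq)) (le_trans qr' r'T).
rewrite lee_fin -mulrA ler_wpM2l// mulrDl mul1r lerD2r.
apply: fine_le_fin; first by apply: integral_ge0 => w _; rewrite lee_fin sqr_ge0.
have mDXT : coord_measurable setT (fun w => X T w - X' T w).
  apply: coord_measurableB; first exact: (S2_coord_measurable SX (later T TT)).
  exact: (S2_coord_measurable SX' TT).
apply: (integral_sqr_ae_le C0 _ (measurable_enorm mDXT) (fun w => enorm_ge0 _) _ (hM T TT)).
  by apply: measurable_funB; [exact: (S2_measurable_real SY (later T TT))|exact: (S2_measurable_real SY' TT)].
apply: filterS2 Y_T Y'_T => w -> ->.
exact: (Phi_tilde_lip).
Qed.

(** Since [Y'] is the constant [c'] at [t'], the drift and the integrand of the last step are those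
    of [Y] alone. The growth bound on the driver thus applies, and bounded second moments over a
    step of length [t' - t] give the required order. *)
Lemma value_increment : exists2 A : R, 0 <= A &
  forall t t' x X X' Y Y' Z Z' c c', 0 <= t <= t' -> t' <= T ->
  sde_solution P T B bt st t x X -> sde_solution P T B bt st t' x X' ->
  bsde_solution P T B ft Pt t X Y Z -> bsde_solution P T B ft Pt t' X' Y' Z' ->
  {ae P, forall w, Y t w = c} -> {ae P, forall w, Y' t' w = c'} ->
  `|c - c'| <= A * (1 + enorm x) * Num.sqrt (t' - t).
Proof.
have [K K0 hK] := f_tilde_growth.
have [C1 C10 hC1] := sde_flow; have [C5 C50 hC5] := sde_moment.
have [C6 C60 hC6] := bsde_bound; have [C7 C70 hC7] := bsde_stability.
(* A gap of at most [delta] meets the absorption condition of [backward_step]. *)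
pose delta : R := (4 * K ^+ 2 + 1)^-1.
have K20 := sqr_ge0 K.
have k1 : 1 <= 4 * K ^+ 2 + 1 by rewrite lerDr mulr_ge0.
have delta0 : 0 < delta by rewrite invr_gt0; exact: lt_le_trans k1.
have delta1 : delta <= 1 by rewrite invf_le1//; exact: lt_le_trans k1.
(* The first summand comes from the difference of the solutions at [t'], the second from the driver
   of [Y] over [[t, t']]. *)
pose C9 := 2 * C7 * C1 + 8 * K ^+ 2 * (C5 + C6).
have C90 : 0 <= C9 by rewrite addr_ge0// !mulr_ge0// addr_ge0.
(* The first summand serves gaps up to [delta]. For larger ones, linear growth of both values
   suffices, because [sqrt (t' - t) / sqrt delta >= 1]. *)
exists (Num.sqrt C9 + 2 * Num.sqrt C6 / Num.sqrt delta).
  by rewrite addr_ge0// ?divr_ge0// ?mulr_ge0// sqrtr_ge0.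
move=> t t' x X X' Y Y' Z Z' c c' /andP[t0 tt'] t'T solX solX' solY solY' Yc Y'c'.
have g0 : 0 <= 1 + enorm x by rewrite addr_ge0// enorm_ge0.
have g20 := sqr_ge0 (1 + enorm x).
have tT : 0 <= t <= T by rewrite t0 (le_trans tt').
have t'0 := le_trans t0 tt'.
have t'T' : 0 <= t' <= T by rewrite t'0.
have tlT : t <= T := le_trans tt' t'T.
have dtt : 0 <= t' - t by rewrite subr_ge0.
have value_bound t1 X1 Y1 Z1 c1 : 0 <= t1 <= T -> sde_solution P T B bt st t1 x X1 ->
    bsde_solution P T B ft Pt t1 X1 Y1 Z1 -> {ae P, forall w, Y1 t1 w = c1} ->
    `|c1| <= Num.sqrt C6 * (1 + enorm x).
  move=> t1T sX1 sY1 Y1c1.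
  have t1t1 : t1 <= t1 <= T by rewrite lexx; case/andP: t1T.
  have := hC6 t1 x X1 Y1 Z1 t1 t1T sX1 sY1 t1t1.
  rewrite (_ : (\int[P]_w (Y1 t1 w ^+ 2)%:E = \int[P]_w (c1 ^+ 2)%:E)%E); last first.
    have [SY1 _ _] := sY1.
    have mY1 : measurable_fun setT (Y1 t1) by exact: S2_measurable_real SY1 t1t1.
    apply: ge0_ae_eq_integral => //.
    - by apply/measurable_EFinP; exact: measurable_funX.
    - by move=> w _; rewrite lee_fin sqr_ge0.
    - by move=> w _; rewrite lee_fin sqr_ge0.
    - by apply: filterS Y1c1 => w -> _.
  rewrite probability_integral_cst lee_fin => h.
  rewrite -(@ler_pXn2r _ 2)// ?nnegrE ?mulr_ge0 ?sqrtr_ge0//.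
  by rewrite real_normK ?num_real// exprMn sqr_sqrtr.
have [small|large] := leP (t' - t) delta; last first.
  have h := value_bound t X Y Z c tT solX solY Yc.
  have h' := value_bound t' X' Y' Z' c' t'T' solX' solY' Y'c'.
  apply: (@le_trans _ _ (2 * Num.sqrt C6 * (1 + enorm x))).
    by apply: (le_trans (ler_normB _ _)); lra.
  apply: (@le_trans _ _
    (2 * Num.sqrt C6 / Num.sqrt delta * (1 + enorm x) * Num.sqrt (t' - t))); last first.
    by rewrite ler_wpM2r ?sqrtr_ge0// ler_wpM2r// lerDr sqrtr_ge0.
  have sd : 0 < Num.sqrt delta by rewrite sqrtr_gt0.
  rewrite (_ : 2 * Num.sqrt C6 / Num.sqrt delta * (1 + enorm x) * Num.sqrt (t' - t) =
    2 * Num.sqrt C6 * (1 + enorm x) * (Num.sqrt (t' - t) / Num.sqrt delta)); last by field; rewrite gt_eqF.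
  apply: ler_peMr; first by rewrite !mulr_ge0// sqrtr_ge0.
  by rewrite ler_pdivlMr// mul1r ler_wsqrtr// ltW.
have SX := solX.1; have [SY pZ _] := solY; have [SY' _ _] := solY'.
have [I itoI [_ pY]] := bsde_path tT SX solY.
have mX := S2_joint tT SX.
have mY := S2_joint_real tT SY.
have mZ := progressive_measurable P_complete B_brownian tlT pZ.1.
have tt1 : t <= t' <= T by rewrite tt'.
have tt2 : t' <= t' <= T by rewrite lexx.
have mYt' := S2_measurable_real SY tt1.
have mY't' := S2_measurable_real SY' tt2.
have domS : dom t t' `<=` cdom t T by exact: dom_sub_closed.
have mcdom : measurable (cdom t T) by apply: measurableX => //; exact: measurable_itv.
pose F (p : R * Om) := 1 + enorm (X p.1 p.2) + `|Y p.1 p.2|.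
have mF : measurable_fun (dom t t') F.
  apply: (measurable_funS mcdom domS); apply: measurable_funD; last exact: measurableT_comp.
  by apply: measurable_funD => //; exact: measurable_enorm.
have F0 p : dom t t' p -> 0 <= F p by rewrite !addr_ge0// enorm_ge0.
have FM r : t < r <= t' -> (\int[P]_w (F (r, w) ^+ 2)%:E <= (2 * (C5 + C6) * (1 + enorm x) ^+ 2)%:E)%E.
  case/andP => tr rt'; have hr : t <= r <= T by rewrite (ltW tr) (le_trans rt').
  have mYr := S2_measurable_real SY hr.
  have mXr : measurable_fun setT (fun w => 1 + enorm (X r w)).
    by apply: measurable_funD => //; apply: measurable_enorm; exact: (S2_coord_measurable SX).
  apply: (le_trans (integral_sqrD P mXr (measurableT_comp (@normr_measurable R setT) mYr))).
  under [Z in (_ + _ * Z <= _)%E]eq_integral do rewrite real_normK ?num_real//.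
  have -> : (2 * (C5 + C6) * (1 + enorm x) ^+ 2)%:E =
      (2%:E * (C5 * (1 + enorm x) ^+ 2)%:E + 2%:E * (C6 * (1 + enorm x) ^+ 2)%:E)%E.
    by rewrite -!EFinM -EFinD; congr (_%:E); ring.
  apply: leeD; apply: lee_wpmul2l => //; [exact: hC5 hr|exact: hC6 solX solY hr].
have flow r : t' <= r <= T -> (msq P setT (fun w => (X r w - X' r w)%R) <=
    (C1 * ((t' - t) * (1 + enorm x) ^+ 2))%:E)%E.
  by apply: hC1 solX solX'; rewrite ?t0.
have tt0 : 0 <= t <= t' by rewrite t0.
have M0 : 0 <= C1 * ((t' - t) * (1 + enorm x) ^+ 2) by rewrite !mulr_ge0.
have V2 := hC7 t t' x x X X' Y Y' Z Z' _ t' tt0 t'T solX solX' solY solY' M0 flow tt2.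
have step := @backward_step R dO Om P T d B P_complete B_brownian t t' K
  (2 * (C5 + C6) * (1 + enorm x) ^+ 2) (cst (c - c')) (fun w => Y t' w - Y' t' w)
  (fun w => I t' w - I t w) (fun p => Z p.1 p.2) F t0 tt' t'T (le_trans small delta1) _ K0 _ _
  (measurable_funB mYt' mY't')
  (ito_integral_increment P_complete B_brownian t0 (lexx t) tt' t'T itoI) mF F0 FM.
have : (c - c') ^+ 2 <= C9 * ((t' - t) * (1 + enorm x) ^+ 2).
  rewrite -lee_fin -(probability_integral_cst P); apply: (le_trans (step _ _ _ _)).
  - apply: (@le_trans _ _ (4 * K ^+ 2 * delta)); first by rewrite ler_wpM2l// mulr_ge0.
    by rewrite ler_pdivrMr ?mul1r ?lerDl//; exact: lt_le_trans k1.
  - exact: measurable_cst.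
  - exact: (finite_measure_integrable_cst P ((c - c') ^+ 2)).
  - apply: filterS3 pY Yc Y'c' => w /(_ t t' (lexx t) tt' t'T)[iu e] eY eY'.
    rewrite (_ : _ - _ - _ = Y t' w - Y t w - (I t' w - I t w)); last by rewrite eY eY' /=; ring.
    rewrite e normrN; apply: abs_Rintegral_le => //.
    + apply: measurable_funM => //; apply: measurable_funD; last first.
        exact: (measurable_path_enorm w (lexx t) t'T mZ).
      apply: measurable_funD.
        apply: measurable_funD => //; exact: (measurable_path_enorm w (lexx t) t'T mX).
      exact: (measurable_path_abs w (lexx t) t'T mY).
    + move=> q; rewrite /= in_itv/= => /andP[tq qt'].
      by apply: hK; rewrite (le_trans t0 (ltW tq)) (le_trans qt' t'T).
  - apply: (@le_trans _ _ (2%:E * (C7 * (C1 * ((t' - t) * (1 + enorm x) ^+ 2)))%:E +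
      (4 * K ^+ 2 * (t' - t) * (2 * (C5 + C6) * (1 + enorm x) ^+ 2))%:E)%E).
      by apply: leeD => //; exact: lee_wpmul2l.
    rewrite -EFinM -EFinD lee_fin; apply: le_of_eq.
    by rewrite /C9; ring.
move=> h; apply: (@le_trans _ _ (Num.sqrt C9 * (1 + enorm x) * Num.sqrt (t' - t))); last first.
  by rewrite [leRHS]mulrAC [leLHS]mulrAC ler_wpM2r// ler_wpM2r ?sqrtr_ge0// lerDl divr_ge0// mulr_ge0 ?sqrtr_ge0.
rewrite -(@ler_pXn2r _ 2)// ?nnegrE ?mulr_ge0 ?sqrtr_ge0//.
rewrite real_normK ?num_real// !exprMn !sqr_sqrtr//.
by apply: (le_trans h); apply: le_of_eq; ring.
Qed.

End MeanField.

Theorem theorem5p2 (R : realType) (dO : measure_display)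
  (Om : measurableType dO) (P : probability Om R)
  (n d : nat) (T : R) (B : R -> Om -> 'rV[R]_d)
  (b : R -> 'rV[R]_n -> 'rV[R]_n -> 'rV[R]_n)
  (sigma : R -> 'rV[R]_n -> 'rV[R]_n -> 'M[R]_(n, d))
  (Phi : 'rV[R]_n -> 'rV[R]_n -> R)
  (f : R -> 'rV[R]_n -> 'rV[R]_n -> R -> R -> 'rV[R]_d -> R)
  (x0 : 'rV[R]_n)
  (X0 : R -> Om -> 'rV[R]_n) (Y0 : R -> Om -> R) (Z0 : R -> Om -> 'rV[R]_d)
  (X : R -> 'rV[R]_n -> R -> Om -> 'rV[R]_n)
  (Y : R -> 'rV[R]_n -> R -> Om -> R)
  (Z : R -> 'rV[R]_n -> R -> Om -> 'rV[R]_d)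
  (u : R -> 'rV[R]_n -> R)
  (T_gt0 : 0 < T)
  (P_complete : measure_is_complete P)
  (B_brownian : brownian_motion P T B)
  (coeff : exists2 C : R, 0 < C & coefficient_assumptions T b sigma Phi f C)
  (X0_sol : sde_solution P T B (b_tilde b P X0) (sigma_tilde sigma P X0) 0 x0 X0)
  (Y0_sol : bsde_solution P T B (f_tilde f P X0 Y0) (Phi_tilde T Phi P X0)
     0 X0 Y0 Z0)
  (X_sol : forall (t : R) (x : 'rV[R]_n), 0 <= t <= T ->
     sde_solution P T B (b_tilde b P X0) (sigma_tilde sigma P X0) t x (X t x))
  (Y_sol : forall (t : R) (x : 'rV[R]_n), 0 <= t <= T ->
     bsde_solution P T B (f_tilde f P X0 Y0) (Phi_tilde T Phi P X0)
       t (X t x) (Y t x) (Z t x))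
  (u_value : forall (t : R) (x : 'rV[R]_n), 0 <= t <= T ->
     {ae P, forall w, Y t x t w = u t x}) :
  exists C : R, forall (x : 'rV[R]_n) (t t' : R),
    0 <= t <= T -> 0 <= t' <= T ->
    `|u t x - u t' x| <= C * (1 + enorm x) * `|t - t'| `^ 2^-1.
Proof.
have [C C0 hC] := coeff.
have X0_S2 := X0_sol.1; have [Y0_S2 _ _] := Y0_sol.
have [A A0 hA] := value_increment P_complete B_brownian T_gt0 C0 hC X0_S2 Y0_S2.
exists A => x t t' tT t'T; rewrite powR12_sqrt//.
(* The claim is symmetric in the two times, while [value_increment] is oriented. *)
wlog tt' : t t' tT t'T / t <= t'.
  move=> h; have [tt'|/ltW t't] := leP t t'; first exact: h.
  by rewrite distrC [`|t - t'|]distrC; exact: h.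
have [t0 _] := andP tT; have [_ t'_T] := andP t'T.
have -> : `|t - t'| = t' - t by rewrite distrC ger0_norm ?subr_ge0.
have tt0 : 0 <= t <= t' by rewrite t0.
exact: (hA t t' x _ _ _ _ _ _ _ _ tt0 t'_T (X_sol t x tT) (X_sol t' x t'T) (Y_sol t x tT) (Y_sol t' x t'T)
  (u_value t x tT) (u_value t' x t'T)).
Qed.
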